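(* For every Turing degree $\mathbf{d}$ there exists a compact metrizable space $\mathcal{Z}_{\mathbf{d}}$ whose compact degree spectrum is $\{\mathbf{x} : \mathbf{d}\leq \mathbf{x}'\}$.
   Context: A Polish presentation of a Polish space $X$ is a metric $d$ on $\omega$ whose Cauchy completion is homeomorphic to $X$; let $a_i$ denote the point of the completion corresponding to $i\in\omega$. It is $\mathbf{x}$-computable if the reals $d(i,j)$ are uniformly $\mathbf{x}$-computable. For compact $X$, a code of a finite rational open cover is a finite set $E\subseteq \omega\times\mathbb{Q}$ such that every $x\in X$ satisfies $d(x,a_i)<r$ for some $(i,r)\in E$. A compact presentation of $X$ is a Polish presentation together with an enumeration of the set of all codes of finite rational open covers of $X$; it is $\mathbf{x}$-computable if the metric is $\mathbf{x}$-computable and this set of codes is $\mathbf{x}$-c.e. The compact degree spectrum of a compact metrizable space $X$ is the set of Turing degrees $\mathbf{x}$ such that $X$ has an $\mathbf{x}$-computable compact presentation. $\mathbf{x}'$ denotes the Turing jump. *)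

(* Defs.v *)
From HB Require Import structures.
From Stdlib Require Arith.Cantor.
From mathcomp Require Import all_boot all_order all_algebra finmap generic_quotient.
From mathcomp Require Import all_classical all_reals.
From mathcomp Require Import topology normedtype sequences.

Set Implicit Arguments.
Unset Strict Implicit.
Unset Printing Implicit Defensive.

Import Order.TTheory GRing.Theory Num.Theory.
Import numFieldNormedType.Exports.

Local Open Scope classical_set_scope.
Local Open Scope ring_scope.
Local Open Scope quotient_scope.

Definition npair (a b : nat) : nat := Cantor.to_nat (a, b).
Definition nfst (n : nat) : nat := (Cantor.of_nat n).1.
Definition nsnd (n : nat) : nat := (Cantor.of_nat n).2.

Lemma npairK1 a b : nfst (npair a b) = a.
Proof. by rewrite /nfst /npair Cantor.cancel_of_to. Qed.

Lemma npairK2 a b : nsnd (npair a b) = b.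
Proof. by rewrite /nsnd /npair Cantor.cancel_of_to. Qed.

Lemma nfst_nsndK n : npair (nfst n) (nsnd n) = n.
Proof.
by rewrite /npair /nfst /nsnd -surjective_pairing Cantor.cancel_to_of.
Qed.

(** Partial recursive functions relative to an oracle, as unary programs on
    [nat]; several arguments are passed through the pairing function. *)
Inductive code : Type :=
| Zero | Succ | Left | Right | Query
| Pair of code & code
| Comp of code & code
| Prec of code & code
| Search of code.

(** [eval A c n v]: program [c] with oracle [A] halts on [n] with value [v].
    [Prec f g] maps <a, 0> to f a and <a, k+1> to g <a, <k, r>>, where r is its
    value at <a, k>; [Search f] maps a to the least k with f <a, k> = 0, f being
    defined at all <a, j> with j < k. *)
Fixpoint eval (A : set nat) (c : code) (n v : nat) {struct c} : Prop :=
  match c with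
  | Zero => v = 0%N
  | Succ => v = n.+1
  | Left => v = nfst n
  | Right => v = nsnd n
  | Query => v = (n \in A)
  | Pair f g => exists a b, [/\ eval A f n a, eval A g n b & v = npair a b]
  | Comp f g => exists2 m, eval A g n m & eval A f m v
  | Prec f g =>
      (fix rec (k w : nat) : Prop :=
         if k is j.+1 then
           exists2 r, rec j r & eval A g (npair (nfst n) (npair j r)) w
         else eval A f (nfst n) w) (nsnd n) v
  | Search f =>
      eval A f (npair n v) 0%N /\
      forall j, (j < v)%N -> exists w, eval A f (npair n j) w.+1
  end.

Fixpoint code_num (c : code) : nat :=
  match c with
  | Zero => 0
  | Succ => 1
  | Left => 2
  | Right => 3
  | Query => 4
  | Pair f g => 5 + 4 * npair (code_num f) (code_num g)
  | Comp f g => 6 + 4 * npair (code_num f) (code_num g)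
  | Prec f g => 7 + 4 * npair (code_num f) (code_num g)
  | Search f => 8 + 4 * code_num f
  end%N.

Definition halts (A : set nat) (c : code) (n : nat) : Prop :=
  exists v, eval A c n v.

Definition ce_in (A S : set nat) : Prop :=
  exists c, S = [set n | halts A c n].

Definition turing_le (B A : set nat) : Prop :=
  exists c, forall n, eval A c n (n \in B).

Definition turing_jump (A : set nat) : set nat :=
  [set e | exists2 c, e = code_num c & halts A c e].

Lemma eval_inj A c n v w : eval A c n v -> eval A c n w -> v = w.
Proof.
elim: c n v w => [||||
  |f IHf g IHg|f IHf g IHg|f IHf g IHg|f IHf] n v w /=; try by move=> -> ->.
- move=> [a [b [fa gb ->]]] [a' [b' [fa' gb' ->]]].
  by rewrite (IHf _ _ _ fa fa') (IHg _ _ _ gb gb').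
- by move=> [m gm fv] [m' gm']; rewrite (IHg _ _ _ gm' gm); exact: IHf.
- move: (nsnd n) => k; elim: k v w => [|k IHk] v w; first exact: IHf.
  by move=> [r hr gr] [r' hr']; rewrite (IHk _ _ hr' hr); exact: IHg.
- move=> [fv minv] [fw minw]; case: (ltngtP v w) => // lt_vw.
  + by have [u fu] := minw _ lt_vw; have := IHf _ _ _ fv fu.
  + by have [u fu] := minv _ lt_vw; have := IHf _ _ _ fw fu.
Qed.

Fixpoint code_subst (q c : code) : code :=
  match c with
  | Query => q
  | Pair f g => Pair (code_subst q f) (code_subst q g)
  | Comp f g => Comp (code_subst q f) (code_subst q g)
  | Prec f g => Prec (code_subst q f) (code_subst q g)
  | Search f => Search (code_subst q f)
  | Zero | Succ | Left | Right => c
  end.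

Lemma eval_subst A B q c n v : (forall k, eval A q k (k \in B)) ->
  eval A (code_subst q c) n v <-> eval B c n v.
Proof.
move=> qB; elim: c n v => [||||
  |f IHf g IHg|f IHf g IHg|f IHf g IHg|f IHf] n v //=.
- split=> [qv|->//]; exact: eval_inj qv (qB n).
- by split=> -[a [b [/IHf ? /IHg ? ->]]]; exists a, b.
- by split=> -[m /IHg ? /IHf ?]; exists m.
- move: (nsnd n) => k; elim: k v => [|k IHk] v; first exact: IHf.
  by split=> -[r /IHk ? /IHg ?]; exists r.
- by split=> -[/IHf ? minv]; split=> // j /minv[w /IHf ?]; exists w.
Qed.

Lemma turing_le_refl A : turing_le A A.
Proof. by exists Query. Qed.

Lemma turing_le_trans B A C : turing_le A B -> turing_le B C -> turing_le A C.
Proof.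
by move=> [c cA] [q qB]; exists (code_subst q c) => n; apply/(eval_subst _ _ _ qB).
Qed.

Lemma ce_in_turing_le A B S : turing_le A B -> ce_in A S -> ce_in B S.
Proof.
move=> [q qA] [c ->]; exists (code_subst q c); apply/seteqP.
by split=> n [v]; exists v; apply/(eval_subst _ _ _ qA).
Qed.

Definition turing_eqb (A B : set nat) : bool :=
  `[< turing_le A B >] && `[< turing_le B A >].

Lemma turing_eqb_refl : reflexive turing_eqb.
Proof. by move=> A; apply/andP; split; apply/asboolP; exact: turing_le_refl. Qed.

Lemma turing_eqb_sym : symmetric turing_eqb.
Proof. by move=> A B; rewrite /turing_eqb andbC. Qed.

Lemma turing_eqb_trans : transitive turing_eqb.
Proof.
move=> B A C /andP[/asboolP AB /asboolP BA] /andP[/asboolP BC /asboolP CB].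
by apply/andP; split; apply/asboolP; apply: turing_le_trans; eassumption.
Qed.

Canonical turing_equiv :=
  EquivRel turing_eqb turing_eqb_refl turing_eqb_sym turing_eqb_trans.

Definition turing_degree : Type := {eq_quot turing_equiv}.

HB.instance Definition _ := Choice.on turing_degree.
HB.instance Definition _ := EqQuotient.on turing_degree.

Definition deg (A : set nat) : turing_degree := \pi_turing_degree A.

(** Order and jump on degrees go through the representative chosen by the
    quotient; both are invariant under Turing equivalence. *)
Definition degree_le (x y : turing_degree) : Prop := turing_le (repr x) (repr y).
Definition degree_jump (x : turing_degree) : turing_degree :=
  deg (turing_jump (repr x)).

Lemma turing_le_repr A : turing_le A (repr (deg A)) /\ turing_le (repr (deg A)) A.
Proof.
have /eqmodP : repr (deg A) = A %[mod turing_degree] by rewrite reprK.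
by move=> /andP[/asboolP ? /asboolP ?].
Qed.

Lemma degree_leE A B : degree_le (deg A) (deg B) <-> turing_le A B.
Proof.
have [[A1 A2] [B1 B2]] := (turing_le_repr A, turing_le_repr B).
split=> AB.
- exact: turing_le_trans (turing_le_trans A1 AB) B2.
- exact: turing_le_trans (turing_le_trans A2 AB) B1.
Qed.

(** Surjection of [nat] onto [rat]. *)
Definition rat_of_nat (n : nat) : rat :=
  ((nfst (nfst n))%:R - (nsnd (nfst n))%:R) / (nsnd n).+1%:R.

Definition formal_ball_of_nat (n : nat) : nat * rat := (nfst n, rat_of_nat (nsnd n)).

Fixpoint seq_num (s : seq nat) : nat :=
  if s is k :: s' then (npair k (seq_num s')).+1 else 0%N.

(** All numbers of all listings of the finite sets in [S]. *)
Definition fset_nums (S : set {fset nat * rat}) : set nat :=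
  [set n | exists2 s : seq nat, n = seq_num s &
    S [fset p in map formal_ball_of_nat s]%fset].

Record nat_metric (R : realType) := NatMetric {
  nat_dist :> nat -> nat -> R ;
  nat_distxx : forall i, nat_dist i i = 0 ;
  nat_dist_pos : forall i j, nat_dist i j = 0 -> i = j ;
  nat_dist_sym : forall i j, nat_dist i j = nat_dist j i ;
  nat_dist_triangle : forall j i k, nat_dist i k <= nat_dist i j + nat_dist j k
}.

Section Completion.
Context {R : realType} (M : nat_metric R).

Definition is_cauchy (u : nat -> nat) : Prop :=
  forall e : R, 0 < e ->
    exists N, forall m n, (N <= m)%N -> (N <= n)%N -> M (u m) (u n) < e.

Definition cauchy_seq : Type := {u : nat -> nat | `[< is_cauchy u >]}.
HB.instance Definition _ := Choice.on cauchy_seq.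

Definition cauchy_dist (u v : cauchy_seq) : R :=
  limn (fun n => M (val u n) (val v n)).

Lemma cauchy_seqP (u : cauchy_seq) : is_cauchy (val u).
Proof. by apply/asboolP; exact: (valP u). Qed.

Lemma nat_dist_quad (a b c d : nat) : `|M a b - M c d| <= M a c + M b d.
Proof.
have h1 := nat_dist_triangle M c a b; have h2 := nat_dist_triangle M d c b.
have h3 := nat_dist_triangle M a c d; have h4 := nat_dist_triangle M b a d.
rewrite ler_norml; apply/andP; split.
  rewrite lerNl opprB lerBlDr (le_trans h3)// (nat_dist_sym M c a) -addrA lerD2l.
  by rewrite addrC.
rewrite lerBlDr (le_trans h1)// -addrA lerD2l (nat_dist_sym M b d) addrC//.
Qed.

Lemma cauchy_dist_cvg (u v : cauchy_seq) :
  M (val u n) (val v n) @[n --> \oo] --> cauchy_dist u v.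
Proof.
suff : cauchy_ex ((fun n => M (val u n) (val v n)) @ \oo).
  by move=> /cauchy_exP; exact: cauchy_cvg.
move=> e e0.
have e20 : 0 < e / 2 by rewrite divr_gt0.
have [N1 h1] := cauchy_seqP u e20; have [N2 h2] := cauchy_seqP v e20.
pose N := maxn N1 N2.
exists (M (val u N) (val v N)); exists N => // n /= Nn.
rewrite /ball /= (le_lt_trans (nat_dist_quad _ _ _ _))// (splitr e).
have := Nn; rewrite geq_max => /andP[? ?].
by rewrite ltrD// ?h1 ?h2// ?leq_maxl ?leq_maxr.
Qed.

Lemma cauchy_distxx u : cauchy_dist u u = 0.
Proof.
rewrite /cauchy_dist; under eq_fun do rewrite nat_distxx.
exact: lim_cst.
Qed.

Lemma cauchy_dist_sym u v : cauchy_dist u v = cauchy_dist v u.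
Proof. by rewrite /cauchy_dist; under eq_fun do rewrite nat_dist_sym. Qed.

Lemma cauchy_dist_triangle v u w :
  cauchy_dist u w <= cauchy_dist u v + cauchy_dist v w.
Proof.
have cD : (M (val u n) (val v n) + M (val v n) (val w n)) @[n --> \oo] -->
    cauchy_dist u v + cauchy_dist v w.
  by apply: cvgD; exact: cauchy_dist_cvg.
rewrite -(cvg_lim (@Rhausdorff R) cD).
apply: ler_lim; first exact: cvgP (@cauchy_dist_cvg u w).
  exact: cvgP cD.
by apply: nearW => n; exact: nat_dist_triangle.
Qed.

Lemma cauchy_dist_ge0 u v : 0 <= cauchy_dist u v.
Proof.
rewrite -(@pmulrn_lge0 _ _ 2)// -(cauchy_distxx u).
by rewrite (le_trans (cauchy_dist_triangle v _ _))// (cauchy_dist_sym v u) -mulr2n.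
Qed.

Definition cauchy_eqb (u v : cauchy_seq) : bool := cauchy_dist u v == 0.

Lemma cauchy_eqb_refl : reflexive cauchy_eqb.
Proof. by move=> u; rewrite /cauchy_eqb cauchy_distxx. Qed.

Lemma cauchy_eqb_sym : symmetric cauchy_eqb.
Proof. by move=> u v; rewrite /cauchy_eqb cauchy_dist_sym. Qed.

Lemma cauchy_eqb_trans : transitive cauchy_eqb.
Proof.
move=> v u w /eqP uv /eqP vw; rewrite /cauchy_eqb eq_le cauchy_dist_ge0 andbT.
by rewrite (le_trans (cauchy_dist_triangle v _ _))// uv vw addr0.
Qed.

Canonical cauchy_equiv :=
  EquivRel cauchy_eqb cauchy_eqb_refl cauchy_eqb_sym cauchy_eqb_trans.

Definition completion : Type := {eq_quot cauchy_equiv}.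
HB.instance Definition _ := Choice.on completion.
HB.instance Definition _ := EqQuotient.on completion.

Definition completion_dist (x y : completion) : R := cauchy_dist (repr x) (repr y).

Lemma completion_distxx x : completion_dist x x = 0.
Proof. exact: cauchy_distxx. Qed.

Lemma completion_dist_pos x y : completion_dist x y = 0 -> x = y.
Proof.
by move=> /eqP xy; rewrite -[x]reprK -[y]reprK; apply/eqmodP.
Qed.

Lemma completion_dist_sym x y : completion_dist x y = completion_dist y x.
Proof. exact: cauchy_dist_sym. Qed.

Lemma completion_dist_triangle y x z :
  completion_dist x z <= completion_dist x y + completion_dist y z.
Proof. exact: cauchy_dist_triangle. Qed.

HB.instance Definition _ := isMetric.Build R completion
  completion_distxx completion_dist_pos completion_dist_sym
  completion_dist_triangle.

Lemma cst_is_cauchy (i : nat) : `[< is_cauchy (fun=> i) >].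
Proof. by apply/asboolP => e e0; exists 0%N => m n _ _; rewrite nat_distxx. Qed.

Definition special_point (i : nat) : completion :=
  \pi_completion (exist _ (fun=> i) (cst_is_cauchy i) : cauchy_seq).

Lemma mdist_pi (u v : cauchy_seq) :
  mdist (\pi_completion u) (\pi_completion v) = cauchy_dist u v.
Proof.
have hr (w : cauchy_seq) : cauchy_dist (repr (\pi_completion w)) w = 0.
  have /eqmodP/eqP// : repr (\pi_completion w) = w %[mod completion].
  by rewrite reprK.
apply/eqP; rewrite eq_le /mdist /= /completion_dist; apply/andP; split.
  rewrite (le_trans (cauchy_dist_triangle u _ _))// hr add0r.
  by rewrite (le_trans (cauchy_dist_triangle v _ _))// (cauchy_dist_sym v) hr addr0.
rewrite (le_trans (cauchy_dist_triangle (repr (\pi_completion u)) _ _))//.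
rewrite cauchy_dist_sym hr add0r.
rewrite (le_trans (cauchy_dist_triangle (repr (\pi_completion v)) _ _))//.
by rewrite hr addr0.
Qed.

Lemma mdist_special_point i j : mdist (special_point i) (special_point j) = M i j.
Proof. by rewrite mdist_pi /cauchy_dist /= lim_cst. Qed.

End Completion.

Definition homeomorphic (X Y : topologicalType) : Prop :=
  exists (f : X -> Y) (g : Y -> X),
    [/\ cancel f g, cancel g f, continuous f & continuous g].

Definition metrizable (R : realType) (X : topologicalType) : Prop :=
  exists M : metricType R, homeomorphic X M.

Definition cover_code (R : realType) (M : nat_metric R) : set {fset nat * rat} :=
  [set E | forall x : completion M,
    exists2 p, p \in E & mdist x (special_point M p.1) < ratr p.2].

Record compact_presentation (R : realType) (X : topologicalType) :=
  CompactPresentation {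
    cp_metric : nat_metric R ;
    cp_homeo : homeomorphic (completion cp_metric) X ;
    cp_enum : nat -> {fset nat * rat} ;
    cp_enumP : range cp_enum = cover_code cp_metric
}.

Definition computable_metric (R : realType) (A : set nat) (M : nat_metric R) :
    Prop :=
  exists c, forall i j n, exists2 m,
    eval A c (npair i (npair j n)) m &
    `|M i j - ratr (rat_of_nat m)| <= 2 ^- n.

Definition computable_presentation (R : realType) (X : topologicalType)
    (A : set nat) (P : compact_presentation R X) : Prop :=
  computable_metric A (cp_metric P) /\
  ce_in A (fset_nums (cover_code (cp_metric P))).

Lemma computable_presentation_turing_le (R : realType) (X : topologicalType)
    (A B : set nat) (P : compact_presentation R X) : turing_le A B ->
  computable_presentation A P -> computable_presentation B P.
Proof.
move=> AB [[c cM] ceP]; split; last exact: ce_in_turing_le AB ceP.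
have [q qA] := AB; exists (code_subst q c) => i j n.
by have [m cm Mm] := cM i j n; exists m => //; apply/(eval_subst _ _ _ qA).
Qed.

Definition compact_degree_spectrum (R : realType) (X : topologicalType) :
    set turing_degree :=
  [set x | exists P : compact_presentation R X, computable_presentation (repr x) P].

Lemma compact_degree_spectrumE (R : realType) (X : topologicalType) (A : set nat) :
  compact_degree_spectrum R X (deg A) <->
  exists P : compact_presentation R X, computable_presentation A P.
Proof.
have [A1 A2] := turing_le_repr A.
by split=> -[P cP]; exists P; apply: computable_presentation_turing_le cP.
Qed.

(* Main.v *)
From Stdlib Require Arith.Cantor.
From mathcomp Require Import all_boot all_order all_algebra.
From mathcomp Require Import finmap generic_quotient.
From mathcomp Require Import all_classical all_reals.
From mathcomp Require Import topology normedtype.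
From mathcomp Require Import zify lra.
Require Import Defs.

(** A set [S] is computable from the jump of [A] iff
    [D = {<n, b> | b = S(n)}] is Sigma_2 in [A], so it suffices to code an
    arbitrary set [D] into a compact space that has an [A]-computable compact
    presentation iff [D] is Sigma_2 in [A].

    The space is a sequence of unit arcs ("legs") converging to a limit arc.
    Certain groups of legs are associated with numbers [n]; a group for [n] has
    [n + 2] legs, and if it is "good" all of them share their left endpoint, so
    that they form a star; otherwise they are pairwise disjoint.  Infinitely many
    groups for [n] are good if [n] is in [D], none if it is not, and infinitely
    many are bad in any case; this determines the space up to homeomorphism.

    If [D n <-> exists a, forall b, Q n a b], a presentation is obtained by
    attaching the groups for [n] to the numbers [a] and keeping the left endpoints
    of such a group within 1 / (b + 1) of each other as long as no failure of
    [Q n a] below [b] has been found.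

    Conversely, [n] is in [D] iff the space has a clopen connected subset whose
    part to the right of a fixed region falls into at least [n + 2] but not into
    [n + 3] pieces.  Since covers are enumerable, falling into at least [k] pieces
    is a Sigma_1 property and connectedness is Pi_1, which gives a Sigma_2
    definition.  The global left-right coordinate, of which a presentation knows
    two finite unions of balls, prevents a leg from being contracted into the
    centre of a star and is what makes the count exact. *)

Set Implicit Arguments.
Unset Strict Implicit.
Unset Printing Implicit Defensive.

Import Order.TTheory GRing.Theory Num.Theory.
Import numFieldNormedType.Exports.

Local Open Scope classical_set_scope.

(** * Functions and relations computable from an oracle *)

(** It is the graph of S that is coded, because each n has exactly one value b: with the jump one
    can search for b together with its witness, so one Sigma_2 condition replaces a pair of them.
    All legs have unit length and accumulate on an arc rather than on a point, so the coordinate has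
    the same range on each of them and the same two unions of balls serve all legs at once. These
    lists are found non-effectively, but they are finite. With n + 2 legs, at least two, a star is
    never confused with the isolated arcs, which are always present. The number of witnesses a for
    [Q n] depends on the normal form and hence on the oracle, while the space must not. So each test
    is repeated infinitely often and bad groups are added; the groups for each n can then be matched
    by a permutation. The gap inside a group is a real that can be approximated but not tested for
    zero; this is why both good and bad groups can be built without knowing which is which. *)

Section Recursive.
Variable A : set nat.

Definition rec_fun (f : nat -> nat) : Prop :=
  exists c, forall n, eval A c n (f n).

Lemma rec_id : rec_fun (fun n => n).
Proof.
by exists (Pair Left Right) => n /=; exists (nfst n), (nsnd n); rewrite nfst_nsndK.
Qed.

Lemma rec_comp f g : rec_fun f -> rec_fun g -> rec_fun (fun n => f (g n)).
Proof. by move=> [c cf] [e eg]; exists (Comp c e) => n; exists (g n). Qed.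

Lemma rec_S f : rec_fun f -> rec_fun (fun n => (f n).+1).
Proof. by move=> fr; apply: (@rec_comp succn) => //; exists Succ. Qed.

Lemma rec_cst k : rec_fun (fun=> k).
Proof. by elim: k => [|k IH]; [exists Zero | exact: rec_S]. Qed.

Lemma rec_nfst f : rec_fun f -> rec_fun (fun n => nfst (f n)).
Proof. by move=> fr; apply: (@rec_comp nfst) => //; exists Left. Qed.

Lemma rec_nsnd f : rec_fun f -> rec_fun (fun n => nsnd (f n)).
Proof. by move=> fr; apply: (@rec_comp nsnd) => //; exists Right. Qed.

Lemma rec_npair f g :
  rec_fun f -> rec_fun g -> rec_fun (fun n => npair (f n) (g n)).
Proof.
by move=> [c cf] [e eg]; exists (Pair c e) => n; exists (f n), (g n).
Qed.

Lemma rec_prim (f b : nat -> nat) (g : nat -> nat -> nat -> nat) :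
  rec_fun f -> rec_fun b ->
  rec_fun (fun m => g (nfst m) (nfst (nsnd m)) (nsnd (nsnd m))) ->
  rec_fun (fun n => nat_rect (fun=> nat) (f n) (g n) (b n)).
Proof.
move=> [c cf] br [e eg].
pose F m := nat_rect (fun=> nat) (f (nfst m)) (g (nfst m)) (nsnd m).
have Fr : rec_fun F.
  exists (Prec c e) => m /=; rewrite /F.
  elim: (nsnd m) => [|k IH] /=; first exact: cf.
  exists (nat_rect (fun=> nat) (f (nfst m)) (g (nfst m)) k) => //.
  by have := eg (npair (nfst m) (npair k (nat_rect (fun=> nat) (f (nfst m)) (g (nfst m)) k)));
    rewrite !(npairK1, npairK2).
have := rec_comp Fr (rec_npair rec_id br).
by rewrite /F; congr rec_fun; apply/funext => n; rewrite npairK1 npairK2.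
Qed.

Lemma rec_ext f g : f =1 g -> rec_fun f -> rec_fun g.
Proof. by move=> /funext ->. Qed.

Lemma rec_add f g : rec_fun f -> rec_fun g -> rec_fun (fun n => f n + g n)%N.
Proof.
move=> fr gr; have := rec_prim (g := fun _ _ r => r.+1) fr gr
  (rec_S (rec_nsnd (rec_nsnd rec_id))).
by apply: rec_ext => n; elim: (g n) => [|k /= ->]; rewrite ?addn0 ?addnS.
Qed.

Lemma rec_mul f g : rec_fun f -> rec_fun g -> rec_fun (fun n => f n * g n)%N.
Proof.
move=> fr gr; have := rec_prim (g := fun n _ r => (r + f n)%N) (rec_cst 0) gr
  (rec_add (rec_nsnd (rec_nsnd rec_id)) (rec_comp fr (rec_nfst rec_id))).
by apply: rec_ext => n; elim: (g n) => [|k /= ->]; rewrite ?muln0 // mulnS addnC.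
Qed.

Lemma rec_pred f : rec_fun f -> rec_fun (fun n => (f n).-1).
Proof.
move=> fr; have := rec_prim (g := fun _ k _ => k) (rec_cst 0) fr
  (rec_nfst (rec_nsnd rec_id)).
by apply: rec_ext => n; case: (f n).
Qed.

Lemma rec_sub f g : rec_fun f -> rec_fun g -> rec_fun (fun n => f n - g n)%N.
Proof.
move=> fr gr; have := rec_prim (g := fun _ _ r => r.-1) fr gr
  (rec_pred (rec_nsnd (rec_nsnd rec_id))).
by apply: rec_ext => n; elim: (g n) => [|k /= ->]; rewrite ?subn0 ?subnS.
Qed.

Lemma rec_expn2 f : rec_fun f -> rec_fun (fun n => 2 ^ f n)%N.
Proof.
move=> fr; have := rec_prim (g := fun _ _ r => (r + r)%N) (rec_cst 1) fr
  (rec_add (rec_nsnd (rec_nsnd rec_id)) (rec_nsnd (rec_nsnd rec_id))).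
by apply: rec_ext => n; elim: (f n) => [|k /= ->] //; rewrite expnS mul2n addnn.
Qed.

Definition rec_dec (P : nat -> Prop) : Prop :=
  exists2 f, rec_fun f & forall n, P n <-> f n = 0%N.

Lemma dec_ext P Q : (forall n, P n <-> Q n) -> rec_dec P -> rec_dec Q.
Proof. by move=> PQ [f fr fP]; exists f => // n; rewrite -PQ. Qed.

Lemma dec_comp P f : rec_dec P -> rec_fun f -> rec_dec (fun n => P (f n)).
Proof. by move=> [g gr gP] fr; exists (g \o f); [exact: rec_comp|move=> n /=]. Qed.

Lemma dec_not P : rec_dec P -> rec_dec (fun n => ~ P n).
Proof.
move=> [f fr fP]; exists (fun n => 1 - f n)%N.
  by apply: rec_sub => //; exact: rec_cst.
by move=> n; rewrite fP; lia.
Qed.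

Lemma dec_and P Q : rec_dec P -> rec_dec Q -> rec_dec (fun n => P n /\ Q n).
Proof.
move=> [f fr fP] [g gr gP]; exists (fun n => f n + g n)%N; first exact: rec_add.
by move=> n; rewrite fP gP; lia.
Qed.

Lemma dec_or P Q : rec_dec P -> rec_dec Q -> rec_dec (fun n => P n \/ Q n).
Proof.
move=> [f fr fP] [g gr gP]; exists (fun n => f n * g n)%N; first exact: rec_mul.
by move=> n; rewrite fP gP; lia.
Qed.

Lemma dec_imp P Q : rec_dec P -> rec_dec Q -> rec_dec (fun n => P n -> Q n).
Proof.
move=> Pd Qd; apply: dec_ext (dec_or (dec_not Pd) Qd) => n.
by split=> [[]//|PQ]; have [/PQ|] := pselect (P n); [right|left].
Qed.

Lemma dec_lt f g : rec_fun f -> rec_fun g -> rec_dec (fun n => f n < g n)%N.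
Proof.
move=> fr gr; exists (fun n => (f n).+1 - g n)%N; last by move=> n; lia.
by apply: rec_sub => //; exact: rec_S.
Qed.

Lemma dec_eq f g : rec_fun f -> rec_fun g -> rec_dec (fun n => f n = g n).
Proof.
move=> fr gr; exists (fun n => (f n - g n) + (g n - f n))%N; last by move=> n; lia.
by apply: rec_add; exact: rec_sub.
Qed.

Lemma dec_oracle f : rec_fun f -> rec_dec (fun n => A (f n)).
Proof.
move=> fr; exists (fun n => 1 - nat_of_bool (f n \in A))%N.
  apply: rec_sub; first exact: rec_cst.
  by apply: (@rec_comp (fun n => nat_of_bool (n \in A))) => //; exists Query.
by move=> n; rewrite -(in_setE A); case: (f n \in A); split.
Qed.

Lemma dec_ball (P : nat -> nat -> Prop) b : rec_fun b ->
  rec_dec (fun m => P (nfst m) (nsnd m)) ->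
  rec_dec (fun n => forall j, (j < b n)%N -> P n j).
Proof.
move=> br [f fr fP].
(* A sum of decision values vanishes iff each of them does. *)
exists (fun n => nat_rect (fun=> nat) 0%N (fun k r => (r + f (npair n k))%N) (b n)).
  apply: (rec_prim (g := fun n k r => (r + f (npair n k))%N)) => //; first exact: rec_cst.
  apply: rec_add; first by do 2 apply: rec_nsnd; exact: rec_id.
  apply: rec_comp => //; apply: rec_npair; first by apply: rec_nfst; exact: rec_id.
  by apply: rec_nfst; apply: rec_nsnd; exact: rec_id.
move=> n; elim: (b n) => [|k IH] /=; first by split.
rewrite (_ : (_ + _ = 0)%N <-> nat_rect (fun=> nat) 0%N (fun k r => (r + f (npair n k))%N) k = 0%N
   /\ f (npair n k) = 0%N); last by lia.
rewrite -IH -fP npairK1 npairK2; split=> [H|[H1 H2] j].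
  by split=> [j jk|]; apply: H => //; lia.
by rewrite ltnS leq_eqVlt => /orP[/eqP ->//|]; exact: H1.
Qed.

Lemma dec_bex (P : nat -> nat -> Prop) b : rec_fun b ->
  rec_dec (fun m => P (nfst m) (nsnd m)) ->
  rec_dec (fun n => exists2 j, (j < b n)%N & P n j).
Proof.
move=> br Pd.
apply: dec_ext (dec_not (dec_ball (P := fun n j => ~ P n j) br (dec_not Pd))) => n.
split=> [/existsNP[j /not_implyP[jb /contrapT Pj]]|[j jb Pj] /(_ j jb)]; last by [].
by exists j.
Qed.

(** Primitive recursion along the decision value: the base is [f n], and every successor step
    discards the previous result and returns [g n]. *)
Lemma rec_if P f g : rec_dec P -> rec_fun f -> rec_fun g ->
  rec_fun (fun n => if `[< P n >] then f n else g n).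
Proof.
move=> [h hr hP] fr gr.
have := rec_prim (g := fun n _ _ => g n) fr hr (rec_comp gr (rec_nfst rec_id)).
apply: rec_ext => n; case: asboolP; rewrite hP; first by move=> ->.
by case: (h n).
Qed.

Definition sigma1 (P : nat -> Prop) : Prop :=
  exists2 Q : nat -> nat -> Prop, rec_dec (fun m => Q (nfst m) (nsnd m)) &
    forall n, P n <-> exists a, Q n a.

Lemma s1_ext P Q : (forall n, P n <-> Q n) -> sigma1 P -> sigma1 Q.
Proof. by move=> PQ [R Rd RP]; exists R => // n; rewrite -PQ. Qed.

Lemma s1_dec P : rec_dec P -> sigma1 P.
Proof.
move=> Pd; exists (fun n _ => P n); first exact: (dec_comp Pd (rec_nfst rec_id)).
by move=> n; split=> [|[]//]; exists 0%N.
Qed.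

Lemma s1_comp P f : sigma1 P -> rec_fun f -> sigma1 (fun n => P (f n)).
Proof.
move=> [Q Qd QP] fr; exists (fun n a => Q (f n) a) => //.
apply: dec_ext (dec_comp Qd (rec_npair (rec_comp fr (rec_nfst rec_id)) (rec_nsnd rec_id))) => n.
by rewrite npairK1 npairK2.
Qed.

Lemma s1_ex (P : nat -> nat -> Prop) :
  sigma1 (fun m => P (nfst m) (nsnd m)) -> sigma1 (fun n => exists a, P n a).
Proof.
move=> [Q Qd QP]; exists (fun n b => Q (npair n (nfst b)) (nsnd b)).
  apply: dec_ext (dec_comp Qd (rec_npair (rec_npair (rec_nfst rec_id)
    (rec_nfst (rec_nsnd rec_id))) (rec_nsnd (rec_nsnd rec_id)))) => n.
  by rewrite npairK1 npairK2.
move=> n; split=> [[a Pa]|[b Qb]].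
  have [b Qb] := (QP (npair n a)).1 (eq_ind_r (fun x => P x _) (eq_ind_r (P n) Pa (npairK2 _ _)) (npairK1 _ _)).
  by exists (npair a b); rewrite npairK1 npairK2.
exists (nfst b); have := (QP (npair n (nfst b))).2 (ex_intro _ _ Qb).
by rewrite npairK1 npairK2.
Qed.

Lemma s1_and P Q : sigma1 P -> sigma1 Q -> sigma1 (fun n => P n /\ Q n).
Proof.
move=> [P' Pd PP] [Q' Qd QQ].
exists (fun n a => P' n (nfst a) /\ Q' n (nsnd a)).
  have r1 := rec_nfst rec_id; have r2 := rec_nsnd rec_id.
  apply: dec_and.
    apply: dec_ext (dec_comp Pd (rec_npair r1 (rec_nfst r2))) => n.
    by rewrite npairK1 npairK2.
  apply: dec_ext (dec_comp Qd (rec_npair r1 (rec_nsnd r2))) => n.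
  by rewrite npairK1 npairK2.
move=> n; rewrite PP QQ; split=> [[[a Pa] [b Qb]]|[a [Pa Qa]]].
  by exists (npair a b); rewrite npairK1 npairK2.
by split; eexists; eassumption.
Qed.

Lemma s1_or P Q : sigma1 P -> sigma1 Q -> sigma1 (fun n => P n \/ Q n).
Proof.
move=> [P' Pd PP] [Q' Qd QQ]; exists (fun n a => P' n a \/ Q' n a).
  exact: dec_or.
move=> n; rewrite PP QQ; split=> [[] [a]|[a []]].
- by exists a; left.
- by exists a; right.
- by left; exists a.
- by right; exists a.
Qed.

(** One common bound [a] on the finitely many witnesses replaces them, which leaves only bounded
    quantifiers in the matrix. *)
Lemma s1_ball (P : nat -> nat -> Prop) b : rec_fun b ->
  sigma1 (fun m => P (nfst m) (nsnd m)) ->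
  sigma1 (fun n => forall j, (j < b n)%N -> P n j).
Proof.
move=> br [Q Qd QP].
exists (fun n a => forall j, (j < b n)%N -> exists2 x, (x < a)%N & Q (npair n j) x).
  apply: (dec_ball (P := fun m j => exists2 x, (x < nsnd m)%N & Q (npair (nfst m) j) x)
    (b := fun m => b (nfst m))).
    by apply: rec_comp => //; apply: rec_nfst; exact: rec_id.
  apply: (dec_bex (P := fun m x => Q (npair (nfst (nfst m)) (nsnd m)) x)
    (b := fun m => nsnd (nfst m))).
    by apply: rec_nsnd; apply: rec_nfst; exact: rec_id.
  apply: dec_ext (dec_comp Qd (rec_npair (rec_npair (rec_nfst (rec_nfst (rec_nfst rec_id)))
    (rec_nsnd (rec_nfst rec_id))) (rec_nsnd rec_id))) => n.
  by rewrite npairK1 npairK2.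
have QP' n j : P n j <-> exists a, Q (npair n j) a.
  by rewrite -QP npairK1 npairK2.
move=> n; split=> [|[a H] j /H [x _ Qx]]; last by rewrite QP'; exists x.
elim: (b n) => [_|k IH H]; first by exists 0%N.
have [a Ha] := IH (fun j jk => H j (ltnW jk)).
have [x Qx] := (QP' _ _).1 (H k (ltnSn k)).
exists (a + x.+1)%N => j; rewrite ltnS leq_eqVlt => /orP[/eqP ->|/Ha[y ya Qy]].
  by exists x => //; lia.
by exists y => //; lia.
Qed.

End Recursive.

Ltac rec_step := first
  [ assumption | apply: rec_id | apply: rec_cst | apply: rec_npair | apply: rec_S
  | apply: rec_nfst | apply: rec_nsnd | apply: rec_add | apply: rec_mul
  | apply: rec_pred | apply: rec_sub | apply: rec_expn2 ].
Ltac rec_auto := repeat rec_step.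
Ltac dec_auto := repeat first
  [ rec_step
  | match goal with
    | |- rec_dec _ (fun n => _ /\ _) => apply: dec_and
    | |- rec_dec _ (fun n => _ \/ _) => apply: dec_or
    | |- rec_dec _ (fun n => ~ _) => apply: dec_not
    | |- rec_dec _ (fun n => forall j, is_true (j < _)%N -> _) => apply: dec_ball
    | |- rec_dec _ (fun n => exists2 j, is_true (j < _)%N & _) => apply: dec_bex
    | |- rec_dec _ (fun n => is_true (_ < _)%N) => apply: dec_lt
    | |- rec_dec _ (fun n => @eq nat _ _) => apply: dec_eq
    | |- rec_dec _ (fun n => _ -> _) => apply: dec_imp
    end ].

(** * Finite sequences coded by numbers *)

Lemma npair_ge a b : (a + b <= npair a b)%N.
Proof. by have := Cantor.to_nat_non_decreasing a b; rewrite /npair; lia. Qed.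

Lemma npair_inj a b a' b' : npair a b = npair a' b' -> a = a' /\ b = b'.
Proof.
by move=> e; split; [rewrite -(npairK1 a b) e npairK1|rewrite -(npairK2 a b) e npairK2].
Qed.

(** The recursion passes to [nsnd m], which is smaller than [n] but not a subterm; hence the fuel,
    for which [n] itself is enough. *)
Fixpoint seq_dec (fuel n : nat) : seq nat :=
  if n is m.+1 then
    if fuel is k.+1 then nfst m :: seq_dec k (nsnd m) else [::]
  else [::].
Definition seq_of (n : nat) : seq nat := seq_dec n n.

Lemma nfst_nsnd_le m : (nfst m + nsnd m <= m)%N.
Proof. by rewrite -{3}(nfst_nsndK m); exact: npair_ge. Qed.

Lemma seq_dec_fuel k n : (n <= k)%N -> seq_dec k n = seq_of n.
Proof.
rewrite /seq_of; suff H m : (n <= m)%N -> (n <= k)%N -> seq_dec k n = seq_dec m n.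
  by apply: H.
elim: k m n => [|k IH] [|m] [|n] //= nm nk.
by congr (_ :: _); apply: IH; have := nfst_nsnd_le n; lia.
Qed.

Lemma seq_ofS m : seq_of m.+1 = nfst m :: seq_of (nsnd m).
Proof.
rewrite {1}/seq_of /= seq_dec_fuel //.
by have := nfst_nsnd_le m; lia.
Qed.

Lemma seq_ofK s : seq_of (seq_num s) = s.
Proof. by elim: s => //= k s IH; rewrite seq_ofS npairK1 npairK2 IH. Qed.

Lemma seq_numK n : seq_num (seq_of n) = n.
Proof.
elim/ltn_ind: n => -[|m] IH //; rewrite seq_ofS /= IH ?nfst_nsndK //.
by have := nfst_nsnd_le m; lia.
Qed.

Lemma size_seq_num s : (size s <= seq_num s)%N.
Proof. by elim: s => //= k s IH; have := npair_ge k (seq_num s); lia. Qed.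

Lemma mem_seq_of_lt t l : t \in seq_of l -> (t < l)%N.
Proof.
rewrite -{2}(seq_numK l); elim: (seq_of l) => //= k s IH.
have := npair_ge k (seq_num s); rewrite in_cons => ? /orP[/eqP ->|/IH]; lia.
Qed.

(* [F] receives the number of the whole remaining list, not just its head. *)
Fixpoint pfold (F : nat -> nat -> nat) (acc : nat) (s : seq nat) : nat :=
  if s is _ :: s' then pfold F (F acc (seq_num s)) s' else acc.

Section Lists.
Variable A : set nat.

Lemma rec_pfold (F : nat -> nat -> nat -> nat) f l : rec_fun A f -> rec_fun A l ->
  rec_fun A (fun m => F (nfst m) (nfst (nsnd m)) (nsnd (nsnd m))) ->
  rec_fun A (fun n => pfold (F n) (f n) (seq_of (l n))).
Proof.
move=> fr lr Fr.
(* The state pairs the accumulator with the number of the remaining list. A list is no longer than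
   its number, so [l n] iterations exhaust it, and the empty list is a fixed point. *)
pose step n (k : nat) r := if `[< nsnd r = 0%N >] then r
  else npair (F n (nfst r) (nsnd r)) (nsnd (nsnd r).-1).
have := rec_nfst (rec_prim (g := step) (rec_npair fr lr) lr _).
have sr : rec_fun A (fun m => step (nfst m) (nfst (nsnd m)) (nsnd (nsnd m))).
  rewrite /step; apply: rec_if; rec_auto; first by apply: dec_eq; rec_auto.
  have r2 : rec_fun A (fun m => npair (nfst m) (npair (nfst (nsnd (nsnd m))) (nsnd (nsnd (nsnd m))))).
    by rec_auto.
  by apply: rec_ext (rec_comp Fr r2) => m; rewrite !(npairK1, npairK2).
move=> /(_ sr); apply: rec_ext => n.
have -> : nat_rect (fun=> nat) (npair (f n) (l n)) (step n) (l n) =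
  iter (l n) (step n 0%N) (npair (f n) (l n)).
  by elim: {2 3}(l n) => //= k ->.
have /= := size_seq_num (seq_of (l n)); rewrite seq_numK.
move: {2 3}(l n) => k; rewrite -{2}(seq_numK (l n)).
elim: (seq_of (l n)) (f n) k => [|t s IH] acc k /= sk.
  suff -> : iter k (step n 0%N) (npair acc 0) = npair acc 0 by rewrite npairK1.
  elim: k {sk} => //= k ->; rewrite /step npairK2.
  by case: asboolP.
case: k sk => // k; rewrite ltnS => sk; rewrite iterSr -(IH _ k sk).
congr (nfst (iter _ _ _)); rewrite /step npairK2 npairK1 /=.
by case: asboolP => //; rewrite npairK2.
Qed.

(** The product over the list of the distances to [f n] vanishes iff [f n] occurs in it. *)
Lemma dec_mem f l : rec_fun A f -> rec_fun A l ->
  rec_dec A (fun n => f n \in seq_of (l n)).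
Proof.
move=> fr lr.
exists (fun n => pfold (fun acc s => acc * ((nfst s.-1 - f n) + (f n - nfst s.-1)))%N
   1 (seq_of (l n))).
  apply: (rec_pfold (F := fun n acc s => acc * ((nfst s.-1 - f n) + (f n - nfst s.-1)))%N) => //.
    exact: rec_cst.
  have := rec_comp fr (rec_nfst (rec_id A)) => fr'.
  by rec_auto.
move=> n; set F := fun _ _ => _.
suff H acc : pfold F acc (seq_of (l n)) = 0%N <-> acc = 0%N \/ f n \in seq_of (l n).
  by rewrite H; split=> [|[]//]; right.
elim: (seq_of (l n)) acc => [|t s IH] acc /=; first by split=> [|[]//]; left.
rewrite IH /F /= npairK1 in_cons; split.
  case=> [|->]; last by rewrite orbT; right.
  move/eqP; rewrite muln_eq0 => /orP[/eqP|/eqP] e; [by left|right].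
  by apply/orP; left; apply/eqP; lia.
case=> [->|/orP[/eqP ->|->]]; [by left| |by right].
by left; lia.
Qed.

Lemma dec_all_seq (P : nat -> nat -> Prop) l : rec_fun A l ->
  rec_dec A (fun m => P (nfst m) (nsnd m)) ->
  rec_dec A (fun n => forall t, t \in seq_of (l n) -> P n t).
Proof.
move=> lr Pd; have lr' := rec_comp lr (rec_nfst (rec_id A)).
have := dec_ball (P := fun n t => t \in seq_of (l n) -> P n t) lr
  (dec_imp (dec_mem (rec_nsnd (rec_id A)) lr') Pd).
apply: dec_ext => n; split=> H t; last by move=> _; exact: H.
by move=> tl; apply: H => //; exact: mem_seq_of_lt.
Qed.

Lemma dec_ex_seq (P : nat -> nat -> Prop) l : rec_fun A l ->
  rec_dec A (fun m => P (nfst m) (nsnd m)) ->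
  rec_dec A (fun n => exists2 t, t \in seq_of (l n) & P n t).
Proof.
move=> lr Pd.
apply: dec_ext (dec_not (dec_all_seq (P := fun n j => ~ P n j) lr (dec_not Pd))) => n.
split=> [/existsNP[j /not_implyP[jb /contrapT Pj]]|[j jb Pj] /(_ j jb)]; last by [].
by exists j.
Qed.

Lemma s1_all_seq (P : nat -> nat -> Prop) l : rec_fun A l ->
  sigma1 A (fun m => P (nfst m) (nsnd m)) ->
  sigma1 A (fun n => forall t, t \in seq_of (l n) -> P n t).
Proof.
move=> lr Pd; have lr' := rec_comp lr (rec_nfst (rec_id A)).
have := s1_ball (P := fun n t => ~ (t \in seq_of (l n)) \/ P n t) lr
  (s1_or (s1_dec (dec_not (dec_mem (rec_nsnd (rec_id A)) lr'))) Pd).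
apply: s1_ext => n; split=> H t.
  by move=> tl; have [] := H t (mem_seq_of_lt tl).
by move=> _; case: (boolP (t \in seq_of (l n))) => [/H|]; [right|left].
Qed.

Lemma s1_ex_seq (P : nat -> nat -> Prop) l : rec_fun A l ->
  sigma1 A (fun m => P (nfst m) (nsnd m)) ->
  sigma1 A (fun n => exists2 t, t \in seq_of (l n) & P n t).
Proof.
move=> lr Pd; have lr' := rec_comp lr (rec_nfst (rec_id A)).
have := s1_ex (P := fun n t => t \in seq_of (l n) /\ P n t)
  (s1_and (s1_dec (dec_mem (rec_nsnd (rec_id A)) lr')) Pd).
by apply: s1_ext => n; split=> [[t []]|[t]]; exists t.
Qed.

End Lists.

Ltac dec_list := repeat first
  [ progress dec_auto
  | match goal with
    | |- rec_dec _ (fun n => exists2 j, is_true (j \in seq_of _) & _) => apply: dec_ex_seq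
    | |- rec_dec _ (fun n => forall j, is_true (j \in seq_of _) -> _) => apply: dec_all_seq
    | |- rec_dec _ (fun n => is_true (_ \in seq_of _)) => apply: dec_mem
    end ].

(** * A universal program, by derivation certificates *)

Section Universal.
Variable A : set nat.

Definition triple (e n v : nat) : nat := npair e (npair n v).

(* [just t l]: the claim [t = <e, <n, v>>], "program number [e] maps [n] to [v]",
   follows from the claims in [l] by one evaluation rule. *)
Definition just (t : nat) (l : seq nat) : Prop :=
  let e := nfst t in let n := nfst (nsnd t) in let v := nsnd (nsnd t) in
  (e = 0 /\ v = 0) \/ (e = 1 /\ v = n.+1) \/ (e = 2 /\ v = nfst n) \/
  (e = 3 /\ v = nsnd n) \/ (e = 4 /\ ((A n /\ v = 1) \/ (~ A n /\ v = 0))) \/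
  (exists2 q, q < e & e = 5 + 4 * q /\
    triple (nfst q) n (nfst v) \in l /\ triple (nsnd q) n (nsnd v) \in l) \/
  (exists2 q, q < e & e = 6 + 4 * q /\ exists2 u : nat, u \in l &
    nfst u = nsnd q /\ nfst (nsnd u) = n /\ triple (nfst q) (nsnd (nsnd u)) v \in l) \/
  (exists2 q, q < e & e = 7 + 4 * q /\
    ((nsnd n = 0 /\ triple (nfst q) (nfst n) v \in l) \/
     exists2 u : nat, u \in l & nfst u = e /\
       nsnd n = (nsnd (nfst (nsnd u))).+1 /\ nfst (nfst (nsnd u)) = nfst n /\
       triple (nsnd q)
         (npair (nfst n) (npair (nsnd (nfst (nsnd u))) (nsnd (nsnd u)))) v \in l)) \/
  (exists2 q, q < e & e = 8 + 4 * q /\ triple q (npair n v) 0 \in l /\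
    forall j, j < v -> exists2 u : nat, u \in l &
      nfst u = q /\ nfst (nsnd u) = npair n j /\ 0 < nsnd (nsnd u))%N.

Lemma just_sub t l l' : {subset l <= l'} -> just t l -> just t l'.
Proof.
move=> ll'; rewrite /just.
do 5 (case=> [H|H]; [by left|right; move: H]).
case=> [[q qe [e1 [/ll' h1 /ll' h2]]]|H]; [by left; exists q|right; move: H].
case=> [[q qe [e1 [u /ll' h1 [e2 [e3 /ll' h2]]]]]|H].
  by left; exists q => //; split=> //; exists u.
right; move: H; case=> [[q qe [e1 [[h1 /ll' h2]|[u /ll' h1 [e2 [e3 [e4 /ll' h2]]]]]]]|].
- by left; exists q => //; split=> //; left.
- by left; exists q => //; split=> //; right; exists u.
move=> [q qe [e1 [/ll' h1 h2]]]; right; exists q => //; split=> //; split=> // j.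
by move=> /h2[u /ll' h3 h4]; exists u.
Qed.

(** The head of a certificate is its latest step: each claim rests on claims further down the
    list. *)
Fixpoint valid (l : seq nat) : Prop :=
  if l is t :: l' then just t l' /\ valid l' else True.

Lemma valid_cat l l' : valid l -> valid l' -> valid (l ++ l').
Proof.
elim: l => //= t l IH [jt vl] vl'; split; last exact: IH.
by apply: just_sub jt => x; rewrite mem_cat => ->.
Qed.

(** The induction is on the certificate and not on the program, because the rule for [Prec] appeals
    to the same program at a smaller argument. *)
Lemma valid_sound l c n v :
  valid l -> triple (code_num c) n v \in l -> eval A c n v.
Proof.
elim: l c n v => //= t l IH c n v [jt vl].
rewrite in_cons => /orP[/eqP tE|]; last exact: IH.
have {}IH c' n' v' := IH c' n' v' vl.
move: jt; rewrite -tE /just !(npairK1, npairK2).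
case: c {tE} => [||||
  |f g|f g|f g|f] /= H;
  repeat match goal with
  | H : _ \/ _ |- _ => case: H => H; try (by lia); try (by case: H => ? _ [? _]; lia)
  end.
- by case: H => _ [[An ->]|[nAn ->]]; [rewrite mem_set|rewrite memNset].
- case: H => q _ [qE].
  rewrite (_ : q = npair (code_num f) (code_num g)) ?npairK1 ?npairK2; last by lia.
  move=> [/IH h1 /IH h2].
  by exists (nfst v), (nsnd v); rewrite nfst_nsndK.
- case: H => q _ [qE].
  rewrite (_ : q = npair (code_num f) (code_num g)) ?npairK1 ?npairK2; last by lia.
  move=> [u + [e1 [e2 /IH h]]].
  rewrite -(nfst_nsndK u) -(nfst_nsndK (nsnd u)) e1 e2 => /IH h'.
  by exists (nsnd (nsnd u)).
- case: H => q _ [qE].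
  rewrite (_ : q = npair (code_num f) (code_num g)) ?npairK1 ?npairK2; last by lia.
  move=> [[-> /IH //]|[u + [e1 [e2 [e3 /IH h]]]]].
  rewrite -(nfst_nsndK u) -(nfst_nsndK (nsnd u)) e1 => /(IH (Prec f g)) /=.
  by rewrite e2 e3 => h'; exists (nsnd (nsnd u)).
- case: H => q _ [qE].
  rewrite (_ : q = code_num f); last by lia.
  move=> [/IH h1 h2]; split=> // j /h2[u + [e1 [e2 e3]]].
  rewrite -(nfst_nsndK u) -(nfst_nsndK (nsnd u)) e1 e2 => /IH h'.
  by exists (nsnd (nsnd u)).-1; rewrite prednK.
Qed.

Lemma valid_complete c n v : eval A c n v ->
  exists2 l, valid l & triple (code_num c) n v \in l.
Proof.
have wrap e n' v' l : valid l -> just (triple e n' v') l ->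
    exists2 l, valid l & triple e n' v' \in l.
  by move=> vl jl; exists (triple e n' v' :: l) => //; rewrite in_cons eqxx.
(* The bound [q < e] in [just] keeps that quantifier bounded and thus decidable; here it is supplied
   for the four compound program forms. *)
have q5 r q : (q < 5 + r + 4 * q)%N by lia.
elim: c n v => [||||
  |f IHf g IHg|f IHf g IHg|f IHf g IHg|f IHf] n v /= H.
- by apply: (wrap _ _ _ [::]) => //; rewrite /just /triple !(npairK1, npairK2); left.
- by apply: (wrap _ _ _ [::]) => //; rewrite /just /triple !(npairK1, npairK2); right; left.
- by apply: (wrap _ _ _ [::]) => //; rewrite /just /triple !(npairK1, npairK2); do 2 right; left.
- by apply: (wrap _ _ _ [::]) => //; rewrite /just /triple !(npairK1, npairK2); do 3 right; left.
- apply: (wrap _ _ _ [::]) => //; rewrite /just /triple !(npairK1, npairK2); do 4 right; left.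
  split=> //; rewrite H; case: (boolP (n \in A)) => [/set_mem|/negP nA]; first by left.
  by right; split=> // An; apply: nA; exact: mem_set.
- move: H => [a [b [/IHf[lf vf mf] /IHg[lg vg mg] ->]]].
  apply: (wrap _ _ _ (lf ++ lg)); first exact: valid_cat.
  rewrite /just; do 5 right; left; rewrite /= !(npairK1, npairK2).
  exists (npair (code_num f) (code_num g)); first exact: (q5 0%N).
  by split=> //; rewrite !(npairK1, npairK2) !mem_cat mf mg orbT.
- move: H => [m /IHg[lg vg mg] /IHf[lf vf mf]].
  apply: (wrap _ _ _ (lf ++ lg)); first exact: valid_cat.
  rewrite /just; do 6 right; left; rewrite /= !(npairK1, npairK2).
  exists (npair (code_num f) (code_num g)); first exact: (q5 1%N).
  split=> //; exists (triple (code_num g) n m); first by rewrite mem_cat mg orbT.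
  by rewrite !(npairK1, npairK2) mem_cat mf.
- rewrite -(nfst_nsndK n); move: H; move: (nfst n) (nsnd n) => a k.
  elim: k v => [|k IHk] v.
    move=> /IHf[lf vf mf]; apply: (wrap _ _ _ lf) => //.
    rewrite /just; do 7 right; left; rewrite /= !(npairK1, npairK2).
    exists (npair (code_num f) (code_num g)); first exact: (q5 2%N).
    by split=> //; left; rewrite !(npairK1, npairK2).
  move=> [r /IHk[l vl ml] /IHg[lg vg mg]].
  apply: (wrap _ _ _ (l ++ lg)); first exact: valid_cat.
  rewrite /just; do 7 right; left; rewrite /= !(npairK1, npairK2).
  exists (npair (code_num f) (code_num g)); first exact: (q5 2%N).
  split=> //; right; exists (triple (code_num (Prec f g)) (npair a k) r);
    first by rewrite mem_cat ml.
  by rewrite !(npairK1, npairK2) mem_cat mg orbT.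
- move: H => [/IHf[lf vf mf] H].
  have [l vl ml] : exists2 l, valid l & forall j, (j < v)%N ->
      exists2 u, u \in l & nfst u = code_num f /\ nfst (nsnd u) = npair n j /\ (0 < nsnd (nsnd u))%N.
    elim: v {mf} H => [|k IHk] H; first by exists [::].
    have [|l vl ml] := IHk; first by move=> j jk; apply: H; lia.
    have [w /IHf[l' vl' ml']] := H k (ltnSn k).
    exists (l ++ l'); first exact: valid_cat.
    move=> j; rewrite ltnS leq_eqVlt => /orP[/eqP ->|/ml[u ul h]].
      exists (triple (code_num f) (npair n k) w.+1); first by rewrite mem_cat ml' orbT.
      by rewrite !(npairK1, npairK2).
    by exists u => //; rewrite mem_cat ul.
  apply: (wrap _ _ _ (lf ++ l)); first exact: valid_cat.
  rewrite /just; do 8 right; rewrite /= !(npairK1, npairK2).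
  exists (code_num f); first exact: (q5 3%N).
  split=> //; split; first by rewrite mem_cat mf.
  by move=> j /ml[u ul h]; exists u => //; rewrite mem_cat ul orbT.
Qed.

(** The offsets 5, 6, 7, 8 exhaust the residues modulo 4. Hence a run of the program numbered [e]
    always comes from an actual program, as the definition of the jump demands. *)
Lemma code_num_surj e : exists c, e = code_num c.
Proof.
elim/ltn_ind: e => e IH.
case: e IH => [|[|[|[|[|e]]]]] IH;
  [by exists Zero|by exists Succ|by exists Left|by exists Right|by exists Query|].
have := divn_eq e 4; set q := (e %/ 4)%N; have := ltn_pmod e (isT : (0 < 4)%N).
have := nfst_nsnd_le q; move: (e %% 4)%N => r qle r4 eE.
have [f fE] := IH (nfst q) ltac:(lia); have [g gE] := IH (nsnd q) ltac:(lia).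
have [h hE] := IH q ltac:(lia).
case: r r4 eE => [|[|[|[|//]]]] _ eE.
- by exists (Pair f g) => /=; rewrite -fE -gE nfst_nsndK; lia.
- by exists (Comp f g) => /=; rewrite -fE -gE nfst_nsndK; lia.
- by exists (Prec f g) => /=; rewrite -fE -gE nfst_nsndK; lia.
- by exists (Search h) => /=; rewrite -hE; lia.
Qed.

Definition runs (e n v : nat) : Prop :=
  exists l, valid (seq_of l) /\ triple e n v \in seq_of l.

Lemma runsP c n v : runs (code_num c) n v <-> eval A c n v.
Proof.
split=> [[l [vl ml]]|/valid_complete[l vl ml]]; first exact: valid_sound ml.
by exists (seq_num l); rewrite seq_ofK.
Qed.

Lemma dec_just : rec_dec A (fun m => just (nfst m) (seq_of (nsnd m))).
Proof.
rewrite /just /triple; dec_list; apply: dec_oracle; rec_auto.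
Qed.

Lemma dec_valid : rec_dec A (fun m => valid (seq_of m)).
Proof.
have [J Jr JP] := dec_just.
exists (fun n => pfold (fun acc s => (acc + J s.-1)%N) 0 (seq_of n)).
  apply: (rec_pfold (F := fun _ acc s => (acc + J s.-1)%N)); rec_auto.
  by apply: rec_comp => //; rec_auto.
move=> n; set F := fun _ _ => _.
suff H acc : pfold F acc (seq_of n) = 0%N <-> acc = 0%N /\ valid (seq_of n).
  by rewrite H; split=> [|[]//].
elim: (seq_of n) acc => [|t s IH] acc /=; first by split=> [|[]//].
rewrite IH /F /=.
have := JP (npair t (seq_num s)); rewrite npairK1 npairK2 seq_ofK => ->.
rewrite (_ : (_ + _ = 0)%N <-> acc = 0%N /\ J (npair t (seq_num s)) = 0%N); last by lia.
by tauto.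
Qed.

Lemma s1_runs e n v : rec_fun A e -> rec_fun A n -> rec_fun A v ->
  sigma1 A (fun m => runs (e m) (n m) (v m)).
Proof.
move=> er nr vr; rewrite /runs.
have fr f : rec_fun A f -> rec_fun A (fun m => f (nfst m)).
  by move=> fr; apply: rec_comp => //; rec_auto.
have := fr _ er; have := fr _ nr; have := fr _ vr => ? ? ?.
apply: s1_ex; apply: s1_and; apply: s1_dec; first by apply: dec_comp dec_valid _; rec_auto.
by apply: dec_mem; rewrite /triple; rec_auto.
Qed.

(** A halting computation is witnessed by its certificate. Conversely [Search] finds the least
    witness; it cannot get stuck, the decision function being total. *)
Lemma ce_in_sigma1 (S : set nat) : ce_in A S <-> sigma1 A S.
Proof.
split=> [[c ->]|[Q [f [c cf] fQ] QP]].
  have := s1_ex (P := fun n v => runs (code_num c) n v)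
    (s1_runs (rec_cst A (code_num c)) (rec_nfst (rec_id A)) (rec_nsnd (rec_id A))).
  by apply: s1_ext => n; split=> -[v /runsP]; exists v.
exists (Search c); apply/seteqP; split=> n /=; rewrite QP.
  move=> [a Qa]; have ex : exists a, f (npair n a) == 0%N.
    by exists a; apply/eqP/fQ; rewrite npairK1 npairK2.
  exists (ex_minn ex); case: ex_minnP => m /eqP fm min.
  split; first by have := cf (npair n m); rewrite fm.
  move=> j jm; exists (f (npair n j)).-1; rewrite prednK; first exact: cf.
  by rewrite lt0n; apply/negP => /min; lia.
move=> [v [ev _]]; exists v.
have := (fQ (npair n v)).2; rewrite npairK1 npairK2; apply.
exact: eval_inj (cf _) ev.
Qed.

Lemma turing_jump_runs e : turing_jump A e <-> exists v, runs e e v.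
Proof.
split=> [[c -> [v /runsP]]|[v]]; first by exists v.
have [c ->] := code_num_surj e => /runsP ev.
by exists c => //; exists v.
Qed.

Lemma s1_jump f : rec_fun A f -> sigma1 A (fun n => turing_jump A (f n)).
Proof.
move=> fr.
have fr' : rec_fun A (fun m => f (nfst m)) by apply: rec_comp => //; rec_auto.
have := s1_ex (P := fun n v => runs (f n) (f n) v) (s1_runs fr' fr' (rec_nsnd (rec_id A))).
by apply: s1_ext => n; rewrite turing_jump_runs.
Qed.

Lemma rec_search (R : nat -> nat -> Prop) :
  rec_dec A (fun m => R (nfst m) (nsnd m)) -> (forall n, exists w, R n w) ->
  exists2 h, rec_fun A h & forall n, R n (h n).
Proof.
move=> [f [c cf] fR] Rex.
have ex n : exists w, f (npair n w) == 0%N.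
  by have [w Rw] := Rex n; exists w; apply/eqP/fR; rewrite npairK1 npairK2.
exists (fun n => ex_minn (ex n)).
  exists (Search c) => n /=; case: ex_minnP => m /eqP fm min.
  split; first by have := cf (npair n m); rewrite fm.
  move=> j jm; exists (f (npair n j)).-1; rewrite prednK; first exact: cf.
  by rewrite lt0n; apply/negP => /min; lia.
move=> n; case: ex_minnP => m /eqP /fR; by rewrite npairK1 npairK2.
Qed.

End Universal.

(** * Sigma_2 sets and the jump *)

Section Sigma2.
Variable A : set nat.

Definition sigma2 (P : nat -> Prop) : Prop :=
  exists2 Q : nat -> nat -> Prop, sigma1 A (fun m => Q (nfst m) (nsnd m)) &
    forall n, P n <-> exists a, ~ Q n a.

Lemma s2_ext P Q : (forall n, P n <-> Q n) -> sigma2 P -> sigma2 Q.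
Proof. by move=> PQ [R Rd RP]; exists R => // n; rewrite -PQ. Qed.

Lemma s2_pi1 P : sigma1 A P -> sigma2 (fun n => ~ P n).
Proof.
move=> Pd; exists (fun n _ => P n); first exact: (s1_comp Pd (rec_nfst (rec_id A))).
by move=> n; split=> [|[]//]; exists 0%N.
Qed.

Lemma s2_dec P : rec_dec A P -> sigma2 P.
Proof.
move=> Pd; apply: s2_ext (s2_pi1 (s1_dec (dec_not Pd))) => n.
by split=> [/contrapT//|Pn]; apply.
Qed.

Lemma s2_comp P f : sigma2 P -> rec_fun A f -> sigma2 (fun n => P (f n)).
Proof.
move=> [Q Qd QP] fr; exists (fun n a => Q (f n) a) => //.
have fr' : rec_fun A (fun m => f (nfst m)) by apply: rec_comp => //; rec_auto.
apply: s1_ext (s1_comp Qd (rec_npair fr' (rec_nsnd (rec_id A)))) => n.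
by rewrite npairK1 npairK2.
Qed.

Lemma s1_comp2 (Q : nat -> nat -> Prop) f g :
  sigma1 A (fun m => Q (nfst m) (nsnd m)) -> rec_fun A f -> rec_fun A g ->
  sigma1 A (fun n => Q (f n) (g n)).
Proof.
move=> Qd fr gr; apply: s1_ext (s1_comp Qd (rec_npair fr gr)) => n.
by rewrite npairK1 npairK2.
Qed.

Lemma s2_ex (P : nat -> nat -> Prop) :
  sigma2 (fun m => P (nfst m) (nsnd m)) -> sigma2 (fun n => exists a, P n a).
Proof.
move=> [Q Qd QP]; exists (fun n b => Q (npair n (nfst b)) (nsnd b)).
  by apply: (s1_comp2 Qd); rec_auto.
have QP' n a : P n a <-> exists b, ~ Q (npair n a) b by rewrite -QP npairK1 npairK2.
move=> n; split=> [[a /QP'[b Qb]]|[b Qb]].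
  by exists (npair a b); rewrite npairK1 npairK2.
by exists (nfst b); rewrite QP'; exists (nsnd b).
Qed.

Lemma s2_s1 P : sigma1 A P -> sigma2 P.
Proof.
move=> [Q Qd QP]; apply: s2_ext (s2_ex (P := Q) (s2_dec Qd)) => n.
by rewrite QP.
Qed.

Lemma s2_and P Q : sigma2 P -> sigma2 Q -> sigma2 (fun n => P n /\ Q n).
Proof.
move=> [P' Pd PP] [Q' Qd QQ].
exists (fun n a => P' n (nfst a) \/ Q' n (nsnd a)).
  by apply: s1_or; [apply: (s1_comp2 Pd)|apply: (s1_comp2 Qd)]; rec_auto.
move=> n; rewrite PP QQ; split=> [[[a Pa] [b Qb]]|[a /not_orP[Pa Qa]]].
  by exists (npair a b); rewrite npairK1 npairK2 => -[].
by split; eexists; eassumption.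
Qed.

Lemma s2_or P Q : sigma2 P -> sigma2 Q -> sigma2 (fun n => P n \/ Q n).
Proof.
move=> [P' Pd PP] [Q' Qd QQ].
exists (fun n a => (nfst a = 0%N \/ P' n (nsnd a)) /\ (nfst a <> 0%N \/ Q' n (nsnd a))).
  apply: s1_and; apply: s1_or; try by apply: s1_dec; dec_auto.
    by apply: (s1_comp2 Pd); rec_auto.
  by apply: (s1_comp2 Qd); rec_auto.
move=> n; rewrite PP QQ; split=> [[[a Pa]|[a Qa]]|[a /not_andP[|]/not_orP[e H]]].
- by exists (npair 1 a); rewrite npairK1 npairK2 => -[[]].
- by exists (npair 0 a); rewrite npairK1 npairK2 => -[_ []].
- by left; exists (nsnd a).
- by right; exists (nsnd a).
Qed.

Lemma s2_all_seq (P : nat -> nat -> Prop) l : rec_fun A l ->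
  sigma2 (fun m => P (nfst m) (nsnd m)) ->
  sigma2 (fun n => forall t, t \in seq_of (l n) -> P n t).
Proof.
move=> lr [Q Qd QP].
have QP' n a : P n a <-> exists b, ~ Q (npair n a) b by rewrite -QP npairK1 npairK2.
(* The witness [w] lists pairs <t, a>, [a] being a witness for [t]. *)
exists (fun n w => (exists2 t, t \in seq_of (l n) & forall u, u \in seq_of w -> nfst u <> t) \/
   exists2 u, u \in seq_of w & Q (npair n (nfst u)) (nsnd u)).
  have lr' : rec_fun A (fun m => l (nfst m)) by apply: rec_comp => //; rec_auto.
  apply: s1_or; first by apply: s1_dec; dec_list.
  apply: s1_ex_seq; first by rec_auto.
  by apply: (s1_comp2 Qd); rec_auto.
move=> n; split=> [|[w /not_orP[H1 H2]] t tl]; last first.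
  have [u uw ut] : exists2 u, u \in seq_of w & nfst u = t.
    apply: contrapT => H; apply: H1; exists t => // u uw ut.
    by apply: H; exists u.
  by rewrite QP'; exists (nsnd u) => Qu; apply: H2; exists u => //; rewrite ut.
elim: (seq_of (l n)) => [_|t s IH H].
  by exists 0%N => -[[]|[]].
have [|w /not_orP[H1 H2]] := IH; first by move=> u us; apply: H; rewrite in_cons us orbT.
have /QP'[a Qa] : P n t by apply: H; rewrite in_cons eqxx.
exists (seq_num (npair t a :: seq_of w)); rewrite seq_ofK => -[[x]|[u]].
  rewrite in_cons => /orP[/eqP ->|xs] Hx.
    by apply: (Hx (npair t a)); rewrite ?in_cons ?eqxx ?npairK1.
  by apply: H1; exists x => // u uw; apply: Hx; rewrite in_cons uw orbT.
rewrite in_cons => /orP[/eqP ->|uw]; first by rewrite npairK1 npairK2.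
by move=> Qu; apply: H2; exists u.
Qed.

Lemma s2_ball (P : nat -> nat -> Prop) b : rec_fun A b ->
  sigma2 (fun m => P (nfst m) (nsnd m)) ->
  sigma2 (fun n => forall j, (j < b n)%N -> P n j).
Proof.
move=> br Pd.
(* [L k] is the number of the list of all numbers below [k], so the bounded quantifier becomes a
   quantifier over a list. *)
pose L k := nat_rect (fun=> nat) 0%N (fun j r => (npair j r).+1) k.
have LE k : seq_of (L k) =i gtn k.
  elim: k => [//|k IH] j; rewrite [L _]/= seq_ofS npairK1 npairK2 in_cons.
  by rewrite -/(L k) IH !inE ltnS [RHS]leq_eqVlt.
have Lr : rec_fun A (fun n => L (b n)).
  by apply: (rec_prim (g := fun _ j r => (npair j r).+1)) => //; rec_auto.
apply: s2_ext (s2_all_seq Lr Pd) => n.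
by split=> H j; have := LE (b n) j; rewrite inE => E Hj; apply: H; rewrite ?E // -E.
Qed.

End Sigma2.

(** Induction on the program. Only [Query] sees the jump, where the answer 1 is Sigma_1 and the
    answer 0 is Pi_1; the other rules use existential and bounded quantifiers, which preserve
    Sigma_2. *)
Lemma s2_eval_jump A c f g : rec_fun A f -> rec_fun A g ->
  sigma2 A (fun m => eval (turing_jump A) c (f m) (g m)).
Proof.
move=> fr gr; suff : sigma2 A (fun m => eval (turing_jump A) c (nfst m) (nsnd m)).
  move=> H; apply: s2_ext (s2_comp H (rec_npair fr gr)) => n.
  by rewrite npairK1 npairK2.
have comp2 c' f' g' : sigma2 A (fun m => eval (turing_jump A) c' (nfst m) (nsnd m)) ->
    rec_fun A f' -> rec_fun A g' -> sigma2 A (fun m => eval (turing_jump A) c' (f' m) (g' m)).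
  move=> H fr' gr'; apply: s2_ext (s2_comp H (rec_npair fr' gr')) => n.
  by rewrite npairK1 npairK2.
elim: c {f g fr gr} => [||||
  |f IHf g IHg|f IHf g IHg|f IHf g IHg|f IHf]; try by (apply: s2_dec => /=; dec_auto).
- have J := s1_jump (rec_nfst (rec_id A)).
  apply: s2_ext (s2_or (s2_and (s2_dec (dec_eq (rec_nsnd (rec_id A)) (rec_cst A 1))) (s2_s1 J))
    (s2_and (s2_dec (dec_eq (rec_nsnd (rec_id A)) (rec_cst A 0))) (s2_pi1 J))) => n /=.
  split=> [[[-> h]|[-> h]]|->]; [by rewrite mem_set|by rewrite memNset|].
  by case: (boolP (nfst n \in turing_jump A)) => [/set_mem ?|/negP H]; [left|right; split=> // ?; apply: H; exact: mem_set].
- suff : sigma2 A (fun m => exists a b, (eval (turing_jump A) f (nfst m) a /\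
     eval (turing_jump A) g (nfst m) b) /\ nsnd m = npair a b).
    apply: s2_ext => m /=.
    by split=> [[a [b [[h1 h2] ->]]]|[a [b [h1 h2 ->]]]]; exists a, b.
  apply: s2_ex; apply: s2_ex; apply: s2_and; last by apply: s2_dec; dec_auto.
  by apply: s2_and; apply: comp2 => //; rec_auto.
- suff : sigma2 A (fun m => exists a, eval (turing_jump A) g (nfst m) a /\
     eval (turing_jump A) f a (nsnd m)).
    by apply: s2_ext => m /=; split=> [[a []]|[a]]; exists a.
  apply: s2_ex.
  by apply: s2_and; apply: comp2 => //; rec_auto.
- pose ok m l := forall t, t \in seq_of l ->
     (nfst t = 0%N /\ eval (turing_jump A) f (nfst (nfst m)) (nsnd t)) \/
     (exists u, (u \in seq_of l /\ nfst t = (nfst u).+1) /\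
        eval (turing_jump A) g (npair (nfst (nfst m)) u) (nsnd t)).
  suff : sigma2 A (fun m => exists l, ok m l /\ npair (nsnd (nfst m)) (nsnd m) \in seq_of l);
    last first.
    apply: s2_ex; apply: s2_and; last by apply: s2_dec; dec_list.
    apply: s2_all_seq; first by rec_auto.
    apply: s2_or; first by apply: s2_and; [apply: s2_dec; dec_auto|apply: comp2 => //; rec_auto].
    apply: s2_ex; apply: s2_and; first by apply: s2_dec; dec_list.
    by apply: comp2 => //; rec_auto.
  apply: s2_ext => m /=.
  rewrite /ok; move: (nfst (nfst m)) (nsnd (nfst m)) (nsnd m) => a k v.
  split.
    move=> [l [okl]]; elim: k v => [|k IH] v /okl; rewrite npairK1 npairK2.
      by case=> [[]//|[u [[_ //]]]].
    case=> [[]//|[u [[ul [kE]] gu]]]; subst k.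
    exists (nsnd u); last by rewrite nfst_nsndK.
    by apply: IH; rewrite nfst_nsndK.
  move=> ev; suff [l [okl kl]] : exists l : seq nat, (forall t : nat, t \in l ->
     (nfst t = 0%N /\ eval (turing_jump A) f a (nsnd t)) \/
     (exists u, (u \in l /\ nfst t = (nfst u).+1) /\
        eval (turing_jump A) g (npair a u) (nsnd t))) /\ npair k v \in l.
    by exists (seq_num l); rewrite seq_ofK.
  elim: k v ev => [|k IH] v.
    move=> fv; exists [:: npair 0 v]; rewrite in_cons eqxx; split=> // t.
    by rewrite inE => /eqP ->; left; rewrite npairK1 npairK2.
  move=> [r /IH[l [okl kl]] gr]; exists (npair k.+1 v :: l); rewrite in_cons eqxx.
  split=> // t; rewrite in_cons => /orP[/eqP ->|/okl[|[u [[ul e] h]]]]; [right|by left|right].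
    by exists (npair k r); rewrite !(npairK1, npairK2) in_cons kl orbT.
  by exists u; rewrite in_cons ul orbT.
- apply: s2_and => /=; first by apply: comp2 => //; rec_auto.
  apply: s2_ball; first by rec_auto.
  by apply: s2_ex; apply: comp2 => //; rec_auto.
Qed.

Fixpoint cst_code (n : nat) : code := if n is m.+1 then Comp Succ (cst_code m) else Zero.

Lemma eval_cst_code A n k v : eval A (cst_code n) k v <-> v = n.
Proof.
elim: n v => [//|n IH] v /=; split=> [[m /IH -> ->//]|->].
by exists n => //; apply/IH.
Qed.

Lemma rec_cst_code_num A f : rec_fun A f -> rec_fun A (fun n => code_num (cst_code (f n))).
Proof.
move=> fr.
(* Here 6 is the offset of [Comp] and 1 the number of [Succ]. *)
suff : rec_fun A (fun n => nat_rect (fun=> nat) 0%N (fun _ r => 6 + 4 * npair 1 r)%N (f n)).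
  by apply: rec_ext => n; elim: (f n) => //= k ->.
by apply: (rec_prim (g := fun _ _ r => 6 + 4 * npair 1 r)%N) => //; rec_auto.
Qed.

(** Post's theorem, stated for a graph. In the converse direction the jump decides the Pi_1 matrix,
    and a search for the value together with its witness succeeds because every [n] has a value. *)
Lemma turing_le_jumpP A B :
  turing_le B (turing_jump A) <-> sigma2 A (fun q => nsnd q = (nfst q \in B)).
Proof.
split=> [[c cB]|[Q /ce_in_sigma1[c cQ] QP]].
  apply: s2_ext (s2_eval_jump c (rec_nfst (rec_id A)) (rec_nsnd (rec_id A))) => q.
  by split=> [h|->//]; exact: eval_inj h (cB _).
set J := turing_jump A.
(* The input [m] is hard-wired, so that this program ignores its own argument: it belongs to the
   jump iff [c] halts on [m]. *)
pose e m := code_num (Comp c (cst_code m)).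
have er : rec_fun J e.
  rewrite /e /=; apply: rec_add; rec_auto; apply: rec_cst_code_num; rec_auto.
have eJ m : J (e m) <-> Q (nfst m) (nsnd m).
  have -> : Q (nfst m) (nsnd m) = halts A c m by rewrite -[LHS]/([set m | Q (nfst m) (nsnd m)] m) cQ.
  split=> [[c' + [v]]|[v ev]].
    (* Programs with equal numbers have equal runs, since [runs] refers to a program by its number
       only; this serves in place of injectivity of [code_num]. *)
    have injc : forall c1 c2, code_num c1 = code_num c2 ->
       forall n v, eval A c1 n v -> eval A c2 n v.
      by move=> c1 c2 h n w /runsP; rewrite h => /runsP.
    by move=> /esym/injc h /h /= [k /eval_cst_code -> ?]; exists v.
  by exists (Comp c (cst_code m)) => //; exists v, m => //; apply/eval_cst_code.
pose R n w := ~ J (e (npair (npair n (nfst w)) (nsnd w))).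
have Rd : rec_dec J (fun m => R (nfst m) (nsnd m)).
  by apply: dec_not; apply: dec_oracle; apply: (rec_comp er); rec_auto.
have RP n w : R n w -> nfst w = (n \in B).
  rewrite /R eJ !(npairK1, npairK2) => nQ.
  have /QP : exists a, ~ Q (npair n (nfst w)) a by exists (nsnd w).
  by rewrite npairK1 npairK2.
have [|h [c' ch] hR] := rec_search Rd.
  move=> n; have [a Qa] := (QP (npair n (nat_of_bool (n \in B)))).1 ltac:(by rewrite npairK1 npairK2).
  by exists (npair (nat_of_bool (n \in B)) a); rewrite /R eJ !(npairK1, npairK2).
exists (Comp Left c') => n; exists (h n) => //=.
by rewrite (RP n).
Qed.

Local Open Scope ring_scope.
Local Open Scope quotient_scope.

(** * Metric completions *)

Section InverseSuccessor.
Context {R : realType}.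

Definition invS (n : nat) : R := n.+1%:R^-1.

Lemma invS_gt0 n : 0 < invS n.
Proof. by rewrite invr_gt0 ltr0n. Qed.

Lemma invS_le n m : (invS n <= invS m) = (m <= n)%N.
Proof. by rewrite /invS lef_pV2 ?posrE ?ltr0n// ler_nat. Qed.

Lemma invS_le1 n : invS n <= 1.
Proof. by rewrite invf_le1 ?ltr0n// ler1n. Qed.

Lemma invS_lt_ex (e : R) : 0 < e -> exists n : nat, invS n < e.
Proof.
move=> e0; exists (Num.truncn e^-1).
by rewrite -[ltRHS]invrK ltf_pV2 ?posrE ?invr_gt0 ?ltr0n// truncnS_gt.
Qed.

End InverseSuccessor.

Section Metric.
Context {R : realType} {T : metricType R}.
Implicit Types (z w : T) (A B S : set T).

(* One fixed elaboration of [mdist]: [mdist] itself occurs with several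
   syntactically different paths to [numDomainType], which [lra] tells apart. *)
Definition dst z w : R := mdist z w.

Lemma dst_tri z w x : dst z x <= dst z w + dst w x.
Proof. exact: metric_triangle. Qed.

Lemma dst_sym z w : dst z w = dst w z.
Proof. exact: metric_sym. Qed.

Lemma dst_ge0 z w : 0 <= dst z w.
Proof. exact: mdist_ge0. Qed.

Lemma dstxx z : dst z z = 0.
Proof. exact: mdistxx. Qed.

Lemma dst_eq0 z w : dst z w = 0 -> z = w.
Proof. exact: mdist_positivity. Qed.

Lemma nbhs_dstE z S :
  nbhs z S <-> exists2 e : R, 0 < e & forall w, dst z w < e -> S w.
Proof.
split=> [/nbhs_ballP[e e0 zS]|[e e0 zS]].
  by exists e => // w zw; apply: zS; rewrite ballEmdist.
by apply/nbhs_ballP; exists e => // w; rewrite ballEmdist; exact: zS.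
Qed.

Lemma open_dstE S :
  open S <-> forall z, S z -> exists2 e : R, 0 < e & forall w, dst z w < e -> S w.
Proof.
rewrite openE; split=> H z Sz; first by apply/nbhs_dstE; exact: H.
by apply/nbhs_dstE; exact: H.
Qed.

Lemma open_dball (c : T) (r : R) : open [set z | dst z c < r].
Proof.
apply/open_dstE => z /= zr; exists (r - dst z c); first by rewrite subr_gt0.
move=> w zw; have := dst_tri w z c; rewrite (dst_sym w z); lra.
Qed.

Lemma dst_le_eq z w : (forall e : R, 0 < e -> dst z w <= e) -> z = w.
Proof.
move=> H; apply: (@dst_eq0); apply/eqP; rewrite eq_le dst_ge0 andbT.
by apply/ler_addgt0Pl => e e0; rewrite addr0; exact: H.
Qed.

(** The form in which compactness is used: a property monotone in [n] that holds near every point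
    from some [n] on does so with one [n] for all. It yields finite subcovers, positive distances
    and Lebesgue numbers. *)
Lemma compact_near_nat A (P : nat -> T -> Prop) : compact A ->
  (forall n m z, (n <= m)%N -> P n z -> P m z) ->
  (forall z, A z -> exists n, \forall w \near z, P n w) ->
  exists n, forall z, A z -> P n z.
Proof.
move=> /compact_near_coveringP cA Pmon Pnear.
have [] := cA nat \oo P _.
  move=> z /Pnear[n Pn].
  exists ([set w | P n w], [set m | (n <= m)%N]) => /=.
    by split=> //; exists n.
  by move=> [w m] /= [Pw nm]; exact: Pmon nm Pw.
by move=> n _ H; exists n => z Az; apply: H => /=.
Qed.

Lemma compact_separated A B : compact A -> closed B -> A `&` B = set0 ->
  exists2 e : R, 0 < e & forall a b, A a -> B b -> e <= dst a b.
Proof.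
move=> cA cB AB0.
have [||n H] := compact_near_nat (P := fun n a => forall b, B b -> invS n <= dst a b) cA.
- move=> n m z nm H b /H; apply: le_trans.
  by rewrite invS_le.
- move=> z Az.
  have /open_dstE/(_ z)[|e e0 zB] : open (~` B) by exact: closed_openC.
    by move=> Bz; have : (A `&` B) z by []; rewrite AB0.
  have [n ne] := invS_lt_ex (e := e / 2) ltac:(lra).
  exists n; apply/nbhs_dstE; exists (e / 2); first by lra.
  move=> w zw b Bb; rewrite leNgt; apply/negP => wb.
  by apply: (zB b) => //; have := dst_tri z w b; lra.
by exists (invS n); rewrite ?invS_gt0// => a b Aa /(H a Aa).
Qed.

Lemma lip_continuous (f : T -> R) :
  (forall z w, `|f z - f w| <= dst z w) -> continuous f.
Proof.
move=> H z; apply/cvgrPdist_lt => e e0; apply/nbhs_dstE; exists e => // w zw.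
by apply: le_lt_trans zw.
Qed.

End Metric.

Lemma unif_continuous (R : realType) (T U : metricType R) (f : T -> U) :
  (forall e : R, 0 < e -> exists2 d : R, 0 < d &
    forall z w, dst z w < d -> dst (f z) (f w) < e) -> continuous f.
Proof.
move=> H z S /nbhs_dstE[e e0 HS].
apply/nbhs_dstE; have [d d0 Hd] := H e e0; exists d => // w /Hd; exact: HS.
Qed.

Section CompletionTheory.
Context {R : realType} (M : nat_metric R).
Notation sp := (special_point M).
Implicit Types (u : nat -> nat) (z w : completion M).

Lemma dst_special p q : dst (sp p) (sp q) = M p q.
Proof. exact: mdist_special_point. Qed.

Definition converges u z := forall e : R, 0 < e ->
  exists N, forall n, (N <= n)%N -> dst z (sp (u n)) < e.

Lemma cauchy_converges u : is_cauchy M u -> exists z, converges u z.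
Proof.
move=> cu.
pose cs : cauchy_seq M := exist _ u (asboolT cu); exists (\pi_(completion M) cs).
move=> e e0; have [N H] := cu (e / 2) ltac:(lra); exists N => n Nn.
rewrite /dst mdist_pi; apply: (@le_lt_trans _ _ (e / 2)); last by lra.
have := @cauchy_dist_cvg _ M cs (exist _ (fun=> u n) (cst_is_cauchy M (u n))).
move=> /cvgP cv; apply: limr_le => //.
by exists N => // m Nm /=; apply: ltW; exact: H.
Qed.

Lemma converges_exists z : exists2 u, is_cauchy M u & converges u z.
Proof.
exists (val (repr z)); first exact: cauchy_seqP.
rewrite -[z in converges _ z]reprK.
move=> e e0; have [N H] := cauchy_seqP (repr z) (e := e / 2) ltac:(lra); exists N => n Nn.
rewrite /dst mdist_pi; apply: (@le_lt_trans _ _ (e / 2)); last by lra.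
have := @cauchy_dist_cvg _ M (repr z) (exist _ (fun=> val (repr z) n) (cst_is_cauchy M _)).
move=> /cvgP cv; apply: limr_le => //.
by exists N => // m Nm /=; apply: ltW; exact: H.
Qed.

Lemma special_dense z (e : R) : 0 < e -> exists p, dst z (sp p) < e.
Proof.
move=> e0; have [u _ uz] := converges_exists z.
by have [N H] := uz e e0; exists (u N); exact: H.
Qed.

Lemma open_special (S : set (completion M)) : open S -> S !=set0 -> exists p, S (sp p).
Proof.
move=> /open_dstE oS [z Sz]; have [e e0 H] := oS z Sz.
by have [p zp] := special_dense z e0; exists p; exact: H.
Qed.

Lemma lip_extend (f : nat -> R) : (forall p q, `|f p - f q| <= M p q) ->
  exists2 F : completion M -> R, forall p, F (sp p) = f p &
    forall z w, `|F z - F w| <= dst z w.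
Proof.
move=> lf.
have Fex z : exists r : R, forall p, `|r - f p| <= dst z (sp p).
  (* the intervals [f p - d(z, p), f p + d(z, p)] meet pairwise *)
  pose E : set R := [set f p - dst z (sp p) | p in setT].
  have ub q : ubound E (f q + dst z (sp q)).
    move=> _ [p _ <-]; have := lf p q; have := dst_tri (sp p) z (sp q).
    rewrite dst_special (dst_sym (sp p) z) ler_norml => h /andP[]; lra.
  have E0 : E !=set0 by exists (f 0%N - dst z (sp 0%N)); exists 0%N.
  exists (sup E) => p; rewrite ler_norml; apply/andP; split.
    have := ub_le_sup (x := f p - dst z (sp p)) (ex_intro _ _ (ub 0%N)).
    by move=> /(_ (ex_intro2 _ _ p I erefl)); lra.
  have := ge_sup E0 (ub p); lra.
have [F FP] := choice Fex.
exists F => [p|z w].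
  by have := FP (sp p) p; rewrite dstxx normr_le0 subr_eq0 => /eqP.
apply/ler_addgt0Pr => e e0.
have [p wp] := special_dense w (e := e / 2) ltac:(lra).
have := FP z p; have := FP w p; have := dst_tri z w (sp p).
by rewrite !ler_norml => ? /andP[? ?] /andP[? ?]; apply/andP; split; lra.
Qed.

End CompletionTheory.

Section UniformExtension.
Context {R : realType} (M M' : nat_metric R).

Definition unif_map (phi : nat -> nat) := forall e : R, 0 < e ->
  exists2 d : R, 0 < d & forall p q, M p q < d -> M' (phi p) (phi q) < e.

(** [F z] is chosen as the limit of the images along a single sequence converging to [z]. The
    uniform modulus gives continuity and shows that the choice does not matter at special points. *)
Lemma unif_extend phi : unif_map phi ->
  exists2 F : completion M -> completion M',
    forall p, F (special_point M p) = special_point M' (phi p) & continuous F.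
Proof.
move=> uphi.
have Fex z : exists z', exists2 u, converges (M := M) u z & converges (M := M') (phi \o u) z'.
  have [u cu uz] := converges_exists z.
  have [z' uz'] : exists z', converges (M := M') (phi \o u) z'.
    apply: cauchy_converges => e /uphi[d d0 H].
    have [N HN] := cu d d0; exists N => m n Nm Nn; apply: H; exact: HN.
  by exists z', u.
have [F FP] := choice Fex.
have unifF (e : R) : 0 < e -> exists2 d : R, 0 < d &
    forall z w, dst z w < d -> dst (F z) (F w) < e.
  move=> e0; have [d d0 H] := uphi (e / 3) ltac:(lra).
  exists (d / 3); first by lra.
  move=> z w zw; have [u uz uz'] := FP z; have [v vw vw'] := FP w.
  have [N1 h1] := uz (d / 3) ltac:(lra); have [N2 h2] := vw (d / 3) ltac:(lra).
  have [N3 h3] := uz' (e / 3) ltac:(lra); have [N4 h4] := vw' (e / 3) ltac:(lra).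
  pose n := (N1 + N2 + N3 + N4)%N.
  have := h1 n ltac:(rewrite /n; lia); have := h2 n ltac:(rewrite /n; lia).
  have := h3 n ltac:(rewrite /n; lia); have := h4 n ltac:(rewrite /n; lia).
  move=> /= k4 k3 k2 k1.
  have := H (u n) (v n); rewrite -!dst_special.
  have := dst_tri (special_point M (u n)) z (special_point M (v n)).
  have := dst_tri z w (special_point M (v n)).
  have := dst_tri (F z) (special_point M' (phi (u n))) (F w).
  have := dst_tri (special_point M' (phi (u n))) (special_point M' (phi (v n))) (F w).
  rewrite (dst_sym (special_point M (u n)) z) (dst_sym _ (F w)) (dst_sym (special_point M' (phi (v n)))).
  move=> t1 t2 t3 t4 /(_ ltac:(lra)); lra.
exists F; last exact: unif_continuous.
move=> p; apply: dst_le_eq => e e0.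
have [d d0 H] := uphi (e / 2) ltac:(lra).
have [u uz uz'] := FP (special_point M p).
have [N1 h1] := uz d ltac:(lra); have [N2 h2] := uz' (e / 2) ltac:(lra).
have := h1 (N1 + N2)%N ltac:(lia); have := h2 (N1 + N2)%N ltac:(lia).
rewrite dst_special /= => k2 /H k1.
have := dst_tri (F (special_point M p)) (special_point M' (phi (u (N1 + N2)%N)))
  (special_point M' (phi p)).
by rewrite dst_special nat_dist_sym; lra.
Qed.

End UniformExtension.

Lemma dense_continuous_id (R : realType) (M : nat_metric R)
    (F : completion M -> completion M) : continuous F ->
  (forall p, F (special_point M p) = special_point M p) -> forall z, F z = z.
Proof.
move=> cF Fp z; apply: dst_le_eq => e e0.
have : nbhs (F z) [set w | dst (F z) w < e / 2].
  by apply/nbhs_dstE; exists (e / 2) => //; lra.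
move=> /(cF z)/nbhs_dstE[d d0 H].
have [p zp] := special_dense z (e := Num.min d (e / 2)) ltac:(rewrite lt_min; lra).
move: zp; rewrite lt_min => /andP[zd ze].
have /= := H _ zd; rewrite Fp.
have := dst_tri (F z) (special_point M p) z.
by rewrite (dst_sym (special_point M p) z); lra.
Qed.

Lemma unif_homeomorphic (R : realType) (M M' : nat_metric R) (phi psi : nat -> nat) :
  unif_map M M' phi -> unif_map M' M psi -> cancel phi psi -> cancel psi phi ->
  homeomorphic (completion M) (completion M').
Proof.
move=> /unif_extend[F FP cF] /unif_extend[G GP cG] K1 K2.
exists F, G; split=> //.
- apply: (@dense_continuous_id R M (G \o F)) => [z|p] /=.
    by apply: continuous_comp; [exact: cF|exact: cG].
  by rewrite FP GP K1.
- apply: (@dense_continuous_id R M' (F \o G)) => [z|p] /=.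
    by apply: continuous_comp; [exact: cG|exact: cF].
  by rewrite GP FP K2.
Qed.

(** * The fan metric *)

Section Fan.
Context {R : realType}.
Notation invS := (@invS R).

Lemma invS_sub i j : invS i - invS j = invS i * invS j * (j%:R - i%:R).
Proof.
have nz (n : nat) : n.+1%:R != 0 :> R by rewrite pnatr_eq0.
rewrite (_ : j%:R - i%:R = j.+1%:R - i.+1%:R :> R); last first.
  by rewrite -[j.+1%:R]natr1 -[i.+1%:R]natr1 opprD addrACA subrr addr0.
by rewrite mulrBr /invS mulfVK// [X in _ = _ - X]mulrAC mulVf// mul1r.
Qed.

(** The nearest other reciprocal is [invS i.+1], at exactly this distance. *)
Lemma invS_gap i j : i != j -> invS i * invS i.+1 <= `|invS i - invS j|.
Proof.
rewrite neq_ltn => /orP[] ij.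
  apply: le_trans (ler_norm _); apply: (@le_trans _ _ (invS i - invS i.+1)).
    by rewrite invS_sub -natr1 addrAC subrr add0r mulr1.
  by rewrite lerD2l lerN2 invS_le.
rewrite distrC; apply: le_trans (ler_norm _); rewrite invS_sub (mulrC (invS j)).
have i0 := invS_gt0 i (R := R); have j0 := invS_gt0 j (R := R).
apply: (@le_trans _ _ (invS i * invS j)).
  by rewrite ler_pM2l// invS_le; lia.
rewrite ler_pMr ?mulr_gt0// -natrB ?ler1n ?subn_gt0//.
exact: ltnW.
Qed.

(* [xpt] enumerates the dyadic rationals of the open unit interval without
   repetition: for [m + 1 = 2 ^ L + a] with [a < 2 ^ L], [xpt m = (2 a + 1) / 2 ^ (L + 1)].
   Injectivity is needed because the points of a presentation are distinct. *)
Definition pw (m : nat) : nat := 2 ^ (trunc_log 2 m.+1).+1.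
Definition xpt (m : nat) : R := (m.*2.+3 - pw m)%:R / (pw m)%:R.

Lemma pw_bounds m : (pw m <= m.*2.+2)%N /\ (m.+2 <= pw m)%N.
Proof.
have /andP[] := trunc_log_bounds (isT : (1 < 2)%N) (isT : (0 < m.+1)%N).
by rewrite /pw => h1 h2; rewrite h2 expnS; lia.
Qed.

Lemma xpt_gt0 m : 0 < xpt m.
Proof.
have [h1 h2] := pw_bounds m.
by rewrite divr_gt0// ltr0n; lia.
Qed.

Lemma xpt_le1 m : xpt m <= 1.
Proof.
have [h1 h2] := pw_bounds m.
by rewrite ler_pdivrMr ?ltr0n ?mul1r ?ler_nat; lia.
Qed.

Lemma xpt_inj m n : xpt m = xpt n -> m = n.
Proof.
have [h1 h2] := pw_bounds m; have [h3 h4] := pw_bounds n.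
have nz (k : nat) : (0 < k)%N -> k%:R != 0 :> R by rewrite pnatr_eq0 lt0n.
move=> /eqP; rewrite /xpt eqr_div ?nz; try lia.
rewrite -!natrM eqr_nat => /eqP H.
(* odd numerators over powers of two *)
have {H} H : (m.*2.+3 * pw n = n.*2.+3 * pw m)%N.
  rewrite !mulnBl in H; nia.
suff : pw m = pw n by move=> e; move: H; rewrite e => /eqP; rewrite eqn_pmul2r; lia.
have l2 (k : nat) : logn 2 (k.*2.+3) = 0%N by apply: logn_coprime; rewrite coprime2n /= odd_double.
have := congr1 (logn 2) H; rewrite !lognM ?l2 ?add0n /pw ?expn_gt0//.
by rewrite !pfactorK// => ->.
Qed.

(** The points with m + 1 = 2 ^ Q + a are the midpoints of the dyadic intervals
    [a / 2 ^ Q, (a + 1) / 2 ^ Q]. The explicit bound on the index is what the finite nets of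
    [fan_net] rely on. *)
Lemma xpt_dense (t : R) Q : 0 <= t <= 1 ->
  exists2 m, (m < 2 ^ Q.+1)%N & `|xpt m - t| <= invS Q.
Proof.
move=> /andP[t0 t1].
have q0 : 0 < (2 ^ Q)%:R :> R by rewrite ltr0n expn_gt0.
have [a aQ ta] : exists2 a, (a < 2 ^ Q)%N & a%:R <= t * (2 ^ Q)%:R <= a.+1%:R.
  have [tlt|] := ltP t 1.
    have tq : 0 <= t * (2 ^ Q)%:R by rewrite mulr_ge0// ltW.
    exists (Num.truncn (t * (2 ^ Q)%:R)); first by rewrite truncn_lt_nat// gtr_pMl.
    by have /andP[-> /ltW ->] := truncn_itv tq.
  move=> t1'; have -> : t = 1 by apply/eqP; rewrite eq_le t1 t1'.
  exists (2 ^ Q).-1; first by rewrite prednK ?expn_gt0.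
  by rewrite mul1r prednK ?expn_gt0// lexx andbT ler_nat leq_pred.
exists (2 ^ Q + a).-1; first by have := expn_gt0 2 Q; rewrite expnS; lia.
have LE : pw (2 ^ Q + a).-1 = (2 ^ Q.+1)%N.
  rewrite /pw prednK; last by rewrite addn_gt0 expn_gt0.
  have aQ' : (2 ^ Q <= 2 ^ Q + a < 2 ^ Q.+1)%N by rewrite expnS; lia.
  by rewrite (trunc_log_eq _ aQ').
rewrite /xpt LE (_ : _ - _ = a.*2.+1)%N; last first.
  by have := expn_gt0 2 Q; rewrite expnS; lia.
have qn : (2 ^ Q.+1)%:R = 2 * (2 ^ Q)%:R :> R by rewrite expnS natrM.
have an : a.*2.+1%:R = 2 * a%:R + 1 :> R by rewrite -natr1 -mul2n natrM.
apply: (@le_trans _ _ ((2 ^ Q)%:R^-1)); last first.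
  by rewrite lef_pV2 ?posrE// ?ltr0n// ler_nat ltn_expl.
rewrite qn an; move: ta; rewrite -natr1 => /andP[ta1 ta2].
have -> : (2 * a%:R + 1) / (2 * (2 ^ Q)%:R) - t =
    ((2 * a%:R + 1) / 2 - t * (2 ^ Q)%:R) / (2 ^ Q)%:R :> R.
  by rewrite mulrBl mulfK ?gt_eqF// invfM mulrA.
rewrite normrM normfV (ger0_norm (ltW q0)) -[leRHS]mul1r ler_wpM2r ?invr_ge0 ?(ltW q0)//.
by rewrite ler_norml; apply/andP; split; lra.
Qed.

(* Leg [i = <g, k>] belongs to group [g = <n, _>], whose legs with [k < n + 2] may
   be glued together; these share the class number [<g, 0>]. *)
Definition sz (g : nat) : nat := (nfst g).+2.
Definition cls (i : nat) : nat :=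
  npair (nfst i) (if (nsnd i < sz (nfst i))%N then 0%N else nsnd i).

Lemma npair_mono a b a' b' : (a <= a')%N -> (b <= b')%N -> (npair a b <= npair a' b')%N.
Proof.
have := Cantor.to_nat_spec a b; have := Cantor.to_nat_spec a' b'.
by rewrite /npair; nia.
Qed.

Lemma cls_le i : (cls i <= i)%N.
Proof.
rewrite -{2}(nfst_nsndK i) /cls; by case: ifP => _ //; apply: npair_mono.
Qed.

Lemma cls_eq i j : cls i = cls j ->
  nfst i = nfst j /\ (i = j \/ (nsnd i < sz (nfst i))%N /\ (nsnd j < sz (nfst i))%N).
Proof.
move=> /npair_inj[gE H]; split=> //; move: H.
rewrite -gE; case: ifP; case: ifP => hj hi //=; first by right.
- by move=> e; move: hj; rewrite -e /sz.
- by move=> e; move: hi; rewrite e /sz.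
by move=> e; left; rewrite -(nfst_nsndK i) -(nfst_nsndK j) gE e.
Qed.

(** A class of several legs lies in a group [g] with at most [g + 2] of them, so classes up to [Q]
    involve finitely many legs. All others are close to the limit arc. *)
Lemma cls_bound Q i : (cls i <= Q)%N -> (i <= npair Q Q.+2)%N.
Proof.
rewrite -{2}(nfst_nsndK i) /cls /sz => H.
have h2 := nfst_nsnd_le (nfst i).
apply: npair_mono; move: H; case: ifP => h H.
all: have := npair_ge (nfst i) 0; have := npair_ge (nfst i) (nsnd i); lia.
Qed.

Section FanMetric.
Variable W : nat -> nat -> Prop.

(** The reciprocal of the first failure of [W g], or 0 if there is none: a real computable from [W]
    uniformly in [g], although its vanishing is a Pi_1 question. *)
Definition eps (g : nat) : R := if `[< forall b, W g b >] then 0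
  else invS (xget 0%N [set b | ~ W g b /\ forall j, (j < b)%N -> W g j]).

(* The stage-[s] approximation: the least failure of [W g] below [s], or [s]. *)
Definition lb (g s : nat) : nat :=
  nat_rect (fun=> nat) 0%N (fun b r => if `[< r = b /\ W g b >] then b.+1 else r) s.

Lemma eps_le1 g : 0 <= eps g <= 1.
Proof.
by rewrite /eps; case: ifP => _; rewrite ?lexx ?ler01// invS_le1 ltW ?invS_gt0.
Qed.

Lemma eps_eq0 g : eps g = 0 <-> forall b, W g b.
Proof.
rewrite /eps; case: asboolP => // H; split=> // e.
by have := invS_gt0 (R := R) (xget 0%N [set b | ~ W g b /\ forall j, (j < b)%N -> W g j]); rewrite e ltxx.
Qed.

(** As long as no failure has appeared below [s], the number and its approximation both lie in [0,
    [invS s]]; afterwards they agree. *)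
Lemma eps_lb g s : `|eps g - invS (lb g s)| <= invS s.
Proof.
have lbP : lb g s = s /\ (forall j, (j < s)%N -> W g j) \/
    (lb g s < s)%N /\ ~ W g (lb g s) /\ forall j, (j < lb g s)%N -> W g j.
  elim: s => [|s IH]; first by left.
  rewrite [lb g s.+1]/= -/(lb g s); case: asboolP => [[e Ws]|nW].
    left; split=> // j; rewrite ltnS leq_eqVlt => /orP[/eqP ->//|js].
    by case: IH => [[_]|[]]; [exact|rewrite e ltnn].
  case: IH => [[e H]|[lt H]]; right; last by split=> //; exact: ltnW.
  by rewrite e ltnSn; split=> //; split=> // Ws; apply: nW.
have s0 := invS_gt0 (R := R) s.
rewrite /eps; case: asboolP => [H|].
  case: lbP => [[-> _]|[_ [/(_ (H _))//]]].
  by rewrite sub0r normrN gtr0_norm.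
move=> /existsNP[b Wb]; set S := [set b | _].
have [b1 Sb1] : exists b1, S b1.
  elim/ltn_ind: b Wb => b IH Wb.
  have [H|/existsNP[j /not_implyP[jb Wj]]] := pselect (forall j, (j < b)%N -> W g j).
    by exists b.
  exact: IH jb Wj.
have [nW mW] : S (xget 0%N S) by apply: xgetPex; exists b1.
move: (xget 0%N S) nW mW => b0 nW mW {b Wb b1 Sb1 S}.
case: lbP => [[-> H]|[lt [nW' mW']]].
  have sb : (s <= b0)%N by rewrite leqNgt; apply/negP => /H.
  have : invS b0 <= invS s by rewrite invS_le.
  have := invS_gt0 (R := R) b0; rewrite ler_norml => ? ?; apply/andP; split; lra.
suff -> : lb g s = b0 by rewrite subrr normr0 ltW.
by case: (ltngtP (lb g s) b0) => // [/mW //|/mW'].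
Qed.

(* Point [<i, m>] is the point of leg [i] over [t = xpt m]. The coordinate [cH]
   separates the classes; within a class [yy] makes the legs fan out from a common
   point over [t = 0] if [eps = 0], and keeps them disjoint if [eps > 0]. *)
Definition yy (i : nat) (t : R) : R := Num.max t (eps (nfst i)) * invS i.
Definition cX (p : nat) : R := xpt (nsnd p).
Definition cH (p : nat) : R := invS (cls (nfst p)).
Definition cY (p : nat) : R := yy (nfst p) (cX p).
Definition fan_dist (p q : nat) : R :=
  `|cX p - cX q| + `|cH p - cH q| + `|cY p - cY q|.

Lemma max_lip (a t s : R) : `|Num.max t a - Num.max s a| <= `|t - s|.
Proof.
rewrite /Num.max; case: (ltP t a) => ta; case: (ltP s a) => sa; rewrite ?subrr ?normr0//;
rewrite ler_norml; have := ler_norm (t - s); have := ler_norm (s - t); rewrite (distrC s);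
move=> ? ?; apply/andP; split; lra.
Qed.

Lemma yy_lip i t s : `|yy i t - yy i s| <= `|t - s|.
Proof.
rewrite /yy -mulrBl normrM (ger0_norm (ltW (invS_gt0 _))).
apply: le_trans (max_lip (eps (nfst i)) t s).
by rewrite ler_piMr// invS_le1.
Qed.

Lemma yy_ge0 i t : 0 <= t -> 0 <= yy i t.
Proof.
move=> t0; apply: mulr_ge0; first by rewrite le_max t0.
exact: ltW (invS_gt0 _).
Qed.

Lemma yy_le i t : t <= 1 -> yy i t <= invS i.
Proof.
move=> t1; have /andP[_ e1] := eps_le1 (nfst i).
by apply: ler_piMl; [exact: ltW (invS_gt0 _)|rewrite ge_max t1].
Qed.

Definition rho (i : nat) : R := invS i * invS i.+1.

Lemma rho_gt0 i : 0 < rho i.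
Proof. by rewrite mulr_gt0 ?invS_gt0. Qed.

(** Over the same abscissa [t] the two heights differ by the maximum times a difference of
    reciprocals, which [invS_gap] bounds below; replacing [t] by [s] on leg [j] costs at most the
    distance of the abscissae. *)
Lemma yy_sep i j t s : i != j -> nfst i = nfst j -> 0 <= t ->
  Num.max t (eps (nfst i)) * rho i <= `|t - s| + `|yy i t - yy j s|.
Proof.
move=> ij gE t0.
have h1 : `|yy i t - yy j t| <= `|yy i t - yy j s| + `|yy j t - yy j s|.
  rewrite (distrC (yy j t)); apply: le_trans (ler_normD _ _).
  by rewrite addrA subrK.
have h2 := yy_lip j t s.
have h3 : Num.max t (eps (nfst i)) * rho i <= `|yy i t - yy j t|.
  have m0 : 0 <= Num.max t (eps (nfst i)) by rewrite le_max t0.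
  rewrite /yy -gE -mulrBr normrM (ger0_norm m0).
  by apply: ler_wpM2l => //; exact: invS_gap.
by rewrite (le_trans h3)// (le_trans h1)// addrC lerD2r.
Qed.

Lemma cls_sep i j : `|invS (cls i) - invS (cls j)| < rho (cls i) -> cls i = cls j.
Proof.
move=> H; apply/eqP/negPn/negP => /invS_gap.
by rewrite -/(rho (cls i)) leNgt H.
Qed.

Lemma fan_distxx p : fan_dist p p = 0.
Proof. by rewrite /fan_dist !subrr normr0 !addr0. Qed.

Lemma fan_dist_pos p q : fan_dist p q = 0 -> p = q.
Proof.
move=> /eqP; rewrite /fan_dist !paddr_eq0 ?addr_ge0// !normr_eq0 !subr_eq0.
move=> /andP[/andP[/eqP hx /eqP hh] /eqP hy].
have sE : nsnd p = nsnd q by exact: xpt_inj.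
have cE : cls (nfst p) = cls (nfst q) by apply: cls_sep; rewrite -/(cH p) hh subrr normr0 rho_gt0.
have [gE _] := cls_eq cE.
rewrite -(nfst_nsndK p) -(nfst_nsndK q) sE; congr npair.
apply/eqP/negPn/negP => ne.
have : Num.max (cX p) (eps (nfst (nfst p))) * rho (nfst p) <= `|cX p - cX q| + `|cY p - cY q|.
  exact: yy_sep ne gE (ltW (xpt_gt0 _)).
rewrite {2}hx hy !subrr normr0 addr0 leNgt pmulr_lgt0 ?rho_gt0//.
by rewrite lt_max xpt_gt0.
Qed.

Lemma fan_dist_sym p q : fan_dist p q = fan_dist q p.
Proof. by rewrite /fan_dist distrC (distrC (cH p)) (distrC (cY p)). Qed.

Lemma fan_dist_triangle q p r : fan_dist p r <= fan_dist p q + fan_dist q r.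
Proof.
have tri (f : nat -> R) : `|f p - f r| <= `|f p - f q| + `|f q - f r|.
  by apply: le_trans (ler_normD _ _); rewrite addrA subrK.
by have := tri cX; have := tri cH; have := tri cY; rewrite /fan_dist; lra.
Qed.

Definition fan_metric : nat_metric R :=
  NatMetric fan_distxx fan_dist_pos fan_dist_sym fan_dist_triangle.

End FanMetric.

(** The map permutes groups and keeps the abscissa and the place in the group. Only finitely many
    legs have an image far from the limit arc, and [loc] treats these one by one; between all other
    legs the distance of the images is governed by the abscissae. Good groups must go to good
    groups, since only there do different legs come arbitrarily close. *)
Lemma fan_unif (W W' : nat -> nat -> Prop) (sigma tau : nat -> nat) :
  cancel sigma tau -> (forall g, nfst (sigma g) = nfst g) ->
  (forall g, (forall b, W g b) -> forall b, W' (sigma g) b) ->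
  unif_map (fan_metric W) (fan_metric W')
    (fun p => npair (npair (sigma (nfst (nfst p))) (nsnd (nfst p))) (nsnd p)).
Proof.
move=> st sn sW e e0.
pose ph i := npair (sigma (nfst i)) (nsnd i).
have [Q Qe] := invS_lt_ex (e := e / 4) ltac:(lra).
(* Points close to leg [i] lie on [i] itself or, near [t = 0], on a leg glued to it. *)
have loc i : exists2 d : R, 0 < d & forall j t s, 0 <= t <= 1 -> 0 <= s <= 1 ->
    `|t - s| + `|invS (cls i) - invS (cls j)| + `|yy W i t - yy W j s| < d ->
    `|t - s| + `|invS (cls (ph i)) - invS (cls (ph j))| + `|yy W' (ph i) t - yy W' (ph j) s| < e.
  pose g := nfst i; pose c := cls i.
  have i0 := rho_gt0 i; have c0 := rho_gt0 c; have /andP[g0 _] := eps_le1 W g.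
  have i1 : rho i <= 1.
    have := invS_le1 (R := R) i; have := invS_le1 (R := R) i.+1.
    have := invS_gt0 (R := R) i; have := invS_gt0 (R := R) i.+1; rewrite /rho; nra.
  (* In a bad group, this radius keeps every other leg of the group away from leg [i]. *)
  pose d2 := if eps W g == 0 then 1 else eps W g * rho i.
  have d20 : 0 < d2.
    by rewrite /d2; case: eqVneq => // g1; rewrite mulr_gt0// lt_neqAle eq_sym g1.
  exists (Num.min (rho c) (Num.min (e / 4 * rho i) d2)).
    by rewrite !lt_min c0 d20 mulr_gt0//; lra.
  move=> j t s /andP[t0 t1] /andP[s0 s1]; rewrite !lt_min => /and3P[hc hi h2].
  have n1 := normr_ge0 (t - s); have n2 := normr_ge0 (invS c - invS (cls j)).
  have n3 := normr_ge0 (yy W i t - yy W j s).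
  have ts : `|t - s| < e / 4 by rewrite -/c in hi; nra.
  have cE : c = cls j by apply: cls_sep; rewrite -/c in hc *; lra.
  have [gE [ij|[ki kj]]] := cls_eq cE.
    by rewrite -ij subrr normr0; have := yy_lip W' (ph i) t s; lra.
  have [<-|ij] := eqVneq i j.
    by rewrite subrr normr0; have := yy_lip W' (ph i) t s; lra.
  have sep := yy_sep W s ij gE t0; rewrite -/g in sep.
  have mt : t <= Num.max t (eps W g) by rewrite le_max lexx.
  have me : eps W g <= Num.max t (eps W g) by rewrite le_max lexx orbT.
  have tn := ler_norm (s - t); rewrite distrC in tn.
  have g00 : eps W g = 0.
    move: h2; rewrite /d2 -/c; case: eqVneq => // _ h2; exfalso.
    have : eps W g * rho i <= Num.max t (eps W g) * rho i by rewrite ler_pM2r.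
    lra.
  have te : t < e / 4.
    rewrite -(ltr_pM2r i0); have : t * rho i <= Num.max t (eps W g) * rho i by rewrite ler_pM2r.
    by rewrite -/c in hi; lra.
  have cE' : cls (ph i) = cls (ph j).
    rewrite /cls /ph !npairK1 !npairK2 /sz !sn -gE.
    by move: ki kj; rewrite /sz => -> ->.
  have e'0 k : nfst k = g -> eps W' (nfst (ph k)) = 0.
    by move=> kg; apply/eps_eq0; rewrite npairK1 kg; apply: sW; apply/eps_eq0.
  rewrite cE' subrr normr0 /yy !e'0// /Num.max !ltNge t0 s0 /=.
  have b1 k (x : R) : 0 <= x -> 0 <= x * invS k <= x.
    by move=> x0; rewrite mulr_ge0 ?(ltW (invS_gt0 _))//= ler_piMr// invS_le1.
  have /andP[? ?] := b1 (ph i) t t0; have /andP[? ?] := b1 (ph j) s s0.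
  have : `|t * invS (ph i) - s * invS (ph j)| < e / 2 by rewrite ltr_norml; apply/andP; split; lra.
  lra.
(* Image classes up to [Q] come from finitely many legs: [tau] pulls the groups back, and
   [cls_bound] limits the places within a group. *)
have [B HB] : exists B, forall i, (B < i)%N -> (Q < cls (ph i))%N.
  exists (npair (\max_(v < Q.+1) tau v) (npair Q Q.+2)) => i; apply: contraTT.
  rewrite -!leqNgt => H; rewrite -(nfst_nsndK i).
  have hk := cls_bound H; have hg := nfst_nsnd_le (cls (ph i)).
  apply: npair_mono; last by apply: leq_trans hk; apply: leq_trans (npair_ge _ _); exact: leq_addl.
  have sQ : (sigma (nfst i) < Q.+1)%N.
    rewrite ltnS; apply: leq_trans H; apply: leq_trans hg; rewrite /cls !npairK1; exact: leq_addr.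
  by rewrite -(st (nfst i)); exact: (leq_bigmax (F := fun v : 'I_Q.+1 => tau v) (Ordinal sQ)).
have [d d0 Hd] : exists2 d : R, 0 < d & forall i, (i <= B)%N -> forall j t s, 0 <= t <= 1 -> 0 <= s <= 1 ->
    `|t - s| + `|invS (cls i) - invS (cls j)| + `|yy W i t - yy W j s| < d ->
    `|t - s| + `|invS (cls (ph i)) - invS (cls (ph j))| + `|yy W' (ph i) t - yy W' (ph j) s| < e.
  elim: B {HB} => [|B [d d0 Hd]].
    by have [d d0 Hd] := loc 0%N; exists d => // i; rewrite leqn0 => /eqP ->.
  have [d' d'0 Hd'] := loc B.+1; exists (Num.min d d'); first by rewrite lt_min d0.
  move=> i; rewrite leq_eqVlt => /orP[/eqP ->|iB] j t s t01 s01; rewrite lt_min => /andP[h1 h2].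
    exact: Hd'.
  exact: Hd.
exists (Num.min d (e / 4)); first by rewrite lt_min d0; lra.
move=> p q; rewrite lt_min => /andP[pqd pqe].
rewrite /= /fan_dist /cY /cH /cX !npairK1 !npairK2 -!/(ph _).
have x01 m : 0 <= xpt m <= 1 by rewrite ltW ?xpt_gt0 ?xpt_le1.
have [pB|Bp] := leqP (nfst p) B.
  exact: Hd.
have [qB|Bq] := leqP (nfst q) B.
  have := Hd _ qB (nfst p) (xpt (nsnd q)) (xpt (nsnd p)) (x01 _) (x01 _).
  rewrite distrC (distrC (invS (cls (nfst q)))) (distrC (yy W _ _)) => /(_ pqd).
  by rewrite (distrC (invS _)) (distrC (yy W' _ _)).
have far i t : (B < i)%N -> 0 <= t <= 1 -> 0 <= invS (cls (ph i)) < e / 4 /\ 0 <= yy W' (ph i) t < e / 4.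
  move=> /HB Qi /andP[t0 t1].
  have h1 : invS (cls (ph i)) <= invS Q by rewrite invS_le ltnW.
  have h2 : invS (ph i) <= invS (cls (ph i)) by rewrite invS_le cls_le.
  have h3 := yy_le W' (ph i) t1.
  rewrite yy_ge0// ltW ?invS_gt0//=; split; lra.
have [/andP[? ?] /andP[? ?]] := far _ (xpt (nsnd p)) Bp (x01 _).
have [/andP[? ?] /andP[? ?]] := far _ (xpt (nsnd q)) Bq (x01 _).
move: pqe; rewrite /= /fan_dist /cX.
have := normr_ge0 (cH p - cH q); have := normr_ge0 (cY W p - cY W q).
have : `|invS (cls (ph (nfst p))) - invS (cls (ph (nfst q)))| < e / 4.
  by rewrite ltr_norml; apply/andP; split; lra.
have : `|yy W' (ph (nfst p)) (xpt (nsnd p)) - yy W' (ph (nfst q)) (xpt (nsnd q))| < e / 4.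
  by rewrite ltr_norml; apply/andP; split; lra.
lra.
Qed.

Lemma fan_homeomorphic (W W' : nat -> nat -> Prop) (sigma tau : nat -> nat) :
  cancel sigma tau -> cancel tau sigma -> (forall g, nfst (sigma g) = nfst g) ->
  (forall g, (forall b, W g b) <-> forall b, W' (sigma g) b) ->
  homeomorphic (completion (fan_metric W)) (completion (fan_metric W')).
Proof.
move=> st ts sn sW.
have tn g : nfst (tau g) = nfst g by rewrite -{2}(ts g) sn.
apply: (unif_homeomorphic (fan_unif (tau := tau) st sn _) (fan_unif (tau := sigma) ts tn _)).
- by move=> g /sW.
- by move=> g h; apply/sW; rewrite ts.
- by move=> p; rewrite !(npairK1, npairK2) st !nfst_nsndK.
- by move=> p; rewrite !(npairK1, npairK2) ts !nfst_nsndK.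
Qed.
End Fan.

(** * Topology of the fan space *)

Definition seq_union (T : Type) (leg : nat -> set T) (s : seq nat) : set T :=
  [set z | exists2 j, j \in s & leg j z].

(* The homeomorphism-invariant features of a fan space from which [D] is recovered:
   [f] is the left-right coordinate and [grp i] lists the legs in the component of leg [i]. *)
Definition fan_like (R : realType) (X : topologicalType) (D : set nat) : Prop :=
  exists (f : X -> R) (leg : nat -> set X) (grp : nat -> seq nat),
  [/\ continuous f,
      (forall i, closed (leg i)),
      (forall i, connected (leg i `&` [set z | 2^-1 <= f z])),
      (forall i, exists2 z, leg i z & f z = 1) &
  [/\ (forall i, [/\ uniq (grp i), i \in grp i, open (seq_union leg (grp i)) &
                     connected (seq_union leg (grp i))]),
      (forall i j k z, j \in grp i -> k \in grp i -> leg j z -> leg k z -> 0 < f z -> j = k),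
      (forall U : set X, open U -> U !=set0 -> exists i, U `&` leg i !=set0) &
      (forall n, D n <-> exists i, size (grp i) = n.+2)]].

(** The factor 3 is made for the equation of a leg, in which each of the three coordinates
    contributes its own Lipschitz constant 1. *)
Lemma lip_closed (R : realType) (T : metricType R) (f : T -> R) :
  (forall z w, `|f z - f w| <= 3 * dst z w) -> closed [set z | f z = 0].
Proof.
move=> lf; rewrite -[X in closed X]setCK; apply: open_closedC; apply/open_dstE => z /= /eqP fz.
have fz0 : 0 < `|f z| by rewrite normr_gt0.
exists (`|f z| / 3); first by lra.
by move=> w zw fw; have := lf z w; rewrite fw subr0; lra.
Qed.

Section FanSpace.
Context {R : realType} (W : nat -> nat -> Prop).
Notation M := (fan_metric W : nat_metric R).
Notation Z := (completion M).
Notation sp := (special_point M).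
Notation invS := (@invS R).
Notation rho := (@rho R).
Notation cX := (@cX R).
Notation cH := (@cH R).
Notation cY := (@cY R W).
Notation eps := (@eps R W).
Notation yy := (@yy R W).

Lemma cX_lip p q : `|cX p - cX q| <= M p q.
Proof. by rewrite /= /fan_dist -addrA lerDl addr_ge0. Qed.
Lemma cH_lip p q : `|cH p - cH q| <= M p q.
Proof. by rewrite /= /fan_dist addrAC lerDr addr_ge0. Qed.
Lemma cY_lip p q : `|cY p - cY q| <= M p q.
Proof. by rewrite /= /fan_dist lerDr addr_ge0. Qed.

Definition zX : Z -> R := s2val (cid2 (lip_extend cX_lip)).
Definition zH : Z -> R := s2val (cid2 (lip_extend cH_lip)).
Definition zY : Z -> R := s2val (cid2 (lip_extend cY_lip)).

Lemma zX_sp p : zX (sp p) = cX p. Proof. exact: (s2valP (cid2 (lip_extend cX_lip))). Qed.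
Lemma zH_sp p : zH (sp p) = cH p. Proof. exact: (s2valP (cid2 (lip_extend cH_lip))). Qed.
Lemma zY_sp p : zY (sp p) = cY p. Proof. exact: (s2valP (cid2 (lip_extend cY_lip))). Qed.
Lemma zX_lip z w : `|zX z - zX w| <= dst z w.
Proof. exact: (s2valP' (cid2 (lip_extend cX_lip))). Qed.
Lemma zH_lip z w : `|zH z - zH w| <= dst z w.
Proof. exact: (s2valP' (cid2 (lip_extend cH_lip))). Qed.
Lemma zY_lip z w : `|zY z - zY w| <= dst z w.
Proof. exact: (s2valP' (cid2 (lip_extend cY_lip))). Qed.

Lemma norm4 (a b c d : R) : `|(a - b) - (c - d)| <= `|a - c| + `|b - d|.
Proof.
have -> : a - b - (c - d) = (a - c) - (b - d) by lra.
exact: ler_normB.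
Qed.

Lemma fan_dstE z w : dst z w = `|zX z - zX w| + `|zH z - zH w| + `|zY z - zY w|.
Proof.
apply/eqP; rewrite -subr_eq0 -normr_le0; apply/ler_addgt0Pl => e e0; rewrite addr0.
have [p zp] := special_dense z (e := e / 8) ltac:(lra).
have [q wq] := special_dense w (e := e / 8) ltac:(lra).
have key (f : Z -> R) : (forall z w, `|f z - f w| <= dst z w) ->
    `| `|f z - f w| - `|f (sp p) - f (sp q)| | <= e / 4.
  move=> lf; apply: le_trans (ler_dist_dist _ _) _.
  apply: le_trans (norm4 _ _ _ _) _.
  by have := lf z (sp p); have := lf w (sp q); lra.
have := key _ zX_lip; have := key _ zH_lip; have := key _ zY_lip.
rewrite !zX_sp !zH_sp !zY_sp.
have := dst_special M p q; rewrite /= /fan_dist => E.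
have h1 := dst_tri z (sp p) w; have h2 := dst_tri (sp p) (sp q) w.
have h3 := dst_tri (sp p) z (sp q); have h4 := dst_tri z w (sp q).
rewrite (dst_sym (sp q) w) in h2; rewrite (dst_sym (sp p) z) in h3.
rewrite E in h2 h3; rewrite !ler_norml => /andP[? ?] /andP[? ?] /andP[? ?].
by apply/andP; split; lra.
Qed.

Lemma fan_eq z w : zX z = zX w -> zH z = zH w -> zY z = zY w -> z = w.
Proof. by move=> e1 e2 e3; apply: dst_eq0; rewrite fan_dstE e1 e2 e3 !subrr normr0 !addr0. Qed.

(** Completeness seen in coordinates: the image of the space in the cube is closed. *)
Lemma fan_point a b c :
  (forall e : R, 0 < e -> exists p, `|cX p - a| + `|cH p - b| + `|cY p - c| < e) ->
  exists z, [/\ zX z = a, zH z = b & zY z = c].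
Proof.
move=> H; have /choice[u uP] : forall n, exists p, `|cX p - a| + `|cH p - b| + `|cY p - c| < invS n.
  by move=> n; apply: H; exact: invS_gt0.
have tri (x y w : R) : `|x - y| <= `|x - w| + `|y - w|.
  by rewrite (distrC y); apply: le_trans (ler_normD _ _); rewrite addrA subrK.
have [z uz] : exists z, converges (M := M) u z.
  apply: cauchy_converges => e e0; have [N Ne] := invS_lt_ex (e := e / 2) ltac:(lra).
  exists N => m n Nm Nn.
  have h1 : invS m <= invS N by rewrite invS_le.
  have h2 : invS n <= invS N by rewrite invS_le.
  have := uP m; have := uP n; rewrite /= /fan_dist.
  have := tri (cX (u m)) (cX (u n)) a; have := tri (cH (u m)) (cH (u n)) b.
  have := tri (cY (u m)) (cY (u n)) c; lra.
have key (f : Z -> R) (g : nat -> R) x : (forall z w, `|f z - f w| <= dst z w) ->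
    (forall p, f (sp p) = g p) -> (forall n, `|g (u n) - x| < invS n) -> f z = x.
  move=> lf fg gx; apply/eqP; rewrite -subr_eq0 -normr_le0; apply/ler_addgt0Pl => e e0.
  rewrite addr0; have [N Ne] := invS_lt_ex (e := e / 2) ltac:(lra).
  have [N' HN'] := uz (e / 2) ltac:(lra).
  pose n := (N + N')%N.
  have h1 : invS n <= invS N by rewrite invS_le leq_addr.
  have h2 := HN' n (leq_addl _ _).
  have := lf z (sp (u n)); have := gx n; rewrite fg.
  have := tri (f z) x (g (u n)); rewrite (distrC x); lra.
have n0 (x : R) := normr_ge0 x.
exists z; split; [apply: (key _ _ _ zX_lip zX_sp)|apply: (key _ _ _ zH_lip zH_sp)|apply: (key _ _ _ zY_lip zY_sp)];
  move=> n; have := uP n; have := n0 (cX (u n) - a); have := n0 (cH (u n) - b);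
  have := n0 (cY (u n) - c); lra.
Qed.

Lemma zX_01 z : 0 <= zX z <= 1.
Proof.
apply/andP; split; apply/ler_addgt0Pl => e e0; have [p zp] := special_dense z e0;
have := zX_lip z (sp p); rewrite zX_sp ler_norml => /andP[? ?];
have := xpt_gt0 (R := R) (nsnd p); have := xpt_le1 (R := R) (nsnd p);
rewrite -/(cX p); lra.
Qed.

Lemma cH_01 p : 0 <= cH p <= 1.
Proof. by rewrite ltW ?invS_gt0 ?invS_le1. Qed.

Lemma cY_01 p : 0 <= cY p <= 1.
Proof.
rewrite yy_ge0 ?(ltW (xpt_gt0 _))//=.
by apply: le_trans (invS_le1 (R := R) (nfst p)); apply: yy_le; exact: xpt_le1.
Qed.

Lemma zHY_01 z : 0 <= zH z <= 1 /\ 0 <= zY z <= 1.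
Proof.
have key (f : Z -> R) (g : nat -> R) : (forall z w, `|f z - f w| <= dst z w) ->
    (forall p, f (sp p) = g p) -> (forall p, 0 <= g p <= 1) -> 0 <= f z <= 1.
  move=> lf fg g01; apply/andP; split; apply/ler_addgt0Pl => e e0;
  have [p zp] := special_dense z e0; have := lf z (sp p);
  rewrite fg ler_norml => /andP[? ?]; have /andP[? ?] := g01 p; lra.
by split; [exact: key zH_lip zH_sp cH_01|exact: key zY_lip zY_sp cY_01].
Qed.

(** By [fan_dstE] the coordinates determine the metric, and by [fan_point] their image is closed in
    the unit cube; compactness is carried back along filters. *)
Lemma fan_compact : compact [set: Z].
Proof.
pose c (z : Z) : R * R * R := ((zX z, zH z), zY z).
pose E := range c.
have nb (a b d e : R) : 0 < e -> nbhs ((a, b), d)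
    [set v : R * R * R | [/\ `|a - v.1.1| < e, `|b - v.1.2| < e & `|d - v.2| < e]].
  by move=> e0; apply/nbhs_ballP; exists e => // -[[x y] w] [[/= h1 h2] h3].
have cE : compact E.
  have K3 : compact (`[0, 1] `*` `[0, 1] `*` `[0, 1] : set (R * R * R)).
    by apply: compact_setX; [apply: compact_setX|]; exact: segment_compact.
  apply: (subclosed_compact _ K3).
  - move=> [[a b] d] cl.
    have [|z [<- <- <-]] := @fan_point a b d; last by exists z.
    move=> e e0; have [_ [[z _ <-] [/= h1 h2 h3]]] := cl _ (nb a b d (e / 8) ltac:(lra)).
    have [p zp] := special_dense z (e := e / 8) ltac:(lra); exists p.
    have tri (x y w : R) : `|x - y| <= `|w - x| + `|y - w|.
      by rewrite (distrC w) (distrC y); apply: le_trans (ler_normD _ _); rewrite addrA subrK.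
    have := tri (cX p) a (zX z); have := tri (cH p) b (zH z); have := tri (cY p) d (zY z).
    have := zX_lip z (sp p); have := zH_lip z (sp p); have := zY_lip z (sp p).
    by rewrite zX_sp zH_sp zY_sp; lra.
  - move=> _ [z _ <-]; have [h1 h2] := zHY_01 z; have h3 := zX_01 z.
    by rewrite /c; repeat split; rewrite /= in_itv.
move=> F FF _; have [|_ [[z _ <-] clz]] := cE (c @ F) _.
  by apply: (@filterS _ F _ setT) filterT => w _; exists w.
exists z; split=> // A B FA /nbhs_dstE[e e0 eB].
have [|v [[w Aw <-] [/= h1 h2 h3]]] := clz (c @` A) _ _ (nb _ _ _ (e / 3) ltac:(lra)).
  by apply: (@filterS _ F _ A) FA => w Aw; exists w.
by exists w; split=> //; apply: eB; rewrite fan_dstE; lra.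
Qed.

Definition leg (i : nat) : set Z := [set z | zH z = invS (cls i) /\ zY z = yy i (zX z)].

Lemma leg_sp p : leg (nfst p) (sp p).
Proof. by split; rewrite ?zX_sp ?zH_sp ?zY_sp. Qed.

Lemma leg_closed i : closed (leg i).
Proof.
have -> : leg i = [set z | `|zH z - invS (cls i)| + `|zY z - yy i (zX z)| = 0].
  apply/seteqP; split=> z /=; first by move=> [-> ->]; rewrite !subrr normr0 addr0.
  move=> /eqP; rewrite paddr_eq0// !normr_eq0 !subr_eq0 => /andP[/eqP ? /eqP ?].
  by split.
apply: lip_closed => z w.
have t (x y : R) : `| `|x| - `|y| | <= `|x - y| by exact: ler_dist_dist.
have := t (zH z - invS (cls i)) (zH w - invS (cls i)).
have := t (zY z - yy i (zX z)) (zY w - yy i (zX w)).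
have := norm4 (zY z) (yy i (zX z)) (zY w) (yy i (zX w)).
have := norm4 (zH z) (invS (cls i)) (zH w) (invS (cls i)).
have := yy_lip W i (zX z) (zX w).
have := zX_lip z w; have := zH_lip z w; have := zY_lip z w.
rewrite subrr normr0.
move=> a1 a2 a3 a4 a5 a6; rewrite !ler_norml => /andP[b1 b2] /andP[b3 b4].
by apply/andP; split; lra.
Qed.

Lemma leg_point i t : 0 <= t <= 1 -> exists2 z, leg i z & zX z = t.
Proof.
move=> t01; have [|z [Xz Hz Yz]] := @fan_point t (invS (cls i)) (yy i t); last first.
  by exists z => //; split=> //; rewrite Xz.
move=> e e0; have [N Ne] := invS_lt_ex (e := e / 2) ltac:(lra).
have [m _ mt] := xpt_dense N t01; exists (npair i m).
rewrite /cX /cH /cY /cX !npairK1 !npairK2 subrr normr0.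
by have := yy_lip W i (xpt m) t; lra.
Qed.

Lemma leg_inj i z w : leg i z -> leg i w -> zX z = zX w -> z = w.
Proof. by move=> [h1 h2] [h3 h4] e; apply: fan_eq => //; rewrite ?h1 ?h3// h2 h4 e. Qed.

(** The leg is parametrized by its abscissa; clamping to [0, 1] makes the parametrization total on
    the reals. *)
Lemma leg_connected i (s : R) : 0 <= s <= 1 -> connected (leg i `&` [set z | s <= zX z]).
Proof.
move=> /andP[s0 s1].
pose cl (t : R) : R := Num.max (Num.min t 1) 0.
have cl01 t : 0 <= cl t <= 1 by rewrite /cl le_max ge_max ler01 lexx orbT andbT ge_min lexx orbT.
have cllip t u : `|cl t - cl u| <= `|t - u|.
  apply: le_trans (max_lip _ _ _) _.
  rewrite -[Num.min t 1]opprK -[Num.min u 1]opprK !oppr_min -opprD normrN.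
  apply: le_trans (max_lip _ _ _) _.
  by rewrite -opprD normrN.
have /choice[ga gaP] : forall t, exists z, leg i z /\ zX z = cl t.
  by move=> t; have [z ? ?] := leg_point i (cl01 t); exists z.
have cga : continuous ga.
  move=> t S /nbhs_dstE[e e0 eS]; apply/nbhs_ballP; exists (e / 2); first by rewrite /=; lra.
  move=> u; rewrite /ball /= => tu; apply: eS; rewrite fan_dstE.
  have [[-> ->] ->] := gaP t; have [[-> ->] ->] := gaP u.
  rewrite subrr normr0; have := yy_lip W i (cl t) (cl u); have := cllip t u; lra.
have -> : leg i `&` [set z | s <= zX z] = ga @` `[s, 1].
  apply/seteqP; split=> [z [lz sz]|_ [t /= + <-]].
    have /andP[z0 z1] := zX_01 z.
    exists (zX z); first by rewrite /= in_itv /= sz z1.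
    have [lg Xg] := gaP (zX z); apply: leg_inj lg lz _.
    by rewrite Xg /cl min_l// max_l.
  rewrite in_itv /= => /andP[st t1]; have [lg Xg] := gaP t; split=> //=.
  by rewrite Xg /cl min_l// max_l// (le_trans s0).
apply: connected_continuous_connected; first exact: segment_connected.
exact: continuous_subspaceT.
Qed.

Definition glued (i j : nat) : Prop := cls i = cls j /\ (i = j \/ eps (nfst i) = 0).

(** The range of the filter is the bound of [cls_bound], so no glued leg is lost. *)
Definition grp (i : nat) : seq nat :=
  [seq j <- iota 0 (npair (cls i) (cls i).+2).+1 | `[< glued i j >]].

Lemma grp_uniq i : uniq (grp i).
Proof. by rewrite filter_uniq// iota_uniq. Qed.

Lemma mem_grp i j : j \in grp i <-> glued i j.
Proof.
rewrite mem_filter mem_iota add0n /=; split=> [/andP[/asboolP]//|ij].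
rewrite (asboolT ij) ltnS /=; apply: cls_bound.
by have [-> _] := ij.
Qed.

Lemma leg_meet i j z : cls i = cls j -> i != j -> leg i z -> leg j z ->
  zX z = 0 /\ eps (nfst i) = 0.
Proof.
move=> cE ij [_ h1] [_ h2]; have [gE _] := cls_eq cE.
have /andP[z0 _] := zX_01 z; have /andP[e0 _] := @eps_le1 R W (nfst i).
have := yy_sep W (zX z) ij gE z0.
rewrite -h1 -h2 !subrr normr0 addr0 pmulr_lle0 ?rho_gt0// ge_max => /andP[z1 e1].
by split; apply/eqP; rewrite eq_le ?z1 ?z0 ?e1 ?e0.
Qed.

Lemma comp_closed i : closed (seq_union leg (grp i)).
Proof.
have -> : seq_union leg (grp i) = \big[setU/set0]_(j <- grp i) leg j.
  by rewrite -bigcup_seq; apply/seteqP; split=> z [j]; exists j.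
by apply: closed_bigsetU => j _; exact: leg_closed.
Qed.

Lemma comp_open i : open (seq_union leg (grp i)).
Proof.
apply/open_dstE => z [j /mem_grp[cij gij] lz].
have eE : eps (nfst i) = eps (nfst j) by have [-> _] := cls_eq cij.
pose d := if eps (nfst j) == 0 then 1 else eps (nfst j) * rho j.
have d0 : 0 < d.
  rewrite /d; case: eqVneq => // g1; rewrite mulr_gt0 ?rho_gt0// lt_neqAle eq_sym g1.
  by have /andP[] := @eps_le1 R W (nfst j).
exists (Num.min (rho (cls j)) d); first by rewrite lt_min rho_gt0 d0.
have key p : dst z (sp p) < Num.min (rho (cls j)) d -> seq_union leg (grp i) (sp p).
  rewrite lt_min => /andP[zc zd]; exists (nfst p); last exact: leg_sp.
  have cE : cls j = cls (nfst p).
    apply: (@cls_sep R); apply: le_lt_trans zc; have [<- _] := lz.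
    by have := zH_lip z (sp p); rewrite zH_sp.
  apply/mem_grp; split; first by rewrite cij.
  have [jp|jp] := eqVneq j (nfst p).
    by rewrite -jp; exact: gij.
  right; have [gE _] := cls_eq cE; have /andP[z0 _] := zX_01 z.
  have := yy_sep W (cX p) jp gE z0; have [_ <-] := lz.
  have := fan_dstE z (sp p); rewrite zX_sp zH_sp zY_sp -/(cY p).
  have := normr_ge0 (zH z - cH p) => n0 dE sep.
  rewrite eE; move: zd; rewrite /d; case: eqVneq => // _ zd; exfalso.
  have : eps (nfst j) * rho j <= Num.max (zX z) (eps (nfst j)) * rho j.
    by rewrite ler_pM2r ?rho_gt0// le_max lexx orbT.
  by rewrite -/(cY p) in sep; lra.
(* The coordinate formulas of [key] apply to special points only. Were [w] outside the union, which
   is closed, a special point close enough to [w] would contradict [key]. *)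
move=> w zw; apply: contrapT => nw.
have /open_dstE/(_ w nw)[e e0 ew] : open (~` seq_union leg (grp i)).
  by apply: closed_openC; exact: comp_closed.
set d1 := Num.min _ _ in zw key.
have [p wp] := special_dense w (e := Num.min e (d1 - dst z w)) ltac:(rewrite lt_min e0; lra).
move: wp; rewrite lt_min => /andP[we wd].
by apply: (ew (sp p) we); apply: key; have := dst_tri z w (sp p); lra.
Qed.

Lemma comp_connected i : connected (seq_union leg (grp i)).
Proof.
have -> : seq_union leg (grp i) = \bigcup_(j in [set j | j \in grp i]) leg j.
  by apply/seteqP; split=> z [j]; exists j.
apply: bigcup_connected.
  have [z lz Xz] := leg_point i (t := 0) ltac:(by rewrite lexx ler01).
  exists z => j /= /mem_grp[cij [<-//|e0]].
  have [gE _] := cls_eq cij; have [h1 h2] := lz.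
  split; first by rewrite -cij.
  by rewrite h2 Xz /yy -gE e0 maxxx !mul0r.
move=> j _.
have := @leg_connected j 0 ltac:(by rewrite lexx ler01).
congr connected; apply/seteqP; split=> [z []//|z lz]; split=> //=.
by have /andP[] := zX_01 z.
Qed.

Lemma size_grp i : eps (nfst i) = 0 -> (nsnd i < sz (nfst i))%N -> size (grp i) = sz (nfst i).
Proof.
move=> e0 ki; set g := nfst i.
rewrite -[RHS](size_iota 0) -(size_map (npair g) (iota 0 _)); apply/perm_size/uniq_perm.
- exact: grp_uniq.
- by rewrite map_inj_uniq ?iota_uniq// => a b /npair_inj[].
move=> j; apply/idP/idP => [/mem_grp[/cls_eq[gE H] _]|/mapP[k + ->]].
  apply/mapP; exists (nsnd j); last by rewrite /g gE nfst_nsndK.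
  by rewrite mem_iota add0n /=; case: H => [<-|[]].
rewrite mem_iota add0n /= => kg; apply/mem_grp; split; last by right.
by rewrite /cls npairK1 npairK2 -/g kg; move: ki; rewrite -/g => ->.
Qed.

Lemma fan_space_fan_like (D : set nat) :
  (forall n, D n <-> exists2 g, nfst g = n & forall b, W g b) -> fan_like R Z D.
Proof.
move=> DW; exists zX, leg, grp; split.
- exact: lip_continuous zX_lip.
- exact: leg_closed.
- by move=> i; apply: leg_connected; apply/andP; split; lra.
- by move=> i; apply: leg_point; rewrite ler01 lexx.
split.
- move=> i; split; [exact: grp_uniq| |exact: comp_open|exact: comp_connected].
  by apply/mem_grp; split=> //; left.
- move=> i j k z /mem_grp[cj _] /mem_grp[ck _] lj lk z0.
  apply/eqP/negPn/negP => jk; have cjk : cls j = cls k by rewrite -cj.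
  by have [e _] := leg_meet cjk jk lj lk; move: z0; rewrite e ltxx.
- move=> U oU U0; have [p Up] := open_special oU U0.
  by exists (nfst p), (sp p); split=> //; exact: leg_sp.
move=> n; rewrite DW; split=> [[g <- /(@eps_eq0 R) gW]|[i iE]].
  by exists (npair g 0); rewrite size_grp npairK1 ?npairK2.
have iu := grp_uniq i.
(* Since n + 2 is at least 2, there is a second leg in the component. It can only be there by
   gluing, so the group is good and its size determines n. *)
have [j ji jg] : exists2 j, j != i & j \in grp i.
  case: (grp i) iE iu => [//|a [//|b s]] _ /= /andP[]; rewrite in_cons => /norP[ab _] _.
  have [e|ne] := eqVneq a i; [exists b|exists a]; rewrite ?inE ?eqxx ?orbT//.
  by rewrite -e eq_sym.
have [cij [e|e0]] := (mem_grp i j).1 jg; first by rewrite e eqxx in ji.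
have [gE [e|[ki _]]] := cls_eq cij; first by rewrite e eqxx in ji.
exists (nfst i); last by apply/eps_eq0; exact: e0.
by move: iE; rewrite size_grp// => -[].
Qed.

End FanSpace.

(** * Computing with codes of rationals *)

Section RationalCodes.
Context {R : realType}.

Definition q2r (m : nat) : R := ratr (rat_of_nat m).

Lemma q2rE m :
  q2r m = ((nfst (nfst m))%:R - (nsnd (nfst m))%:R) / (nsnd m).+1%:R.
Proof. by rewrite /q2r /rat_of_nat fmorph_div /= rmorphB /= !ratr_nat. Qed.

Definition qmk (a b c : nat) : nat := npair (npair a b) c.

Lemma q2r_mk a b c : q2r (qmk a b c) = (a%:R - b%:R) / c.+1%:R.
Proof. by rewrite q2rE /qmk !(npairK1, npairK2). Qed.

Definition qadd (m n : nat) : nat :=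
  qmk (nfst (nfst m) * (nsnd n).+1 + nfst (nfst n) * (nsnd m).+1)
      (nsnd (nfst m) * (nsnd n).+1 + nsnd (nfst n) * (nsnd m).+1)
      ((nsnd m).+1 * (nsnd n).+1).-1.

Definition qneg (m : nat) : nat := qmk (nsnd (nfst m)) (nfst (nfst m)) (nsnd m).

Definition qmul (m n : nat) : nat :=
  qmk (nfst (nfst m) * nfst (nfst n) + nsnd (nfst m) * nsnd (nfst n))
      (nfst (nfst m) * nsnd (nfst n) + nsnd (nfst m) * nfst (nfst n))
      ((nsnd m).+1 * (nsnd n).+1).-1.

Lemma q2r_add m n : q2r (qadd m n) = q2r m + q2r n.
Proof.
rewrite q2r_mk prednK ?muln_gt0// !q2rE !natrD !natrM.
have n1 : (nsnd m).+1%:R != 0 :> R by rewrite pnatr_eq0.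
have n2 : (nsnd n).+1%:R != 0 :> R by rewrite pnatr_eq0.
rewrite addf_div//; congr (_ / _).
by rewrite !mulrBl opprD addrACA.
Qed.

Lemma q2r_neg m : q2r (qneg m) = - q2r m.
Proof. by rewrite q2r_mk q2rE -mulNr opprB. Qed.

Lemma q2r_mul m n : q2r (qmul m n) = q2r m * q2r n.
Proof.
rewrite q2r_mk prednK ?muln_gt0// !q2rE !natrD !natrM mulf_div; congr (_ / _).
set a := (nfst (nfst m))%:R; set b := (nsnd (nfst m))%:R.
set c := (nfst (nfst n))%:R; set d := (nsnd (nfst n))%:R.
by rewrite mulrBl !mulrBr; lra.
Qed.

Lemma q2r_lt m n : (q2r m < q2r n) =
  (nfst (nfst m) * (nsnd n).+1 + nsnd (nfst n) * (nsnd m).+1 <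
   nfst (nfst n) * (nsnd m).+1 + nsnd (nfst m) * (nsnd n).+1)%N.
Proof.
rewrite !q2rE ltr_pdivrMr ?ltr0n// mulrAC ltr_pdivlMr ?ltr0n//.
rewrite -(ltr_nat R) !natrD !natrM !mulrBl.
by apply/idP/idP; lra.
Qed.

Lemma q2r_invS k : q2r (qmk 1 0 k) = invS k.
Proof. by rewrite q2r_mk subr0 mul1r. Qed.

Lemma q2r_pow k : q2r (qmk 1 0 (2 ^ k).-1) = 2 ^- k.
Proof. by rewrite q2r_mk prednK ?expn_gt0// subr0 mul1r natrX. Qed.

Lemma pow_le_invS k : 2 ^- k <= invS k :> R.
Proof.
rewrite -natrX lef_pV2 ?posrE ?ltr0n ?expn_gt0// ler_nat.
exact: ltn_expl.
Qed.

Lemma pow_lt_ex (e : R) : 0 < e -> exists k, 2 ^- k < e.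
Proof.
by move=> /invS_lt_ex[k ke]; exists k; exact: le_lt_trans (pow_le_invS k) ke.
Qed.

End RationalCodes.

Section RecRational.
Variables (R : realType) (A : set nat).

Lemma rec_qmk f g h : rec_fun A f -> rec_fun A g -> rec_fun A h ->
  rec_fun A (fun n => qmk (f n) (g n) (h n)).
Proof. by move=> ? ? ?; rewrite /qmk; rec_auto. Qed.

Lemma rec_qadd f g : rec_fun A f -> rec_fun A g -> rec_fun A (fun n => qadd (f n) (g n)).
Proof. by move=> ? ?; rewrite /qadd /qmk; rec_auto. Qed.

Lemma rec_qneg f : rec_fun A f -> rec_fun A (fun n => qneg (f n)).
Proof. by move=> ?; rewrite /qneg /qmk; rec_auto. Qed.

Lemma rec_qmul f g : rec_fun A f -> rec_fun A g -> rec_fun A (fun n => qmul (f n) (g n)).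
Proof. by move=> ? ?; rewrite /qmul /qmk; rec_auto. Qed.

Lemma dec_qlt f g : rec_fun A f -> rec_fun A g ->
  rec_dec A (fun n => q2r (f n) < q2r (g n) :> R).
Proof.
move=> fr gr.
suff : rec_dec A (fun n => nfst (nfst (f n)) * (nsnd (g n)).+1 + nsnd (nfst (g n)) * (nsnd (f n)).+1 <
   nfst (nfst (g n)) * (nsnd (f n)).+1 + nsnd (nfst (f n)) * (nsnd (g n)).+1)%N.
  by apply: dec_ext => n; rewrite q2r_lt.
by dec_auto.
Qed.

Lemma s1_lt (M : nat_metric R) f g h : computable_metric A M ->
  rec_fun A f -> rec_fun A g -> rec_fun A h ->
  sigma1 A (fun n => M (f n) (g n) < q2r (h n)) /\
  sigma1 A (fun n => q2r (h n) < M (f n) (g n)).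
Proof.
move=> [c cM] fr gr hr.
have /choice[ap apP] : forall m, exists a, eval A c m a /\
    `|M (nfst m) (nfst (nsnd m)) - q2r a| <= 2 ^- nsnd (nsnd m).
  by move=> m; have [a h1 h2] := cM (nfst m) (nfst (nsnd m)) (nsnd (nsnd m));
    exists a; move: h1; rewrite !nfst_nsndK.
have apr : rec_fun A ap by exists c => m; have [] := apP m.
pose t n k := ap (npair (f n) (npair (g n) k)).
have tP n k : `|M (f n) (g n) - q2r (t n k)| <= 2 ^- k.
  by have [_] := apP (npair (f n) (npair (g n) k)); rewrite !(npairK1, npairK2).
have fr' : rec_fun A (fun m => f (nfst m)) by apply: rec_comp => //; rec_auto.
have gr' : rec_fun A (fun m => g (nfst m)) by apply: rec_comp => //; rec_auto.
have hr' : rec_fun A (fun m => h (nfst m)) by apply: rec_comp => //; rec_auto.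
have tr : rec_fun A (fun m => t (nfst m) (nsnd m)) by apply: rec_comp => //; rec_auto.
have pr : rec_fun A (fun m => qmk 1 0 (2 ^ nsnd m).-1) by rewrite /qmk; rec_auto.
split.
  suff : sigma1 A (fun n => exists k, q2r (qadd (t n k) (qmk 1 0 (2 ^ k).-1)) < q2r (h n) :> R).
    apply: s1_ext => n; split=> [[k]|H].
      by rewrite q2r_add q2r_pow; have := tP n k; rewrite ler_norml => /andP[? ?]; lra.
    have [k ke] := pow_lt_ex (e := (q2r (h n) - M (f n) (g n)) / 2) ltac:(lra).
    exists k; rewrite q2r_add q2r_pow.
    by have := tP n k; rewrite ler_norml => /andP[? ?]; lra.
  by apply: s1_ex; apply: s1_dec; apply: dec_qlt => //; exact: rec_qadd.
suff : sigma1 A (fun n => exists k, q2r (qadd (h n) (qmk 1 0 (2 ^ k).-1)) < q2r (t n k) :> R).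
  apply: s1_ext => n; split=> [[k]|H].
    by rewrite q2r_add q2r_pow; have := tP n k; rewrite ler_norml => /andP[? ?]; lra.
  have [k ke] := pow_lt_ex (e := (M (f n) (g n) - q2r (h n)) / 2) ltac:(lra).
  exists k; rewrite q2r_add q2r_pow.
  by have := tP n k; rewrite ler_norml => /andP[? ?]; lra.
by apply: s1_ex; apply: s1_dec; apply: dec_qlt => //; exact: rec_qadd.
Qed.

(** Concatenation of the image of [s] with the list coded by [acc], up to order: covers depend on
    membership alone. *)
Definition push (h : nat -> nat) (acc : nat) (s : seq nat) : nat :=
  pfold (fun acc l => (npair (h (nfst l.-1)) acc).+1) acc s.

Lemma push_mem h acc s : seq_of (push h acc s) =i map h s ++ seq_of acc.
Proof.
rewrite /push; elim: s acc => [//|k s IH] acc x /=.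
rewrite IH /= npairK1 !mem_cat seq_ofS npairK1 npairK2 !in_cons mem_cat.
by case: (x == h k); case: (x \in map h s).
Qed.

Lemma rec_push h f l : rec_fun A h -> rec_fun A f -> rec_fun A l ->
  rec_fun A (fun n => push h (f n) (seq_of (l n))).
Proof.
move=> hr fr lr; apply: (rec_pfold (F := fun _ acc l => (npair (h (nfst l.-1)) acc).+1)) => //.
have hr' : rec_fun A (fun m => h (nfst (nsnd (nsnd m)).-1)) by apply: rec_comp => //; rec_auto.
by rec_auto.
Qed.

End RecRational.

(** * Recovering the coded set from a presentation *)

Section FormalBalls.
Context {R : realType} (M : nat_metric R).
Notation Y := (completion M).
Notation sp := (special_point M).
Notation q2r := (@q2r R).
Implicit Types (s l L K C Rg : seq nat) (z : Y).

Definition fball (b : nat) : set Y := [set z | dst z (sp (nfst b)) < q2r (nsnd b)].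
Definition funion s : set Y := [set z | exists2 b, b \in s & fball b z].
Definition covers s : Prop := forall z, funion s z.
Definition inball (p b : nat) : Prop := M p (nfst b) < q2r (nsnd b).
(** Formal disjointness is sufficient for disjointness of the balls and, being a strict inequality
    between computable reals, is Sigma_1. *)
Definition bdisj (b b' : nat) : Prop := q2r (qadd (nsnd b) (nsnd b')) < M (nfst b) (nfst b').

(* The complement of [L] and [C] is covered by formally disjoint colour classes of
   balls, each of the colours [0, ..., n - 1] meeting both [K] and [Rg]; further colours
   are allowed. The list [l] consists of pairs <colour, ball>. *)
Definition splits L Rg K C (n : nat) : Prop :=
  exists l, [/\ covers ([seq nsnd a | a <- l] ++ L ++ C),
    (forall a, a \in l -> forall b, b \in l ->
       nfst a = nfst b \/ bdisj (nsnd a) (nsnd b)) &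
    forall j, (j < n)%N -> exists2 a, a \in l & nfst a = j /\
      exists p, inball p (nsnd a) /\
        ((exists2 k, k \in K & inball p k) /\ (exists2 k, k \in Rg & inball p k))].

Lemma fball_sp p b : fball b (sp p) <-> inball p b.
Proof. by rewrite /fball /= dst_special. Qed.

Lemma funion_sp p s : funion s (sp p) <-> exists2 b, b \in s & inball p b.
Proof. by split=> -[b bs /fball_sp ?]; exists b. Qed.

Lemma fball_open b : open (fball b).
Proof. exact: open_dball. Qed.

Lemma funion_open s : open (funion s).
Proof.
apply/open_dstE => z [b bs bz]; have /open_dstE/(_ z bz)[e e0 H] := @fball_open b.
by exists e => // w /H; exists b.
Qed.

Lemma funion_cat s s' : funion (s ++ s') = funion s `|` funion s'.
Proof.
apply/seteqP; split=> z; first by move=> [b]; rewrite mem_cat => /orP[] bs bz; [left|right]; exists b.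
by case=> -[b bs bz]; exists b => //; rewrite mem_cat bs ?orbT.
Qed.

Lemma bdisjP b b' z : bdisj b b' -> fball b z -> fball b' z -> False.
Proof.
rewrite /bdisj q2r_add /fball /= => h h1 h2.
have := dst_special M (nfst b) (nfst b').
have := dst_tri (sp (nfst b)) z (sp (nfst b')); rewrite (dst_sym (sp (nfst b)) z).
by move=> t E; rewrite E in t; lra.
Qed.

Lemma small_ball z (e : R) : 0 < e -> exists2 b, q2r (nsnd b) < e & fball b z.
Proof.
move=> /invS_lt_ex[k ke]; have [p zp] := special_dense z (invS_gt0 k).
by exists (npair p (qmk 1 0 k)); rewrite /fball /= ?npairK1 npairK2 q2r_invS.
Qed.

Lemma finite_balls (F : set Y) (G : nat -> Prop) : compact F ->
  (forall z, F z -> exists2 b, G b & fball b z) ->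
  exists2 s, (forall b, b \in s -> G b) & F `<=` funion s.
Proof.
move=> cF FG.
have [||n H] := compact_near_nat (P := fun n z => exists b, [/\ (b < n)%N, G b & fball b z]) cF.
- by move=> n m z nm [b [bn Gb bz]]; exists b; split=> //; exact: leq_trans nm.
- move=> z /FG[b Gb bz]; exists b.+1.
  have := open_nbhs_nbhs (conj (@fball_open b) bz).
  by apply: filterS => w bw; exists b.
exists [seq b <- iota 0 n | `[< G b >]] => [b|z /H[b [bn Gb bz]]].
  by rewrite mem_filter => /andP[/asboolP].
by exists b => //; rewrite mem_filter mem_iota (asboolT Gb).
Qed.

Lemma finite_balls_sub (F O : set Y) : compact F -> open O -> F `<=` O ->
  exists2 s, F `<=` funion s & funion s `<=` O.
Proof.
move=> cF /open_dstE oO FO.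
have [|s sG Fs] := finite_balls (G := fun b => fball b `<=` O) cF.
  move=> z /FO/oO[e e0 eO]; have [b be bz] := small_ball z (e := e / 2) ltac:(lra).
  exists b => // w bw; apply: eO; move: bz bw; rewrite /fball /= => bz bw.
  by have := dst_tri z (sp (nfst b)) w; rewrite (dst_sym (sp (nfst b)) w); lra.
by exists s => // z [b /sG]; exact.
Qed.

Lemma bounded_pos_min (P : nat -> R -> Prop) B :
  (forall i (d d' : R), d' <= d -> P i d -> P i d') ->
  (forall i, (i < B)%N -> exists2 d : R, 0 < d & P i d) ->
  exists2 d : R, 0 < d & forall i, (i < B)%N -> P i d.
Proof.
move=> Pm; elim: B => [_|B IH H]; first by exists 1.
have [d d0 Hd] := IH (fun i iB => H i (ltnW iB)).
have [d' d'0 Hd'] := H B (ltnSn B).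
exists (Num.min d d'); first by rewrite lt_min d0.
move=> i; rewrite ltnS leq_eqVlt => /orP[/eqP ->|/Hd].
  by apply: Pm Hd'; rewrite ge_min lexx orbT.
by apply: Pm; rewrite ge_min lexx.
Qed.

(** Disjoint compact pieces have a positive mutual distance [e]. Balls of radius below [e / 4] that
    meet different pieces have centres more than [e / 2] apart, hence are formally disjoint; the
    number of the piece is the colour. *)
Lemma splits_intro L Rg K C n N (F : nat -> set Y) : (n <= N)%N ->
  (forall j, (j < N)%N -> compact (F j)) -> (forall j, (j < N)%N -> closed (F j)) ->
  (forall j k, (j < N)%N -> (k < N)%N -> j <> k -> F j `&` F k = set0) ->
  (forall z, (exists2 j, (j < N)%N & F j z) \/ funion L z \/ funion C z) ->
  (forall j, (j < n)%N -> exists z, [/\ F j z, funion K z & funion Rg z]) ->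
  splits L Rg K C n.
Proof.
move=> nN cF clF dF covF ptF.
have [e e0 eF] : exists2 e : R, 0 < e & forall j k a b, (j < N)%N -> (k < N)%N -> j <> k ->
    F j a -> F k b -> e <= dst a b.
  have [||e e0 H] := bounded_pos_min (B := (npair N N).+1)
    (P := fun m (e : R) => forall a b, (nfst m < N)%N -> (nsnd m < N)%N -> nfst m <> nsnd m ->
      F (nfst m) a -> F (nsnd m) b -> e <= dst a b).
  - by move=> m d d' dd H a b h1 h2 h3 h4 h5; apply: le_trans dd _; exact: H.
  - move=> m _; have [[[h1 h2] h3]|nh] := pselect (((nfst m < N)%N /\ (nsnd m < N)%N) /\ nfst m <> nsnd m).
      have [e e0 H] := compact_separated (cF _ h1) (clF _ h2) (dF _ _ h1 h2 h3).
      by exists e => // a b _ _ _; exact: H.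
    by exists 1 => // a b h1 h2 h3; case: nh.
  exists e => // j k a b jN kN jk Fa Fb.
  apply: (H (npair j k)); rewrite ?npairK1 ?npairK2//.
  by rewrite ltnS; apply: npair_mono; exact: ltnW.
have /choice[s sP] : forall j, exists s, (j < N)%N ->
    (forall b, b \in s -> q2r (nsnd b) < e / 4 /\ exists2 z, F j z & fball b z) /\ F j `<=` funion s.
  move=> j; have [jN|Nj] := ltnP j N; last by exists [::].
  have [|s h1 h2] := finite_balls (G := fun b => q2r (nsnd b) < e / 4 /\ exists2 z, F j z & fball b z) (cF _ jN).
    move=> z Fz; have [b be bz] := small_ball z (e := e / 4) ltac:(lra).
    by exists b => //; split=> //; exists z.
  by exists s.
pose l := [seq npair j b | j <- iota 0 N, b <- s j].
have lP a : a \in l <-> exists j b, [/\ (j < N)%N, b \in s j & a = npair j b].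
  split=> [/allpairsPdep[j [b [jN bs ->]]]|[j [b [jN bs ->]]]].
    by exists j, b; rewrite mem_iota in jN.
  by apply/allpairsPdep; exists j, b; rewrite mem_iota.
exists l; split.
- move=> z; rewrite !funion_cat; case: (covF z) => [[j jN Fz]|[Lz|Cz]]; [left|right; by left|right; by right].
  have [_ /(_ z Fz)[b bs bz]] := sP j jN.
  exists b => //; apply/mapP; exists (npair j b); last by rewrite npairK2.
  by apply/lP; exists j, b.
- move=> a /lP[j [b [jN bs ->]]] a' /lP[k [b' [kN bs' ->]]]; rewrite !npairK1 !npairK2.
  have [->|/eqP jk] := eqVneq j k; [by left|right].
  have [/(_ b bs)[rb [z Fz bz]] _] := sP j jN.
  have [/(_ b' bs')[rb' [z' Fz' bz']] _] := sP k kN.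
  have := eF _ _ _ _ jN kN jk Fz Fz'; rewrite /bdisj q2r_add; move: bz bz'; rewrite /fball /=.
  have := dst_special M (nfst b) (nfst b').
  have := dst_tri z (sp (nfst b)) z'; have := dst_tri (sp (nfst b)) (sp (nfst b')) z'.
  rewrite (dst_sym (sp (nfst b')) z') => t1 t2 E h1 h2 h3; rewrite E in t1; lra.
move=> j jn; have jN := leq_trans jn nN.
have [z [Fz Kz Rz]] := ptF j jn; have [_ /(_ z Fz)[b bs bz]] := sP j jN.
exists (npair j b); first by apply/lP; exists j, b.
rewrite npairK1 npairK2; split=> //.
have [||p [[bp Kp] Rp]] := @open_special _ M ((fball b `&` funion K) `&` funion Rg).
- by apply: openI; [apply: openI|]; [exact: fball_open|exact: funion_open|exact: funion_open].
- by exists z.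
by exists p; split; [exact/fball_sp|split; exact/funion_sp].
Qed.

Lemma splits_elim L Rg K C n : splits L Rg K C n ->
  exists O : nat -> set Y, [/\ (forall j, open (O j)),
    (forall j k z, O j z -> O k z -> j = k),
    (forall z, (exists j, O j z) \/ funion L z \/ funion C z) &
    (forall j, (j < n)%N -> exists z, [/\ O j z, funion K z & funion Rg z])].
Proof.
move=> [l [cov dis pts]].
exists (fun j => [set z | exists2 a, a \in l /\ nfst a = j & fball (nsnd a) z]); split.
- move=> j; apply/open_dstE => z [a al az].
  by have /open_dstE/(_ z az)[e e0 H] := @fball_open (nsnd a); exists e => // w /H; exists a.
- move=> j k z [a [al <-] az] [b [bl <-] bz]; have [//|h] := dis a al b bl.
  by case: (bdisjP h az bz).
- move=> z; have := cov z; rewrite !funion_cat => -[[b /mapP[a al ->] bz]|[Lz|Cz]].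
  + by left; exists (nfst a), a.
  + by right; left.
  + by right; right.
move=> j /pts[a al [aj [p [pa [pK pR]]]]]; exists (sp p); split.
- by exists a => //; exact/fball_sp.
- exact/funion_sp.
- exact/funion_sp.
Qed.

Lemma connected_in_open (G O1 O2 : set Y) : connected G -> open O1 -> open O2 ->
  (forall z, G z -> O1 z \/ O2 z) -> (forall z, O1 z -> O2 z -> False) ->
  G `&` O1 !=set0 -> G `<=` O1.
Proof.
move=> cG o1 o2 G12 d12 G1 z Gz.
suff GE : G `&` O1 = G by move: Gz; rewrite -GE => -[].
apply: cG => //; first by exists O1.
exists (~` O2); first exact: open_closedC.
apply/seteqP; split=> w [Gw Ow]; split=> //; first by move=> /(d12 w Ow).
by case: (G12 w Gw).
Qed.

Lemma connected_one_piece (G : set Y) (O : nat -> set Y) j k : connected G ->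
  (forall j, open (O j)) -> (forall j k z, O j z -> O k z -> j = k) ->
  (forall z, G z -> exists j, O j z) -> G `&` O j !=set0 -> G `&` O k !=set0 -> j = k.
Proof.
move=> cG oO dO GO Gj [w [Gw kw]].
have /(_ w Gw) jw : G `<=` O j.
  apply: (connected_in_open (O2 := [set z | exists2 i, i <> j & O i z])) => //.
  - apply/open_dstE => z [i ij iz].
    by have /open_dstE/(_ z iz)[e e0 H] := oO i; exists e => // x /H; exists i.
  - move=> z /GO[i iz]; have [<-|/eqP ij] := eqVneq i j; [by left|right].
    by exists i.
  - by move=> z jz [i ij iz]; apply: ij; exact: dO iz jz.
exact: dO jw kw.
Qed.

End FormalBalls.
Arguments fball {R} M b _.
Arguments funion {R} M s _.

(** * Counting the legs of a component by covers *)

Section Detection.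
Context {R : realType} (M : nat_metric R) (D : set nat).
Notation Y := (completion M).
Notation sp := (special_point M).

Lemma clopen_connected_eq (U V : set Y) : open U -> closed U -> connected U ->
  open V -> closed V -> connected V -> U `&` V !=set0 -> U = V.
Proof.
move=> oU clU cU oV clV cV UV; apply/seteqP; split.
- apply: (connected_in_open cU oV (O2 := ~` V)) => //.
  + exact: closed_openC.
  + by move=> z _; exact: EM.
- apply: (connected_in_open cV oU (O2 := ~` U)) => //; last by rewrite setIC.
  + exact: closed_openC.
  + by move=> z _; exact: EM.
Qed.

Lemma fan_detect : compact [set: Y] -> fan_like R Y D ->
  exists L Rg All : seq nat, forall n, D n <-> exists K C : seq nat,
    [/\ covers M (K ++ C), (forall k, k \in K -> forall c, c \in C -> bdisj M k c),
        splits M L Rg K C n.+2, ~ splits M [::] All K C 2 & ~ splits M L Rg K C n.+3].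
Proof.
move=> cY [f [leg [grp [cf clleg conleg leg1 [grpP disleg densleg Dsz]]]]].
have cptcl (F : set Y) : closed F -> compact F.
  by move=> clF; apply: subclosed_compact clF cY _.
have clf (a : R) : closed [set z | f z <= a].
  by have /continuous_closedP/(_ _ (@closed_le R a)) := cf.
have clf' (a : R) : closed [set z | a <= f z].
  by have /continuous_closedP/(_ _ (@closed_ge R a)) := cf.
have opf (a : R) : open [set z | f z < a].
  by have /continuousP/(_ _ (@open_lt R a)) := cf.
have opf' (a : R) : open [set z | a < f z].
  by have /continuousP/(_ _ (@open_gt R a)) := cf.
(* [L] contains the region f <= 1/3, so removing it leaves disjoint pieces of legs, and it avoids f
   >= 1/2, so it cannot break the connected part of a leg there. [Rg] below contains the right ends
   of all legs and stays in f > 1/2, so a point marking a colour lies on such a connected part. *)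
have [L L1 L2] : exists2 L, [set z | f z <= 3^-1] `<=` funion M L & funion M L `<=` [set z | f z < 2^-1].
  by apply: finite_balls_sub => //; [exact: cptcl|move=> z /=; lra].
have [Rg R1 R2] : exists2 L, [set z | 1 <= f z] `<=` funion M L & funion M L `<=` [set z | 2^-1 < f z].
  by apply: finite_balls_sub => //; [exact: cptcl|move=> z /=; lra].
have [All All1 _] : exists2 L, [set: Y] `<=` funion M L & funion M L `<=` [set: Y].
  by apply: finite_balls_sub => //; exact: openT.
have comp_closed i : closed (seq_union leg (grp i)).
  have -> : seq_union leg (grp i) = \big[setU/set0]_(j <- grp i) leg j.
    by rewrite -bigcup_seq; apply/seteqP; split=> z [j]; exists j.
  by apply: closed_bigsetU => j _; exact: clleg.
have count i K C n : funion M K = seq_union leg (grp i) -> funion M C = ~` funion M K ->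
    splits M L Rg K C n <-> (n <= size (grp i))%N.
  move=> KE CE; have [ug ig og cg] := grpP i; split.
    move=> /splits_elim[O [oO dO covO ptO]].
    (* [q j] is a leg through the point marking colour [j]. Over f >= 1/2 this leg meets neither [L]
       nor [C], so it is covered by the colours and, being connected there, has a single colour;
       hence [q] is injective. *)
    have /choice[q qP] : forall j, exists q, (j < n)%N -> q \in grp i /\
        (leg q `&` [set z | 2^-1 <= f z]) `&` O j !=set0.
      move=> j; have [jn|_] := ltnP j n; last by exists 0%N.
      have [z [Oz Kz Rz]] := ptO j jn; move: (Kz); rewrite KE => -[q qg lz].
      by exists q => _; split=> //; exists z; split=> //; split=> //; apply: ltW; exact: R2.
    rewrite -(size_iota 0 n) -(size_map q); apply: uniq_leq_size; last first.
      by move=> x /mapP[j]; rewrite mem_iota add0n /= => /qP[h _] ->.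
    rewrite map_inj_in_uniq ?iota_uniq// => j k; rewrite !mem_iota !add0n /=.
    move=> /qP[hj Oj] /qP[hk Ok] jk; rewrite -jk in Ok.
    apply: (connected_one_piece (conleg (q j)) oO dO) => // z [lz fz].
    case: (covO z) => [//|[/L2 /=|]]; first by move: fz => /=; lra.
    rewrite CE => Kz; case: Kz; rewrite KE; by exists (q j).
  (* One piece for each leg, its part over f >= 1/3: no two legs of a component meet where f > 0,
     and the rest of [K] lies in [L]. *)
  move=> nsz; pose F j : set Y := leg (nth 0%N (grp i) j) `&` [set z | 3^-1 <= f z].
  have clF j : closed (F j) by apply: closedI.
  apply: (splits_intro (F := F) nsz) => //.
  - by move=> j _; exact: cptcl.
  - move=> j k jn kn jk; apply/seteqP; split=> // z [[lj fj] [lk _]].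
    have f0 : 0 < f z by move: fj => /=; lra.
    have := disleg i _ _ z (mem_nth 0%N jn) (mem_nth 0%N kn) lj lk f0.
    by move=> /eqP; rewrite nth_uniq// => /eqP.
  - move=> z; have [Kz|nKz] := pselect (funion M K z); last by right; right; rewrite CE.
    have [fz|fz] := ltP (f z) 3^-1; first by right; left; apply: L1 => /=; exact: ltW.
    left; move: Kz; rewrite KE => -[q qg lz]; exists (index q (grp i)); first by rewrite index_mem.
    by split; rewrite ?nth_index.
  - move=> j jn; have jg : nth 0%N (grp i) j \in grp i by apply: mem_nth; exact: leq_trans nsz.
    have [z lz f1] := leg1 (nth 0%N (grp i) j); exists z; split.
    + by split=> //=; rewrite f1; lra.
    + by rewrite KE; exists (nth 0%N (grp i) j).
    + by apply: R1 => /=; rewrite f1.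
have conn K C : open (funion M K) -> closed (funion M K) -> funion M C = ~` funion M K ->
    connected (funion M K) <-> ~ splits M [::] All K C 2.
  move=> oK clK CE; split=> [cK /splits_elim[O [oO dO covO ptO]]|nsp].
    have [z0 [O0 K0 _]] := ptO 0%N isT; have [z1 [O1 K1 _]] := ptO 1%N isT.
    suff : 0%N = 1%N by [].
    apply: (connected_one_piece cK oO dO); [|by exists z0|by exists z1].
    move=> z Kz; case: (covO z) => [//|[[b]//|]]; by rewrite CE.
  (* Since [K] codes a closed set, both halves of a separation are closed, hence compact, and serve
     as the two pieces. *)
  apply: contrapT => /connectedPn[E [E0 KE [s1 s2]]]; apply: nsp.
  have clE b : closed (E b).
    move=> z clz; have Kz : funion M K z.
      by apply: clK; apply: closure_subset clz; rewrite KE; case: b => w; [right|left].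
    move: Kz; rewrite KE; case: b clz => clz [] // Ez.
    - have : (E false `&` closure (E true)) z by []. by rewrite s2.
    - have : (closure (E false) `&` E true) z by []. by rewrite s1.
  have dE : E false `&` E true = set0.
    by apply/seteqP; split=> // z [h1 h2]; rewrite -s1; split=> //; exact: subset_closure.
  apply: (splits_intro (F := fun j => E (j == 1%N)) (leqnn 2)).
  - by move=> j _; exact: cptcl.
  - by move=> j _; exact: clE.
  - by move=> [|[|j]] [|[|k]] //= _ _ _; rewrite setIC.
  - move=> z; have [|nKz] := pselect (funion M K z); last by right; right; rewrite CE.
    by rewrite KE => -[Ez|Ez]; left; [exists 0%N|exists 1%N].
  - move=> j j2; have [z Ez] := E0 (j == 1%N); exists z; split=> //.
      by rewrite KE; case: (j == 1%N) Ez; [right|left].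
    exact: All1.
exists L, Rg, All => n; rewrite Dsz; split=> [[i sz]|[K [C [cov dKC spn nsp2 nspn]]]].
  have [ug ig og cg] := grpP i.
  pose U := seq_union leg (grp i).
  (* [U] and its complement are compact and at a positive distance [e], so small balls meeting the
     one are formally disjoint from small balls meeting the other. *)
  have [K [C [K1 C1 dKC]]] : exists K C, [/\ U `<=` funion M K, ~` U `<=` funion M C &
      forall k, k \in K -> forall c, c \in C -> bdisj M k c].
    have clU' : closed (~` U) by exact: open_closedC.
    have [|e e0 He] := compact_separated (cptcl _ (comp_closed i)) clU'.
      by apply/seteqP; split=> // z [].
    have G (V : set Y) : closed V -> exists2 s, (forall b, b \in s -> q2r (nsnd b) < e / 4 /\
        exists2 z, V z & fball M b z) & V `<=` funion M s.
      move=> clV; apply: finite_balls; first exact: cptcl.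
      move=> z Vz; have [b be bz] := small_ball z (e := e / 4) ltac:(lra).
      by exists b => //; split=> //; exists z.
    have [K KG K1] := G _ (comp_closed i); have [C CG C1] := G _ clU'.
    exists K, C; split=> // k /KG[rk [z Uz kz]] c /CG[rc [w Uw cw]].
    have := He z w Uz Uw; move: kz cw; rewrite /bdisj q2r_add /fball /=.
    have := dst_special M (nfst k) (nfst c).
    have := dst_tri z (sp (nfst k)) w; have := dst_tri (sp (nfst k)) (sp (nfst c)) w.
    rewrite (dst_sym (sp (nfst c)) w) => t1 t2 E h1 h2 h3; rewrite E in t1; lra.
  have dis z : funion M K z -> funion M C z -> False.
    by move=> [k kK kz] [c cC cz]; exact: bdisjP (dKC k kK c cC) kz cz.
  have KE : funion M K = U.
    apply/seteqP; split=> // z Kz; apply: contrapT => /C1; exact: dis.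
  have CE : funion M C = ~` funion M K.
    by rewrite KE; apply/seteqP; split=> // z Cz; rewrite -KE => /dis; apply.
  exists K, C; split=> //.
  - by move=> z; rewrite funion_cat CE; exact: EM.
  - by apply/(count i) => //; rewrite sz.
  - by apply/(conn K C) => //; rewrite KE //; exact: comp_closed.
  - by move=> /(count i _ _ _ KE CE); rewrite sz ltnn.
have dis z : funion M K z -> funion M C z -> False.
  by move=> [k kK kz] [c cC cz]; exact: bdisjP (dKC k kK c cC) kz cz.
have CE : funion M C = ~` funion M K.
  apply/seteqP; split=> z; first by move=> Cz Kz; exact: dis Kz Cz.
  by move=> nK; have := cov z; rewrite funion_cat => -[].
have oK := @funion_open _ M K.
have clK : closed (funion M K).
  by rewrite -[X in closed X]setCK -CE; apply: open_closedC; exact: funion_open.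
have cK : connected (funion M K) by apply/(conn K C).
(* A splitting into at least one colour shows that [K] is nonempty, so it meets some leg; clopen
   connected sets that meet coincide, and [K] is the component of that leg. *)
have [O [_ _ _ /(_ 0%N isT)[z [_ Kz _]]]] := splits_elim spn.
have [i [w [Kw lw]]] := densleg _ oK (ex_intro _ z Kz).
have [ug ig og cg] := grpP i.
have KE : funion M K = seq_union leg (grp i).
  by apply: clopen_connected_eq => //; exists w; split=> //; exists i.
exists i; move/(count i _ _ _ KE CE) : spn => h1.
have /negP : ~ (n.+3 <= size (grp i))%N by move=> h; apply: nspn; apply/(count i).
by lia.
Qed.

End Detection.

(** * The detecting condition is Sigma_2 *)

Section DetectionComplexity.
Context {R : realType} (A : set nat) (M : nat_metric R).

Lemma covers_eqi s s' : s =i s' -> covers M s -> covers M s'.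
Proof. by move=> ss' c z; have [b bs bz] := c z; exists b => //; rewrite -ss'. Qed.

Lemma fset_nums_covers n : fset_nums (cover_code M) n <-> covers M (seq_of n).
Proof.
split=> [[s -> H] z|H].
  rewrite seq_ofK; have [p] := H z; rewrite inE /= => /mapP[b bs ->] zb.
  by exists b.
exists (seq_of n); first by rewrite seq_numK.
move=> z; have [b bs bz] := H z; exists (formal_ball_of_nat b) => //.
by rewrite inE /=; apply/mapP; exists b.
Qed.

Hypothesis cM : computable_metric A M.
Hypothesis covM : sigma1 A (fun n => covers M (seq_of n)).

Lemma s1_bdisj f g : rec_fun A f -> rec_fun A g -> sigma1 A (fun n => bdisj M (f n) (g n)).
Proof.
move=> fr gr; rewrite /bdisj.
by apply: (proj2 (s1_lt cM _ _ _)); rec_auto; apply: rec_qadd; rec_auto.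
Qed.

Lemma s1_inball f g : rec_fun A f -> rec_fun A g -> sigma1 A (fun n => inball M (f n) (g n)).
Proof. by move=> fr gr; apply: (proj1 (s1_lt cM _ _ _)); rec_auto. Qed.

Lemma s1_splits L Rg K C N : rec_fun A K -> rec_fun A C -> rec_fun A N ->
  sigma1 A (fun n => splits M L Rg (seq_of (K n)) (seq_of (C n)) (N n)).
Proof.
move=> Kr Cr Nr.
suff : sigma1 A (fun n => exists l,
    (covers M (seq_of (push nsnd (push id (seq_num L) (seq_of (C n))) (seq_of l))) /\
     (forall a, a \in seq_of l -> forall b, b \in seq_of l ->
       nfst a = nfst b \/ bdisj M (nsnd a) (nsnd b))) /\
    forall j, (j < N n)%N -> exists2 a, a \in seq_of l & nfst a = j /\
      exists p, inball M p (nsnd a) /\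
        ((exists2 k, k \in seq_of (K n) & inball M p k) /\
         (exists2 k, k \in seq_of (seq_num Rg) & inball M p k))).
  apply: s1_ext => n.
  have cE l : covers M (seq_of (push nsnd (push id (seq_num L) (seq_of (C n))) (seq_of l))) <->
      covers M ([seq nsnd a | a <- seq_of l] ++ L ++ seq_of (C n)).
    have E : seq_of (push nsnd (push id (seq_num L) (seq_of (C n))) (seq_of l)) =i
        [seq nsnd a | a <- seq_of l] ++ L ++ seq_of (C n).
      move=> x; rewrite push_mem !mem_cat push_mem mem_cat map_id seq_ofK.
      by rewrite (orbC (x \in L)).
    by split; apply: covers_eqi => x; rewrite E.
  split=> [[l [[/cE h1 h2] h3]]|[l [h1 h2 h3]]].
    by exists (seq_of l); split=> //; move: h3; rewrite seq_ofK.
  exists (seq_num l); rewrite !seq_ofK; split; [split|] => //.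
  by have := (cE (seq_num l)).2; rewrite !seq_ofK; apply.
have r1 f : rec_fun A f -> rec_fun A (fun m => f (nfst m)).
  by move=> fr; apply: rec_comp => //; rec_auto.
have Kr1 := r1 _ Kr; have Cr1 := r1 _ Cr; have Nr1 := r1 _ Nr.
have Kr2 := r1 _ Kr1; have Kr3 := r1 _ Kr2; have Kr4 := r1 _ Kr3.
apply: s1_ex; apply: s1_and; [apply: s1_and|].
- apply: (s1_comp covM).
  by do 2 (apply: rec_push; rec_auto).
- do 2 (apply: s1_all_seq; first by rec_auto).
  apply: s1_or; first by apply: s1_dec; dec_auto.
  by apply: s1_bdisj; rec_auto.
- apply: s1_ball; first by rec_auto.
  apply: s1_ex_seq; first by rec_auto.
  apply: s1_and; first by apply: s1_dec; dec_auto.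
  apply: s1_ex; apply: s1_and; first by apply: s1_inball; rec_auto.
  apply: s1_and; (apply: s1_ex_seq; first by rec_auto); by apply: s1_inball; rec_auto.
Qed.

(** [L], [Rg] and [All] enter as constants, so it does not matter that they were found
    non-effectively. What remains is an existential quantifier over [K] and [C], Sigma_1 clauses,
    and two negated Sigma_1 clauses. *)
Lemma fan_sigma2 (D : set nat) : compact [set: completion M] ->
  fan_like R (completion M) D -> sigma2 A D.
Proof.
move=> cY fY; have [L [Rg [All H]]] := fan_detect cY fY.
suff : sigma2 A (fun n => exists w,
    ((covers M (seq_of (push id (nsnd w) (seq_of (nfst w)))) /\
      (forall k, k \in seq_of (nfst w) -> forall c, c \in seq_of (nsnd w) -> bdisj M k c)) /\
     splits M L Rg (seq_of (nfst w)) (seq_of (nsnd w)) n.+2) /\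
    ~ (splits M [::] All (seq_of (nfst w)) (seq_of (nsnd w)) 2 \/
       splits M L Rg (seq_of (nfst w)) (seq_of (nsnd w)) n.+3)).
  apply: s2_ext => n; rewrite H.
  have cE w : covers M (seq_of (push id (nsnd w) (seq_of (nfst w)))) <->
      covers M (seq_of (nfst w) ++ seq_of (nsnd w)).
    by split; apply: covers_eqi => x; rewrite push_mem map_id.
  split=> [[w [[[/cE h1 h2] h3] /not_orP[h4 h5]]]|[K [C [h1 h2 h3 h4 h5]]]].
    by exists (seq_of (nfst w)), (seq_of (nsnd w)).
  exists (npair (seq_num K) (seq_num C)).
  have := cE (npair (seq_num K) (seq_num C)); rewrite !(npairK1, npairK2) !seq_ofK => ->.
  by split=> // -[].
apply: s2_ex; apply: s2_and.
  apply: s2_s1; apply: s1_and; [apply: s1_and|].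
  - by apply: (s1_comp covM); apply: rec_push; rec_auto.
  - do 2 (apply: s1_all_seq; first by rec_auto).
    by apply: s1_bdisj; rec_auto.
  - by apply: s1_splits; rec_auto.
apply: s2_pi1; apply: s1_or; by apply: s1_splits; rec_auto.
Qed.

End DetectionComplexity.

(** * Computable presentations of fan spaces *)

Section FanComputable.
Context {R : realType} (A : set nat) (W : nat -> nat -> Prop).
Hypothesis Wd : rec_dec A (fun m => W (nfst m) (nsnd m)).
Notation invS := (@invS R).
Notation q2r := (@q2r R).
Notation M := (fan_metric W : nat_metric R).

Lemma asbool_bool (b : bool) : `[< b >] = b.
Proof. by case: b; [exact: asboolT|exact: asboolF]. Qed.

Lemma rec_pw f : rec_fun A f -> rec_fun A (fun n => pw (f n)).
Proof.
move=> fr.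
(* [pw m] is the least power of 2 that is at least m + 2; in passing to m + 1 it doubles exactly
   when it is below m + 3. *)
suff : rec_fun A (fun n => nat_rect (fun=> nat) 2%N
    (fun m r => if `[< (r < m.+3)%N >] then 2 * r else r)%N (f n)).
  apply: rec_ext => n; elim: (f n) => [//|m IH] /=; rewrite IH asbool_bool.
  have [h1 h2] := pw_bounds m; have [h3 h4] := pw_bounds m.+1.
  move: h1 h2 h3 h4; rewrite /pw; set a := trunc_log 2 m.+1; set b := trunc_log 2 m.+2.
  have ab : (a <= b)%N by apply: leq_trunc_log.
  move=> h1 h2 h3 h4; case: ifP => h.
    have -> : b = a.+1; last by rewrite -expnS.
    by apply: trunc_log_eq => //; rewrite !expnS in h1 h2 h *; lia.
  have -> // : b = a.
  by apply: trunc_log_eq => //; rewrite !expnS in h1 h2 h *; lia.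
apply: (rec_prim (g := fun _ m r => if `[< (r < m.+3)%N >] then 2 * r else r)%N) => //; first exact: rec_cst.
by apply: rec_if; dec_auto.
Qed.

Lemma rec_cls f : rec_fun A f -> rec_fun A (fun n => cls (f n)).
Proof.
move=> fr; suff : rec_fun A (fun n => npair (nfst (f n))
    (if `[< (nsnd (f n) < (nfst (nfst (f n))).+2)%N >] then 0%N else nsnd (f n))).
  by apply: rec_ext => n; rewrite asbool_bool.
apply: rec_npair; first by rec_auto.
by apply: rec_if; dec_auto.
Qed.

Lemma rec_lb f g : rec_fun A f -> rec_fun A g -> rec_fun A (fun n => lb W (f n) (g n)).
Proof.
move=> fr gr.
apply: (rec_prim (f := fun=> 0%N)
  (g := fun n b r => if `[< r = b /\ W (f n) b >] then b.+1 else r)) => //; first exact: rec_cst.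
have fr' : rec_fun A (fun m => f (nfst m)) by apply: rec_comp => //; rec_auto.
apply: rec_if; rec_auto; apply: dec_and; first by dec_auto.
have pr : rec_fun A (fun m => npair (f (nfst m)) (nfst (nsnd m))) by rec_auto.
by apply: dec_ext (dec_comp Wd pr) => m; rewrite npairK1 npairK2.
Qed.

Definition qmax (m n : nat) : nat := if `[< q2r m < q2r n >] then n else m.
Definition qdist (m n : nat) : nat := qmax (qadd m (qneg n)) (qadd n (qneg m)).

Lemma q2r_max m n : q2r (qmax m n) = Num.max (q2r m) (q2r n).
Proof. by rewrite /qmax asbool_bool /Num.max; case: ifP. Qed.

Lemma q2r_dist m n : q2r (qdist m n) = `|q2r m - q2r n|.
Proof. by rewrite q2r_max !q2r_add !q2r_neg -(opprB (q2r m) (q2r n)) maxrN. Qed.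

Lemma rec_qmax f g : rec_fun A f -> rec_fun A g -> rec_fun A (fun n => qmax (f n) (g n)).
Proof. by move=> fr gr; apply: rec_if => //; exact: dec_qlt. Qed.

Lemma rec_qdist f g : rec_fun A f -> rec_fun A g -> rec_fun A (fun n => qdist (f n) (g n)).
Proof. by move=> fr gr; apply: rec_qmax; apply: rec_qadd => //; exact: rec_qneg. Qed.

Definition xq (m : nat) : nat := qmk (m * 2 + 3) (pw m) (pw m).-1.
Definition yq (p s : nat) : nat :=
  qmul (qmax (xq (nsnd p)) (qmk 1 0 (lb W (nfst (nfst p)) s))) (qmk 1 0 (nfst p)).
Definition fanq (p q s : nat) : nat :=
  qadd (qadd (qdist (xq (nsnd p)) (xq (nsnd q)))
             (qdist (qmk 1 0 (cls (nfst p))) (qmk 1 0 (cls (nfst q)))))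
       (qdist (yq p s) (yq q s)).

Lemma q2r_xq m : q2r (xq m) = xpt m.
Proof.
have [h1 h2] := pw_bounds m.
rewrite q2r_mk prednK; last by lia.
by rewrite /xpt natrB; [congr ((_ %:R - _) / _); lia|lia].
Qed.

Lemma q2r_yq p s : `|cY W p - q2r (yq p s)| <= invS s.
Proof.
rewrite q2r_mul q2r_max q2r_xq !q2r_invS /cY /yy -mulrBl normrM (gtr0_norm (invS_gt0 _)).
have h1 := max_lip (cX p) (eps W (nfst (nfst p))) (invS (lb W (nfst (nfst p)) s)).
rewrite !(Order.TotalTheory.maxC _ (cX p)) in h1.
apply: (@le_trans _ _ (`|Num.max (cX p) (eps W (nfst (nfst p))) -
   Num.max (cX p) (invS (lb W (nfst (nfst p)) s))|)); first by rewrite ler_piMr// invS_le1.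
exact: le_trans h1 (eps_lb W _ _).
Qed.

Lemma q2r_fanq p q s : `|M p q - q2r (fanq p q s)| <= 2 * invS s.
Proof.
rewrite !q2r_add !q2r_dist !q2r_xq !q2r_invS /= /fan_dist -/(cX p) -/(cX q) -/(cH p) -/(cH q).
rewrite opprD addrACA subrr add0r.
apply: le_trans (ler_dist_dist _ _) _; apply: le_trans (norm4 _ _ _ _) _.
by have := q2r_yq p s; have := q2r_yq q s; lra.
Qed.

Lemma fan_computable : computable_metric A M.
Proof.
(* The error comes from two heights, each off by at most [invS] of the stage; the stage 2 ^ (n + 1)
   makes their sum at most 2 ^ -n. *)
pose F m := fanq (nfst m) (nfst (nsnd m)) (2 ^ (nsnd (nsnd m)).+1).
have [c cF] : rec_fun A F.
  have xr f : rec_fun A f -> rec_fun A (fun n => xq (f n)).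
    by move=> fr; have := rec_pw fr => ?; rewrite /xq; apply: rec_qmk; rec_auto.
  have yr f g : rec_fun A f -> rec_fun A g -> rec_fun A (fun n => yq (f n) (g n)).
    move=> fr gr; rewrite /yq; apply: rec_qmul; [apply: rec_qmax|].
    - by apply: xr; rec_auto.
    - by apply: rec_qmk; rec_auto; apply: rec_lb; rec_auto.
    - by apply: rec_qmk; rec_auto.
  rewrite /F /fanq; apply: rec_qadd; [apply: rec_qadd|]; apply: rec_qdist.
  1,2: by apply: xr; rec_auto.
  1,2: by apply: rec_qmk; [exact: rec_cst|exact: rec_cst|apply: rec_cls; rec_auto].
  1,2: by apply: yr; rec_auto.
exists c => i j n; exists (F (npair i (npair j n))); first exact: cF.
rewrite /F !(npairK1, npairK2) -/(q2r _); apply: le_trans (q2r_fanq _ _ _) _.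
have : invS (2 ^ n.+1) <= 2 ^- n.+1.
  rewrite -natrX lef_pV2 ?posrE ?ltr0n ?expn_gt0// ler_nat; exact: leqnSn.
have : 2 * 2 ^- n.+1 = 2 ^- n :> R by rewrite exprS invfM mulVKf// pnatr_eq0.
lra.
Qed.

(** With Q = 8 N + 7 one has [invS Q = invS N / 8]. Legs of class at most Q have index at most
    [npair Q Q.+2]; the extra place Q + 3 admits one leg standing for all the others, and abscissae
    below 2 ^ (Q + 1) are dense enough by [xpt_dense]. *)
Definition net_bound (N : nat) : nat :=
  (npair (npair (8 * N + 7) (8 * N + 7).+3) (2 ^ (8 * N + 7).+1)).+1.

Lemma fan_net (z : completion M) N :
  exists2 p, (p < net_bound N)%N & dst z (special_point M p) <= invS N.
Proof.
rewrite /net_bound; set Q := (8 * N + 7)%N.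
have QN : invS Q = invS N / 8.
  by rewrite /invS (_ : Q.+1 = 8 * N.+1)%N ?natrM ?invfM 1?mulrC// /Q; lia.
have N0 := invS_gt0 (R := R) N.
have [q zq] := special_dense z (e := invS N / 8) ltac:(lra).
have [m mQ xm] := xpt_dense (R := R) (t := cX q) Q ltac:(by rewrite ltW ?xpt_gt0 ?xpt_le1).
have mQ' : (m <= 2 ^ Q.+1)%N by exact: ltnW.
suff [i iQ Mi] : exists2 i, (i <= npair Q Q.+3)%N & M q (npair i m) <= 3 * invS Q.
  exists (npair i m); first by rewrite ltnS; exact: npair_mono.
  have := dst_tri z (special_point M q) (special_point M (npair i m)).
  by have := dst_special M q (npair i m) => ->; lra.
rewrite distrC in xm.
have [cQ|Qc] := leqP (cls (nfst q)) Q.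
  exists (nfst q).
    by apply: leq_trans (cls_bound cQ) _; apply: npair_mono.
  rewrite /= /fan_dist /cH /cY /cX !npairK1 !npairK2 subrr normr0.
  by have := yy_lip W (nfst q) (xpt (nsnd q) : R) (xpt m); rewrite /cX in xm; lra.
(* A leg of group 0 outside its gluable part, hence alone in its class, and as close to the limit
   arc as all legs of class above [Q]. *)
pose i := npair 0 Q.+3.
have ci : cls i = i by rewrite /cls !npairK1 npairK2.
have iQ : (Q <= i)%N by have := npair_ge 0 Q.+3; rewrite -/i; lia.
exists i; first by apply: npair_mono.
rewrite /= /fan_dist /cH /cY !npairK1 ci {2 4}/cX !npairK2.
have pos := invS_gt0 (R := R).
have h1 : invS (cls (nfst q)) <= invS Q by rewrite invS_le ltnW.
have h2 : invS i <= invS Q by rewrite invS_le.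
have h3 : invS (nfst q) <= invS Q by rewrite invS_le; apply: leq_trans (cls_le _); exact: ltnW.
have y1 := yy_le W (nfst q) (xpt_le1 (R := R) (nsnd q)).
have y2 := yy_le W i (xpt_le1 (R := R) m).
have y3 := yy_ge0 W (nfst q) (ltW (xpt_gt0 (R := R) (nsnd q))).
have y4 := yy_ge0 W i (ltW (xpt_gt0 (R := R) m)).
have a1 : `|invS (cls (nfst q)) - invS i| <= invS Q.
  by have := pos (cls (nfst q)); have := pos i; rewrite ler_norml => ? ?; apply/andP; split; lra.
have a2 : `|yy W (nfst q) (cX q) - yy W i (xpt m)| <= invS Q.
  by rewrite ler_norml /cX; apply/andP; split; lra.
by lra.
Qed.

(** Lebesgue numbers: by compactness a cover has a uniform margin [invS N]. Conversely, a margin of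
    [invS N] at the points of the finite net is enough, and this is a finite Sigma_1 check. *)
Lemma fan_covers : sigma1 A (fun n => covers M (seq_of n)).
Proof.
suff : sigma1 A (fun n => exists N, forall p, (p < net_bound N)%N -> exists2 b, b \in seq_of n &
    M p (nfst b) < q2r (qadd (nsnd b) (qneg (qmk 1 0 N)))).
  apply: s1_ext => n; set s := seq_of n; split=> [[N H] z|cov].
    have [p pB zp] := fan_net z N; have [b bs] := H p pB.
    rewrite q2r_add q2r_neg q2r_invS => pb; exists b => //; rewrite /fball /=.
    have := dst_tri z (special_point M p) (special_point M (nfst b)).
    by have := dst_special M p (nfst b) => ->; lra.
  have [||N H] := compact_near_nat (P := fun N z => exists2 b, b \in s &
      dst z (special_point M (nfst b)) + invS N < q2r (nsnd b)) (@fan_compact R W).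
  - move=> k m z km [b bs bz]; exists b => //; apply: le_lt_trans bz.
    by rewrite lerD2l invS_le.
  - move=> z _; have [b bs] := cov z; rewrite /fball /= => bz.
    pose e := q2r (nsnd b) - dst z (special_point M (nfst b)).
    have e0 : 0 < e by rewrite /e; lra.
    have [N Ne] := invS_lt_ex (e := e / 2) ltac:(lra).
    exists N; apply/nbhs_dstE; exists (e / 2); first by lra.
    move=> w zw; exists b => //; have := dst_tri w z (special_point M (nfst b)).
    by rewrite (dst_sym w z); rewrite /e in Ne zw; lra.
  exists N => p _; have [b bs bp] := H (special_point M p) I; exists b => //.
  by rewrite q2r_add q2r_neg q2r_invS; move: bp; rewrite dst_special; lra.
apply: s1_ex; apply: s1_ball.
  by rewrite /net_bound; rec_auto.
apply: s1_ex_seq; first by rec_auto.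
apply: (proj1 (s1_lt fan_computable _ _ _)); rec_auto.
Qed.

End FanComputable.

(** * Invariance under homeomorphism and the spectrum *)

Lemma infinite_of_inj (A : set nat) (e : nat -> nat) : injective e ->
  (forall k, A (e k)) -> infinite_set A.
Proof.
move=> ei eA; apply: (@sub_infinite_set _ (range e)); first by move=> _ [k _ <-].
rewrite (eq_finite_set (inj_card_eq _)); first exact: infinite_nat.
by move=> x y _ _; exact: ei.
Qed.

(** A bijection of the sets and one of their complements are put together; this matches good groups
    with good and bad with bad. *)
Lemma nat_bij_sets (A B : set nat) : infinite_set A -> infinite_set (~` A) ->
  infinite_set B -> infinite_set (~` B) ->
  exists s t : nat -> nat, [/\ cancel s t, cancel t s & forall u, A u <-> B (s u)].
Proof.
have bij (X Y : set nat) : infinite_set X -> infinite_set Y -> exists f, set_bij X Y f.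
  move=> iX iY; apply/card_set_bijP.
  apply: card_eq_trans (eq_card_nat (countableP _) iX) _.
  by rewrite card_eq_sym; exact: eq_card_nat (countableP _) iY.
move=> iA iA' iB iB'.
have [f [fh fi fs]] := bij _ _ iA iB; have [h [hh hi hs]] := bij _ _ iA' iB'.
pose s u := if `[< A u >] then f u else h u.
have sA u : A u -> s u = f u by move=> Au; rewrite /s asboolT.
have sA' u : ~ A u -> s u = h u by move=> Au; rewrite /s asboolF.
have sP u : A u <-> B (s u).
  split=> [Au|Bs]; first by rewrite sA//; exact: fh.
  by apply: contrapT => nA; have : (~` B) (s u) by rewrite sA'//; exact: hh.
have si : injective s.
  move=> u v suv; have [Au|nAu] := pselect (A u).
    have Av : A v by apply/sP; rewrite -suv; exact/sP.
    by apply: fi; rewrite ?inE// -sA// -(sA v).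
  have nAv : ~ A v by move=> /sP; rewrite -suv => /sP.
  by apply: hi; rewrite ?inE// -sA'// -(sA' v).
have /choice[t tP] : forall v, exists u, s u = v.
  move=> v; have [Bv|nBv] := pselect (B v).
    by have [u Au <-] := fs v Bv; exists u; exact: sA.
  by have [u Au <-] := hs v nBv; exists u; exact: sA'.
by exists s, t; split=> // u; apply: si; rewrite tP.
Qed.

Lemma homeomorphic_sym (X Y : topologicalType) : homeomorphic X Y -> homeomorphic Y X.
Proof. by move=> [f [g [? ? ? ?]]]; exists g, f. Qed.

Lemma homeomorphic_compact (X Y : topologicalType) : homeomorphic X Y ->
  compact [set: X] -> compact [set: Y].
Proof.
move=> [f [g [fK gK cf cg]]] cX.
have -> : [set: Y] = f @` [set: X] by apply/seteqP; split=> // y _; exists (g y).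
apply: continuous_compact => //; exact: continuous_subspaceT.
Qed.

Lemma homeomorphic_fan_like (R : realType) (X Y : topologicalType) (D : set nat) :
  homeomorphic X Y -> fan_like R Y D -> fan_like R X D.
Proof.
move=> [h [g [hK gK ch cg]]] [f [leg [grp [cf cl con pt [gP dis den sz]]]]].
have pre (S : set Y) : h @^-1` S = g @` S.
  apply/seteqP; split=> [x Sx|_ [y Sy <-]]; first by exists (h x).
  by rewrite /= gK.
have precon (S : set Y) : connected S -> connected (h @^-1` S).
  move=> cS; rewrite pre; apply: connected_continuous_connected => //.
  exact: continuous_subspaceT.
exists (f \o h), (fun i => h @^-1` leg i), grp; split.
- by move=> x; apply: continuous_comp; [exact: ch|exact: cf].
- by move=> i; apply: closed_comp => // x _; exact: ch.
- by move=> i; exact: precon (con i).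
- by move=> i; have [y ly fy] := pt i; exists (g y); rewrite /= gK.
split=> //.
- move=> i; have [h1 h2 h3 h4] := gP i; split=> //; last exact: precon h4.
  by apply: open_comp h3 => x _; exact: ch.
- by move=> i j k z; exact: dis.
- move=> U oU [x Ux].
  have oU' : open (g @^-1` U) by apply: open_comp oU => ? _; exact: cg.
  have [|i [y [Uy ly]]] := den _ oU'; first by exists (h x); rewrite /= hK.
  by exists i, (g y); split=> //=; rewrite gK.
Qed.

Lemma sigma2_normal (A D : set nat) : sigma2 A D ->
  exists2 Q : nat -> nat -> nat -> Prop,
    rec_dec A (fun m => Q (nfst m) (nfst (nsnd m)) (nsnd (nsnd m))) &
    forall n, D n <-> exists a, forall b, Q n a b.
Proof.
move=> [S [Q Qd QP] SD].
exists (fun n a b => ~ Q (npair n a) b).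
  apply: dec_not.
  have r : rec_fun A (fun m => npair (npair (nfst m) (nfst (nsnd m))) (nsnd (nsnd m))) by rec_auto.
  by apply: dec_ext (dec_comp Qd r) => m; rewrite npairK1 npairK2.
have QP' n a : S n a <-> exists b, Q (npair n a) b by rewrite -QP npairK1 npairK2.
move=> n; rewrite SD; split=> -[a h]; exists a; last by move=> /QP'[b]; exact: h.
by move=> b Qb; apply: h; apply/QP'; exists b.
Qed.

Lemma fan_presentation (R : realType) (A : set nat) (W : nat -> nat -> Prop)
    (Z : topologicalType) : rec_dec A (fun m => W (nfst m) (nsnd m)) ->
  homeomorphic (completion (fan_metric W : nat_metric R)) Z ->
  exists P : compact_presentation R Z, computable_presentation A P.
Proof.
move=> Wd hom; set M := fan_metric W : nat_metric R.
have [E0 cE0] : exists E, cover_code M E.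
  have [s _ sT] := finite_balls (G := fun=> True) (@fan_compact R W)
    (fun z _ => let: ex_intro2 b _ bz := small_ball z ltr01 in ex_intro2 _ _ b I bz).
  have : fset_nums (cover_code M) (seq_num s).
    by apply/fset_nums_covers; rewrite seq_ofK => z; exact: sT.
  by move=> [t _ ct]; eexists; exact: ct.
(* All finite sets are enumerated, with the fixed cover [E0] in place of those that do not cover;
   effectivity is carried by the set of codes and not by this enumeration. *)
pose en n : {fset nat * rat} :=
  if (choice.unpickle n : option {fset nat * rat}) is Some E then if `[< cover_code M E >] then E else E0 else E0.
have enP : range en = cover_code M.
  apply/seteqP; split=> [_ [n _ <-]|E cE].
    by rewrite /en; case: choice.unpickle => // E; case: asboolP.
  by exists (choice.pickle E) => //; rewrite /en choice.pickleK asboolT.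
exists (CompactPresentation hom enP); split; first exact: fan_computable.
apply/ce_in_sigma1; apply: s1_ext (@fan_covers R A W Wd) => n.
by split=> /fset_nums_covers.
Qed.

(** Groups are numbered <n, <a, k>>. Those with k = 0 are bad, and those with k > 0 all repeat the
    same test, so that for every n the good groups are none or infinitely many, and the bad ones
    infinitely many, whatever the oracle and the normal form. *)
Lemma fan_spectrum (R : realType) (D A : set nat) :
  let W0 g (b : nat) := nsnd (nsnd g) <> 0%N /\ D (nfst g) in
  (exists P : compact_presentation R (completion (fan_metric W0 : nat_metric R)),
    computable_presentation A P) <-> sigma2 A D.
Proof.
move=> W0; set Z := completion _.
have fZ : fan_like R Z D.
  apply: fan_space_fan_like => n; split=> [Dn|[g <- /(_ 0%N)[]//]].
  by exists (npair n (npair 0 1)); rewrite ?npairK1// => b; rewrite /W0 npairK1 !npairK2.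
split=> [[[M hom en enP] [/= cM ceM]]|/sigma2_normal[Q Qd DQ]].
  apply: (fan_sigma2 cM).
  - by move/ce_in_sigma1: ceM; apply: s1_ext => n; exact: fset_nums_covers.
  - exact: homeomorphic_compact (homeomorphic_sym hom) (@fan_compact R W0).
  - exact: homeomorphic_fan_like hom fZ.
pose W g b := nsnd (nsnd g) <> 0%N /\ Q (nfst g) (nfst (nsnd g)) b.
have Wd : rec_dec A (fun m => W (nfst m) (nsnd m)).
  apply: dec_and; first by dec_auto.
  have r : rec_fun A (fun m => npair (nfst (nfst m)) (npair (nfst (nsnd (nfst m))) (nsnd m))) by rec_auto.
  by apply: dec_ext (dec_comp Qd r) => m; rewrite !(npairK1, npairK2).
apply: (fan_presentation Wd).
pose G n u := forall b, W (npair n u) b; pose G0 n u := forall b, W0 (npair n u) b.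
have GE n u : G n u <-> nsnd u <> 0%N /\ forall b, Q n (nfst u) b.
  rewrite /G /W npairK1 npairK2; split=> [h|[h1 h2] b]; last by split.
  by split=> [|b]; [have [] := h 0%N|have [] := h b].
have G0E n u : G0 n u <-> nsnd u <> 0%N /\ D n.
  by rewrite /G0 /W0 npairK1 npairK2; split=> [/(_ 0%N)|].
(* The groups of each n are permuted separately: if [D n] holds, good and bad groups are infinite in
   number on both sides; otherwise no group is good on either side and the identity will do. *)
have /choice[s /choice[t stP]] : forall n, exists s, exists t : nat -> nat,
    [/\ cancel s t, cancel t s & forall u, G n u <-> G0 n (s u)].
  move=> n; have [Dn|nDn] := pselect (D n); last first.
    exists id, id; split=> // u; rewrite GE G0E; split=> [[_ h]|[]//].
    by case: nDn; apply/DQ; exists (nfst u).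
  have [a Qa] := (DQ n).1 Dn.
  have j1 x : injective (fun k => npair x k.+1) by move=> k k' /npair_inj[_ []].
  have j2 : injective (fun k => npair k 0) by move=> k k' /npair_inj[].
  apply: nat_bij_sets.
  - by apply: (infinite_of_inj (j1 a)) => k; apply/GE; rewrite npairK1 npairK2.
  - by apply: (infinite_of_inj j2) => k /GE; rewrite npairK2 => -[].
  - by apply: (infinite_of_inj (j1 0%N)) => k; apply/G0E; rewrite npairK2.
  - by apply: (infinite_of_inj j2) => k /G0E; rewrite npairK2 => -[].
apply: (@fan_homeomorphic R W W0 (fun g => npair (nfst g) (s (nfst g) (nsnd g)))
  (fun g => npair (nfst g) (t (nfst g) (nsnd g)))).
- by move=> g; have [st _ _] := stP (nfst g); rewrite npairK1 npairK2 st nfst_nsndK.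
- by move=> g; have [_ ts _] := stP (nfst g); rewrite npairK1 npairK2 ts nfst_nsndK.
- by move=> g; rewrite npairK1.
- by move=> g; have [_ _ h] := stP (nfst g); have := h (nsnd g); rewrite /G nfst_nsndK.
Qed.

Theorem theorem3p3 (R : realType) (d : turing_degree) :
  exists Z : topologicalType,
    [/\ compact [set: Z], metrizable R Z &
        compact_degree_spectrum R Z = [set x | degree_le d (degree_jump x)]].
Proof.
pose D : set nat := [set q | nsnd q = (nfst q \in repr d)].
pose W0 g (b : nat) := nsnd (nsnd g) <> 0%N /\ D (nfst g).
exists (completion (fan_metric W0 : nat_metric R)); split.
- exact: fan_compact.
- by exists (completion (fan_metric W0 : nat_metric R)), id, id; split=> // z; exact: cvg_id.
apply/seteqP; split=> x /=; rewrite /compact_degree_spectrum /= fan_spectrum -turing_le_jumpP.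
all: have [J1 J2] := turing_le_repr (turing_jump (repr x)).
all: by rewrite /degree_le /degree_jump => h; apply: turing_le_trans h _.
Qed.
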